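(* Let $d\ge 2$, let $\Omega\subset\mathbb{R}^d$ be a bounded domain with Lipschitz boundary, let $\mu\in L^\infty(\Omega)$ with $\mu\ge 0$ a.e., and let $p,q:\Omega\times[0,\infty)\to[2,\infty)$ be Carathéodory functions satisfying: (a) $2\le p^-:=\operatorname{ess\,inf}_{\Omega\times[0,\infty)}p\le p^+:=\operatorname{ess\,sup}_{\Omega\times[0,\infty)}p\le d$, $\ 2\le q^-:=\operatorname{ess\,inf}_{\Omega\times[0,\infty)}q\le q^+:=\operatorname{ess\,sup}_{\Omega\times[0,\infty)}q<+\infty$, and $p(x,t)\le q(x,t)$ for a.a. $x\in\Omega$ and all $t\ge0$; (b) for a.a. $x\in\Omega$ the functions $t\mapsto p(x,t)$ and $t\mapsto q(x,t)$ are continuous, constant on $[0,1]$ (equal to some $p(x)$ and $q(x)$ respectively), and nondecreasing on $[1,\infty)$; (c) $\mu\in C^{0,1}(\overline\Omega)$, and there exist $c_p,c_q>0$ with $|p(x,t)-p(y,t)|\le c_p|x-y|$ and $|q(x,t)-q(y,t)|\le c_q|x-y|$ for all $t\ge 0$ and all $x,y\in\Omega$; (d) $\frac{q^+}{p^-}<1+\frac1d$. Then the functional $I:W_0^{1,\mathcal{H}}(\Omega)\to\mathbb{R}$, $I(u)=\int_\Omega\mathcal{H}(x,|\nabla u|)\,dx$, is well-defined and belongs to $C^1(W_0^{1,\mathcal{H}}(\Omega),\mathbb{R})$, with $I'(u)=A(u)$ for all $u\in W_0^{1,\mathcal H}(\Omega)$, where $$\langle A(u),v\rangle=\int_\Omega\left(|\nabla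 u|^{p(x,|\nabla u|)-2}\nabla u\cdot\nabla v+\mu(x)|\nabla u|^{q(x,|\nabla u|)-2}\nabla u\cdot\nabla v\right)dx,\quad u,v\in W_0^{1,\mathcal{H}}(\Omega).$$
   Context: $h(x,t)=|t|^{p(x,|t|)-2}t+\mu(x)|t|^{q(x,|t|)-2}t$ for $t\ne0$, $h(x,0)=0$; $\mathcal{H}(x,t)=\int_0^t h(x,s)\,ds$. $L^{\mathcal{H}}(\Omega)=\{u \text{ measurable}:\rho_{\mathcal H}(u):=\int_\Omega\mathcal{H}(x,u)\,dx<\infty\}$ with the Luxemburg norm $\|u\|_{L^{\mathcal H}(\Omega)}=\inf\{\lambda>0:\rho_{\mathcal{H}}(u/\lambda)\le1\}$. $W^{1,\mathcal{H}}(\Omega)=\{u\in L^{\mathcal{H}}(\Omega):|\nabla u|\in L^{\mathcal{H}}(\Omega)\}$ with norm $\|u\|_{L^{\mathcal{H}}(\Omega)}+\||\nabla u|\|_{L^{\mathcal{H}}(\Omega)}$, and $W_0^{1,\mathcal{H}}(\Omega)$ is the completion of $C_0^\infty(\Omega)$ in $W^{1,\mathcal{H}}(\Omega)$. $\langle\cdot,\cdot\rangle$ is the duality pairing between $W_0^{1,\mathcal{H}}(\Omega)$ and its dual. *)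

(* Defs.v *)
From HB Require Import structures.
From mathcomp Require Import all_boot all_order all_algebra.
From mathcomp Require Import all_classical all_reals all_analysis.
From mathcomp Require Import ess_sup_inf.

Set Implicit Arguments.
Unset Strict Implicit.
Unset Printing Implicit Defensive.

Import Order.TTheory GRing.Theory Num.Theory.
Import numFieldNormedType.Exports.

Local Open Scope classical_set_scope.
Local Open Scope ring_scope.

HB.instance Definition _ (R : realType) (n : nat) :=
  @isMeasurable.Build (sigma_display (@open 'rV[R]_n)) 'rV[R]_n
    <<s @open 'rV[R]_n >> (@sigma_algebra0 _ setT _)
    (@sigma_algebraC _ _) (@sigma_algebra_bigcup _ setT _).

Section rV_measurable.
Context {R : realType}.

Lemma open_measurable_rV n (U : set 'rV[R]_n) : open U -> measurable U.
Proof. by move=> oU; exact: sub_sigma_algebra. Qed.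

Lemma measurable_rV_coord n (i : 'I_n) :
  measurable_fun [set: 'rV[R]_n] (fun v : 'rV[R]_n => v ord0 i).
Proof.
apply: (measurability (@measurable_realfun.RGenOpens.G R)).
  exact: measurable_realfun.RGenOpens.measurableE.
move=> _ [_ [a [b ->]] <-]; rewrite setTI; apply: open_measurable_rV.
apply: open_comp; last exact: interval_open.
by move=> v _; exact: coord_continuous.
Qed.

Lemma measurable_fun_rV d (T : measurableType d) n (f : T -> 'rV[R]_n) :
  (forall i, measurable_fun [set: T] (fun t => f t ord0 i)) ->
  measurable_fun [set: T] f.
Proof.
move=> mf; apply: (measurability (@open 'rV[R]_n)) => //.
move=> _ [U oU <-]; rewrite setTI.
pose B (qr : 'rV[rat]_n * rat) : set 'rV[R]_n :=
  ball (map_mx ratr qr.1 : 'rV[R]_n) (ratr qr.2 : R).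
have -> : U = \bigcup_qr (if `[< B qr `<=` U >] then B qr else set0).
  apply/seteqP; split => [v Uv|v [qr _]]; last by case: asboolP => [BU /BU|].
  have /nbhs_ballP[e /= e0 eU] := open_nbhs_nbhs (conj oU Uv).
  have e2 : 0 < e / 2 by rewrite divr_gt0.
  have [r] := rat_in_itvoo e2; rewrite in_itv/= => /andP[r0 re].
  have /choice[q qP] : forall i, exists q : rat, `|ratr q - v ord0 i| < ratr r.
    move=> i; have := @rat_in_itvoo R (v ord0 i - ratr r) (v ord0 i + ratr r).
    by case=> [|q]; [rewrite ltrD2l gtrN|rewrite in_itv/= -ltr_distl; exists q].
  exists (\row_i q i, r) => //; rewrite /B/=; case: asboolP => [_|[]].
    by split => // i j; rewrite !mxE (ord1 i); exact: qP.
  apply: subset_trans eU => w [_ qw]; split => // i j.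
  rewrite (ord1 i) [e]splitr; apply: (@ball_triangle _ R (ratr (q j) : R)).
    by apply: ball_sym; apply: lt_trans re; exact: qP.
  by apply: lt_trans re; have := qw ord0 j; rewrite !mxE.
rewrite preimage_bigcup; apply: countable_bigcupT_measurable => // -[q r].
case: asboolP => _; last by rewrite preimage_set0.
have [r0|r0] := leP (ratr r : R) 0.
  rewrite (_ : _ @^-1` _ = set0)// -subset0 => t [/=].
  by rewrite ltNge r0.
rewrite (_ : _ @^-1` _ = \bigcap_(i in [set: 'I_n])
    ((fun t => f t ord0 i) @^-1` ball (ratr (q ord0 i) : R) (ratr r))).
  apply: fin_bigcap_measurable => // i _.
  rewrite -[X in measurable X]setTI; apply: mf => //.
  exact: measurable_realfun.measurable_ball.
apply/seteqP; split => [t [_ qt] i _|t qt]; first by have := qt ord0 i; rewrite mxE.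
by split => // i j; rewrite (ord1 i) mxE; exact: qt.
Qed.

End rV_measurable.

Section lebesgue_rV.
Context {R : realType}.
Local Open Scope ereal_scope.

Definition rV_cons n (x : measurableTypeR R * 'rV[R]_n) : 'rV[R]_n.+1 :=
  row_mx (const_mx x.1 : 'M[R]_1) x.2.

Definition rV_uncons n (v : 'rV[R]_n.+1) : measurableTypeR R * 'rV[R]_n :=
  (v ord0 ord0, \row_i v ord0 (lift ord0 i)).

Lemma rV_cons0 n (x : measurableTypeR R * 'rV[R]_n) : rV_cons x ord0 ord0 = x.1.
Proof.
rewrite /rV_cons (_ : ord0 = lshift n (ord0 : 'I_1)); last exact/val_inj.
by rewrite (row_mxEl (const_mx x.1 : 'M[R]_1)) mxE.
Qed.

Lemma rV_consS n (x : measurableTypeR R * 'rV[R]_n) i : rV_cons x ord0 (lift ord0 i) = x.2 ord0 i.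
Proof.
rewrite /rV_cons (_ : lift ord0 i = rshift 1 i); last exact/val_inj.
by rewrite (row_mxEr (const_mx x.1 : 'M[R]_1)).
Qed.

Lemma rV_consK n : cancel (@rV_cons n) (@rV_uncons n).
Proof.
move=> [x v]; congr pair => /=; first exact: rV_cons0.
by apply/rowP => i; rewrite mxE rV_consS.
Qed.

Lemma measurable_rV_cons n : measurable_fun setT (@rV_cons n).
Proof.
apply: measurable_fun_rV => i; case: (unliftP ord0 i) => [j ->|->].
  under eq_fun do rewrite rV_consS.
  exact: measurableT_comp (measurable_rV_coord j) measurable_snd.
by under eq_fun do rewrite rV_cons0; exact: measurable_fst.
Qed.

Lemma measurable_rV_uncons n : measurable_fun setT (@rV_uncons n).
Proof.
apply: measurable_fun_pair; first exact: measurable_rV_coord.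
apply: measurable_fun_rV => i.
by under eq_fun do rewrite mxE; exact: measurable_rV_coord.
Qed.

Section step.
Variables (n : nat) (m : {sigma_finite_measure set 'rV[R]_n -> \bar R}).

Definition lebesgue_rV_step : set 'rV[R]_n.+1 -> \bar R :=
  pushforward (@lebesgue_measure R \x m) (@rV_cons n).

Let step0 : lebesgue_rV_step set0 = 0.
Proof. by rewrite /lebesgue_rV_step /pushforward preimage_set0 measure0. Qed.

Let step_ge0 A : 0 <= lebesgue_rV_step A.
Proof. exact: (measure_ge0 (@lebesgue_measure R \x m)). Qed.

Let step_sigma_additive : semi_sigma_additive lebesgue_rV_step.
Proof.
move=> F mF tF mUF; rewrite /lebesgue_rV_step /pushforward preimage_bigcup.
apply: measure_semi_sigma_additive.
- by move=> i; rewrite -[X in measurable X]setTI; exact: measurable_rV_cons.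
- apply/trivIsetP => /= i j _ _ ij; rewrite -preimage_setI.
  by move/trivIsetP : tF => /(_ _ _ _ _ ij) ->//; rewrite preimage_set0.
- rewrite -preimage_bigcup -[X in measurable X]setTI.
  exact: measurable_rV_cons.
Qed.

HB.instance Definition _ := isMeasure.Build _ _ _ lebesgue_rV_step
  step0 step_ge0 step_sigma_additive.

Let step_sigma_finite : sigma_finite [set: 'rV[R]_n.+1] lebesgue_rV_step.
Proof.
have /sigma_finiteP[A [AT ndA Aoo]] := sigma_finiteT (@lebesgue_measure R).
have /sigma_finiteP[B [BT ndB Boo]] := sigma_finiteT m.
exists (fun k => @rV_uncons n @^-1` (A k `*` B k)).
  rewrite -preimage_bigcup (_ : \bigcup_k _ = setT) ?preimage_setT//.
  apply/seteqP; split => // -[x v] _.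
  have [i _ Aix] : (\bigcup_k A k) x by rewrite -AT.
  have [j _ Bjv] : (\bigcup_k B k) v by rewrite -BT.
  exists (maxn i j) => //; split => /=.
  - by move: x Aix; exact/subsetPset/ndA/leq_maxl.
  - by move: v Bjv; exact/subsetPset/ndB/leq_maxr.
move=> k; have [mAk Akoo] := Aoo k; have [mBk Bkoo] := Boo k; split.
  rewrite -[X in measurable X]setTI.
  by apply: measurable_rV_uncons => //; exact: measurableX.
rewrite /lebesgue_rV_step /pushforward -comp_preimage.
rewrite (_ : @rV_uncons n \o @rV_cons n = idfun) ?preimage_id.
  by rewrite product_measure1E// lte_mul_pinfty// ge0_fin_numE.
by apply/funext => x /=; rewrite rV_consK.
Qed.

HB.instance Definition _ := Measure_isSigmaFinite.Build _ _ _ lebesgue_rV_step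
  step_sigma_finite.

End step.

(* Lebesgue measure on the Borel sets of [R^n], as an iterated product; it is
   determined by [lebesgue_rV_box] below. *)
Fixpoint lebesgue_rV n : {sigma_finite_measure set 'rV[R]_n -> \bar R} :=
  if n is n'.+1 return {sigma_finite_measure set 'rV[R]_n -> \bar R}
  then lebesgue_rV_step (lebesgue_rV n') else \d_(0%R : 'rV[R]_0).

Lemma lebesgue_rV_box n (a b : 'rV[R]_n) :
  (forall i, a ord0 i <= b ord0 i)%R ->
  lebesgue_rV n [set v | forall i, (a ord0 i < v ord0 i <= b ord0 i)%R] =
  (\prod_(i < n) (b ord0 i - a ord0 i))%:E.
Proof.
elim: n => [|n IHn] in a b *; move=> ab.
  rewrite big_ord0 /= diracE mem_set// => -[].
  by [].
rewrite /= /lebesgue_rV_step /pushforward.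
set A := (X in (_ \x _) X).
have -> : A = `]a ord0 ord0, b ord0 ord0]%classic `*`
    [set v : 'rV[R]_n | forall i : 'I_n, (a ord0 (lift ord0 i) < v ord0 i <= b ord0 (lift ord0 i))%R].
  apply/seteqP; split => x.
    move=> /= H; split => [|i]; first by have := H ord0; rewrite rV_cons0 in_itv.
    by have := H (lift ord0 i); rewrite rV_consS.
  move=> [/= H0 HS] i; case: (unliftP ord0 i) => [j ->|->].
    by rewrite rV_consS.
  by rewrite rV_cons0; rewrite in_itv in H0.
have := IHn (\row_i a ord0 (lift ord0 i))%R (\row_i b ord0 (lift ord0 i))%R.
set B := (X in lebesgue_rV n X); set C := (X in _ `*` X).
have -> : B = C.
  apply/seteqP; split => v H i; have := H i; by rewrite !mxE.
move=> IH; rewrite product_measure1E//; last first.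
  rewrite (_ : C = \bigcap_(i in [set: 'I_n]) ((fun v => v ord0 i) @^-1`
    `]a ord0 (lift ord0 i), b ord0 (lift ord0 i)]%classic)).
    apply: fin_bigcap_measurable => // i _.
    by rewrite -[X in measurable X]setTI; exact: measurable_rV_coord.
  apply/seteqP; split => [v H i _|v H i]; first by rewrite /= in_itv; exact: H.
  by have := H i I; rewrite /= in_itv.
rewrite IH => [|i]; last by rewrite !mxE; exact: ab.
have := lebesgue_measure_itv `]a ord0 ord0, b ord0 ord0]; rewrite /= lte_fin => ->.
rewrite big_ord_recl EFinM.
have [_|ba] := ltP; first by rewrite EFinB; congr (_ * _%:E); apply: eq_bigr => i _; rewrite !mxE.
have -> : b ord0 ord0 = a ord0 ord0 by apply/eqP; rewrite eq_le ba ab.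
by rewrite subrr !mul0e.
Qed.

End lebesgue_rV.

Section domains.
Context {R : realType} {d : nat}.
Implicit Type Om : set 'rV[R]_d.

Definition edot n (v w : 'rV[R]_n) : R := \sum_(i < n) v ord0 i * w ord0 i.

(* The library's norm on ['rV[R]_n] is the maximum norm. *)
Definition enorm n (v : 'rV[R]_n) : R := Num.sqrt (edot v v).

Definition bounded_domain Om :=
  [/\ Om !=set0, open Om, connected Om & bounded_set Om].

(* Near each boundary point [x0], and in the orthonormal coordinates centred at
   [x0] given by the columns of [E] (the first [d - 1]) and by [e] (the last
   one), [Om] is the part of a ball lying strictly above a Lipschitz graph. *)
Definition lipschitz_boundary Om :=
  forall x0, (closure Om `\` Om°) x0 ->
  exists (E : 'M[R]_(d, d.-1)) (e : 'cV[R]_d) (gamma : 'rV[R]_d.-1 -> R)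
         (L r : R),
    [/\ [/\ E^T *m E = 1%:M, E^T *m e = 0 & e^T *m e = 1%:M],
        forall a b, `|gamma a - gamma b| <= L * enorm (a - b),
        0 < r &
        forall x, enorm (x - x0) < r ->
          (Om x <-> gamma ((x - x0) *m E) < ((x - x0) *m e) ord0 ord0)].

Definition ess_sup_on d' (T : measurableType d') (m : {measure set T -> \bar R})
    (D : set T) (f : T -> R) : \bar R :=
  ess_sup m (patch (fun=> -oo%E) D (EFin \o f)).

Definition ess_inf_on d' (T : measurableType d') (m : {measure set T -> \bar R})
    (D : set T) (f : T -> R) : \bar R :=
  ess_inf m (patch (fun=> +oo%E) D (EFin \o f)).

Definition halfline : set (measurableTypeR R) := `[0, +oo[%classic.

(* Essential bounds over [Om `*` [0, +oo[] for the (d+1)-dimensional measure. *)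
Definition exp_inf Om (p : 'rV[R]_d -> R -> R) : \bar R :=
  ess_inf_on (lebesgue_rV d \x @lebesgue_measure R)%E (Om `*` halfline)
    (fun z => p z.1 z.2).

Definition exp_sup Om (p : 'rV[R]_d -> R -> R) : \bar R :=
  ess_sup_on (lebesgue_rV d \x @lebesgue_measure R)%E (Om `*` halfline)
    (fun z => p z.1 z.2).

Definition caratheodory Om (p : 'rV[R]_d -> R -> R) :=
  (forall t, 0 <= t -> measurable_fun Om (p ^~ t)) /\
  (\forall x \ae lebesgue_rV d, Om x -> {within `[0, +oo[, continuous (p x)}).

Definition exponent_shape (r : R -> R) :=
  [/\ {within `[0, +oo[, continuous r},
      forall s t, 0 <= s <= 1 -> 0 <= t <= 1 -> r s = r t &
      forall s t, 1 <= s -> s <= t -> r s <= r t].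

End domains.

Section sobolev.
Context {R : realType} {d : nat}.
Variable Om : set 'rV[R]_d.
Local Notation lam := (lebesgue_rV d).
Implicit Types (u v phi : 'rV[R]_d -> R).

Definition partial (i : 'I_d) u : 'rV[R]_d -> R :=
  fun x => 'D_(delta_mx ord0 i) (u : 'rV[R]_d -> R^o) x.

Definition iter_partial (s : seq 'I_d) u := foldr partial u s.

Definition smooth u :=
  forall s x, differentiable (iter_partial s u : 'rV[R]_d -> R^o) x.

(* C_0^oo(Om), extended by zero to the whole space. *)
Definition test_fun phi :=
  [/\ smooth phi, compact (closure [set x | phi x != 0]) &
      closure [set x | phi x != 0] `<=` Om].

Definition loc_integrable u :=
  measurable_fun Om u /\
  forall K, K `<=` Om -> compact K -> (\int[lam]_(x in K) `|u x|%:E < +oo)%E.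

Definition weak_gradient u (g : 'rV[R]_d -> 'rV[R]_d) :=
  [/\ loc_integrable u, forall i, loc_integrable (fun x => g x ord0 i) &
      forall phi i, test_fun phi ->
        \int[lam]_(x in Om) (u x * partial i phi x) =
        - \int[lam]_(x in Om) (g x ord0 i * phi x)].

Definition weakly_differentiable u := exists g, weak_gradient u g.

(* Some representative of the weak gradient, which is unique only up to
   equality almost everywhere in [Om]. *)
Definition grad u : 'rV[R]_d -> 'rV[R]_d :=
  xget (fun=> 0) [set g | weak_gradient u g].

Variable H : 'rV[R]_d -> R -> R.

Definition modular u : \bar R := (\int[lam]_(x in Om) (H x (u x))%:E)%E.

(* Measurable means Borel measurable: a Lebesgue measurable function agrees
   almost everywhere with a Borel one, so the classes modulo equality almost
   everywhere are the usual ones. *)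
Definition LH u := measurable_fun Om u /\ (modular u < +oo)%E.

Definition lux_norm u : R :=
  inf [set l | 0 < l /\ (modular (fun x => u x / l)%R <= 1)%E].

Definition W1H u :=
  [/\ LH u, weakly_differentiable u & LH (fun x => enorm (grad u x))].

Definition W1H_norm u : R := lux_norm u + lux_norm (fun x => enorm (grad u x)).

(* The elements of W_0^{1,H} are represented by functions, not by classes of
   functions modulo equality almost everywhere in [Om]; on them [W1H_norm] is a
   seminorm whose kernel is that equality. *)
Definition W01H u :=
  W1H u /\
  forall eps, 0 < eps -> exists2 phi, test_fun phi & W1H_norm (u - phi) < eps.

Definition gradient_energy u : R :=
  \int[lam]_(x in Om) H x (enorm (grad u x)).

End sobolev.

(* Calculus on a linear subspace [W] of [V] (semi)normed by [N]. *)
Section frechet.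
Context {R : realType} {V : lmodType R}.
Variables (W : set V) (N : V -> R).

Definition dual_norm (L : V -> R) : \bar R :=
  ereal_sup [set `|L v|%:E | v in [set v | W v /\ N v <= 1]].

Definition in_dual (L : V -> R) :=
  (forall a v w, W v -> W w -> L (a *: v + w) = a * L v + L w) /\
  (dual_norm L < +oo)%E.

Definition frechet_derivative (F : V -> R) (u : V) (L : V -> R) :=
  in_dual L /\
  forall eps, 0 < eps -> exists2 delta, 0 < delta &
    forall v, W v -> N v < delta -> `|F (u + v) - F u - L v| <= eps * N v.

(* [F] is of class C^1 on [W] and its derivative at [u] is [dF u]. *)
Definition C1_with_derivative (F : V -> R) (dF : V -> V -> R) :=
  (forall u, W u -> frechet_derivative F u (dF u)) /\
  (forall u, W u -> forall eps, 0 < eps -> exists2 delta, 0 < delta &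
    forall w, W w -> N (w - u) < delta ->
      (dual_norm (fun v => dF w v - dF u v)%R <= eps%:E)%E).

End frechet.

Section double_phase.
Context {R : realType} {d : nat}.
Variables (p q : 'rV[R]_d -> R -> R) (mu : 'rV[R]_d -> R).

Definition dp_h (x : 'rV[R]_d) (t : R) : R :=
  if t == 0 then 0 else
  `|t| `^ (p x `|t| - 2) * t + mu x * `|t| `^ (q x `|t| - 2) * t.

(* The oriented integral of [dp_h x] from [0] to [t]. *)
Definition dp_H (x : 'rV[R]_d) (t : R) : R :=
  if 0 <= t then \int[@lebesgue_measure R]_(s in `[0, t]) dp_h x s
  else - \int[@lebesgue_measure R]_(s in `[t, 0]) dp_h x s.

(* At points where [grad u x = 0] the factor [enorm (grad u x) `^ _] may be
   [0 `^ 0 = 1], but the summands vanish because [edot] does. *)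
Definition dp_A_integrand (Om : set 'rV[R]_d) (u v : 'rV[R]_d -> R)
    (x : 'rV[R]_d) : R :=
  let Du := grad Om u x in let Dv := grad Om v x in
  enorm Du `^ (p x (enorm Du) - 2) * edot Du Dv +
  mu x * enorm Du `^ (q x (enorm Du) - 2) * edot Du Dv.

Definition dp_A (Om : set 'rV[R]_d) (u v : 'rV[R]_d -> R) : R :=
  \int[lebesgue_rV d]_(x in Om) dp_A_integrand Om u v x.

End double_phase.

(* Main.v *)
(** The exponents may grow so fast in [t] that [H] fails the Delta_2 condition,
    and the energy need not be finite, let alone differentiable, on all of
    W^{1,H}. It is the density of the test functions in [W01H] that saves the
    day: test functions have bounded gradients, so every multiple of the gradient
    of an element of [W01H] has finite energy. On such gradients the operator
    u |-> h(x, |Du|) Du / |Du| is continuous into the dual space: if the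
    gradients Dw_n converge to Du fast in the Luxemburg norm, then the energies of
    a fixed multiple of Dw_n - Du form a summable sequence of functions in L^1,
    which yields almost everywhere convergence and a dominating function, and
    Young's inequality with a dominated convergence argument conclude. Since H is
    convex in t, the remainder I(u + v) - I(u) - <A(u), v> lies between 0 and
    <A(u + v) - A(u), v>, so the continuity of A gives the Frechet
    differentiability of I.

    Gradients are handled through the uniqueness of weak gradients, which follows
    from the fundamental lemma of the calculus of variations, and the weak
    gradient of a test function is its classical gradient, by integration by
    parts. The hypotheses that hold almost everywhere extend to all of [Om] by
    the Lipschitz bounds in [x]. *)

From mathcomp Require Import all_boot all_order all_algebra.
From mathcomp Require Import all_classical all_reals all_analysis.
From mathcomp Require Import ess_sup_inf.
From mathcomp Require Import measurable_realfun ring lra.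
Require Import Defs.

Import Order.TTheory GRing.Theory Num.Theory.
Import numFieldNormedType.Exports.

Local Open Scope classical_set_scope.
Local Open Scope ring_scope.

Set Implicit Arguments.
Unset Strict Implicit.
Unset Printing Implicit Defensive.

(** * Smooth functions on boxes *)

(** Continuity into the dual must be uniform over directions [w] of which only [\int H(x, w) <= 1]
    is known, and this quantity does not become small. The increment of the operator is therefore
    multiplied by a large [lambda] before Young's inequality is applied: the modular of [w] enters
    with its bound 1, and the final division by [lambda] supplies the smallness. The price is the
    energy of [8 * lambda] times the gradient of [u], which explains why all multiples must have
    finite energy. Almost everywhere convergence removes the points with large increments in the
    limit; at the others Young's inequality is applied at a small level [eta], the same for all [x],
    which relies on power bounds with one exponent [Q] and on the finite measure of [Om]. The
    estimates on [H] rest on the monotonicity of [h(x, t) / t] in [t]: it gives convexity, and it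
    absorbs the factor [lambda] into the argument of [h]. *)

Section smooth_test_functions.
Context {R : realType}.
Implicit Types (f g : R -> R) (k n : nat).

(** The classical [exp(-1/t)] glued to zero. The weights [t^-k] make the family stable under
    differentiation, up to linear combinations. *)
Definition flat k (t : R) : R := if 0 < t then t^-1 ^+ k * expR (- t^-1) else 0.

Lemma flat_ge0 k t : 0 <= flat k t.
Proof.
rewrite /flat; case: ifPn => // t0.
by rewrite mulr_ge0 ?expR_ge0// exprn_ge0// invr_ge0 ltW.
Qed.

(** With [s = 1/t], the single term [s^(k+2) / (k+2)!] of the exponential series beats the weight
    [s^k] with two powers to spare; these yield the zero derivative at the origin. *)
Lemma flat_le_sqr k t : flat k t <= (k.+2)`!%:R * t ^+ 2.
Proof.
rewrite /flat; case: ifPn => [t0|_]; last by rewrite mulr_ge0// sqr_ge0.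
set s := t^-1; have s0 : 0 < s by rewrite invr_gt0.
have -> : t ^+ 2 = (s ^+ 2)^-1 by rewrite -exprVn invrK.
rewrite expRN ler_pdivrMr ?expR_gt0// mulrAC ler_pdivlMr ?exprn_gt0// -exprD addn2.
have /(le_trans _) : s ^+ k.+2 / (k.+2)`!%:R <= expR s.
  by apply: le_trans (expR_ge1Dxn k.+1 (ltW s0)); rewrite lerDr.
by move=> /(_ _ (lexx _)); rewrite ler_pdivrMr ?ltr0n ?fact_gt0// mulrC.
Qed.

Lemma is_derive_sqr_bound f C : (forall h, `|f h| <= C * h ^+ 2) ->
  is_derive (0 : R) 1 f 0.
Proof.
move=> fC.
have f0 : f 0 = 0 by apply/eqP; rewrite -normr_le0 (le_trans (fC 0))// expr0n mulr0.
suff cf : h^-1 *: ((f \o shift 0) (h *: 1) - f 0) @[h --> (0:R)^'] --> (0 : R).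
  by split; [exact: cvgP cf|exact: cvg_lim cf].
apply/norm_cvg0P.
have C0 : (fun h : R => C * `|h|) @ (0:R)^' --> (0 : R).
  rewrite -[X in _ --> X](mulr0 C); apply: cvgMr; rewrite -[X in _ --> X](@normr0 R R).
  by apply: cvg_norm; exact: nbhs_dnbhs.
apply: (squeeze_cvgr _ (cvg_cst 0) C0); near=> h.
rewrite normr_ge0/= f0 subr0 addr0 [h *: 1]mulr1.
have h0 : h != 0 by near: h; exact: nbhs_dnbhs_neq.
rewrite normrM normfV ler_pdivrMl ?normr_gt0//.
by rewrite mulrCA -expr2 real_normK ?num_real// fC.
Unshelve. all: by end_near. Qed.

(** Since [s = 1/t] satisfies [s' = -s^2], differentiation raises the weight by one through the
    power and by two through the exponential. At 0 the quadratic bound applies. *)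
Lemma is_derive_flat k (t : R) :
  is_derive t 1 (flat k) (flat k.+2 t - k%:R * flat k.+1 t).
Proof.
have [t0|t0|->] := ltgtP t 0.
- rewrite /flat (lt_gtF t0) mulr0 subr0.
  apply: (@near_eq_is_derive _ _ _ (cst 0)).
  near=> s; rewrite ifF//; apply/negbTE; rewrite -leNgt ltW//.
  by near: s; exact: lt_nbhsl.
- rewrite /flat t0.
  apply: (@near_eq_is_derive _ _ _ (fun s : R => s^-1 ^+ k * expR (- s^-1))).
    near=> s; rewrite ifT//; near: s; exact: lt_nbhsr.
  have t0' : t != 0 by rewrite gt_eqF.
  have dV : is_derive t 1 (fun s : R => s^-1) (- t ^- 2).
    have := @is_deriveV R id t 1 1 t0' (is_derive_id _ _).
    by move=> /is_derive_eq; apply; rewrite /GRing.scale/= mulr1.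
  have dE : is_derive t 1 (fun s : R => expR (- s^-1)) (expR (- t^-1) * t ^- 2).
    have := @is_derive1_comp R expR (fun s : R => - s^-1) t _ _ (is_derive_expR _) (is_deriveN dV).
    by move=> /is_derive_eq; apply; rewrite opprK.
  have := is_deriveM (is_deriveX k dV) dE; rewrite exprfctE => /is_derive_eq; apply.
  rewrite /GRing.scale/= -!exprVn; clear dV dE; set e := expR _; set s := t^-1.
  by case: k => [|k] /=; rewrite ?mulr0n !exprS; ring.
- rewrite /flat ltxx mulr0 subr0; apply: (@is_derive_sqr_bound _ (k.+2)`!%:R) => h.
  by rewrite ger0_norm ?flat_ge0// flat_le_sqr.
Unshelve. all: by end_near. Qed.

(* A class of smooth functions that is stable under differentiation by
   construction, see [bumpy_derive]. *)
Inductive bumpy : (R -> R) -> Prop :=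
| bumpy_flat k a b : bumpy (fun t => flat k (a * t + b))
| bumpy_scale c f : bumpy f -> bumpy (fun t => c * f t)
| bumpy_add f g : bumpy f -> bumpy g -> bumpy (fun t => f t + g t)
| bumpy_mul f g : bumpy f -> bumpy g -> bumpy (fun t => f t * g t).

Lemma bumpy_derive f : bumpy f ->
  exists2 g, bumpy g & forall t : R, is_derive t 1 f (g t).
Proof.
elim=> [k a b|c {}f _ [f' bf' df']|{}f g _ [f' bf' df'] _ [g' bg' dg']|
    {}f g bf [f' bf' df'] bg [g' bg' dg']].
- exists (fun t => a * (flat k.+2 (a * t + b) + - k%:R * flat k.+1 (a * t + b))).
    apply: bumpy_scale; apply: bumpy_add; first exact: bumpy_flat.
    exact: (bumpy_scale _ (bumpy_flat _ _ _)).
  move=> t.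
  have dl : is_derive t 1 (fun t : R => a * t + b) a.
    have := is_deriveD (is_deriveZ a (is_derive_id t (1:R))) (is_derive_cst b t 1).
    by move=> /is_derive_eq; apply; rewrite addr0 [_ *: 1]mulr1.
  have := @is_derive1_comp _ (flat k) (fun t => a * t + b) t _ _ (is_derive_flat _ _) dl.
  by move=> /is_derive_eq; apply; rewrite mulrC mulNr.
- exists (fun t => c * f' t); first exact: bumpy_scale.
  by move=> t; have := is_deriveZ c (df' t).
- exists (fun t => f' t + g' t); first exact: bumpy_add.
  by move=> t; exact: is_deriveD.
- exists (fun t => f t * g' t + g t * f' t); first by apply: bumpy_add; exact: bumpy_mul.
  by move=> t; exact: is_deriveM.
Qed.

Definition tensor d (f : 'I_d -> R -> R) (x : 'rV[R]_d) : R :=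
  \prod_i f i (x ord0 i).

Lemma differentiable_tensor d (f : 'I_d -> R -> R) x :
  (forall i, bumpy (f i)) -> differentiable (tensor f : 'rV[R]_d -> R^o) x.
Proof.
move=> bf; rewrite /tensor.
elim: (index_enum _) => [|i r IH].
  by under eq_fun do rewrite big_nil; exact: differentiable_cst.
under eq_fun do rewrite big_cons.
apply: (@differentiableM _ _ (fun x : 'rV[R]_d => f i (x ord0 i))) => //.
apply: (@differentiable_comp _ _ _ _ (fun x : 'rV[R]_d => x ord0 i) (f i)).
  exact: differentiable_coord.
have [g _ dg] := bumpy_derive (bf i).
by apply/derivable1_diffP; exact: ex_derive.
Qed.

(** The other factors are constant along the [j]-th axis, so the difference quotients coincide with
    those of a function of one variable. *)
Lemma partial_tensor d (f : 'I_d -> R -> R) (j : 'I_d) g :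
  (forall t : R, is_derive t 1 (f j) (g t)) ->
  partial j (tensor f) = tensor (fun i => if i == j then g else f i).
Proof.
move=> dg; apply/funext => x; rewrite /partial.
pose c := \prod_(i | i != j) f i (x ord0 i).
have -> : tensor (fun i => if i == j then g else f i) x = c * g (x ord0 j).
  rewrite /tensor (bigD1 j)//= eqxx mulrC; congr (_ * _).
  by apply: eq_bigr => i /negbTE ->.
have <- : 'D_1 (fun t => c * f j t) (x ord0 j) = c * g (x ord0 j).
  by have [_] := is_deriveZ c (dg (x ord0 j)).
have E (h : R) : h^-1 *: ((tensor f \o shift x) (h *: delta_mx ord0 j) - tensor f x)
    = h^-1 *: (((fun t => c * f j t) \o shift (x ord0 j)) (h *: 1) -
               (fun t => c * f j t) (x ord0 j)).
  congr (_ *: _); congr (_ - _); last by rewrite /tensor (bigD1 j)//= mulrC.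
  rewrite /= /tensor (bigD1 j)//= mulrC !mxE !eqxx [h *: 1]mulr1 mulr1.
  congr (_ * _); apply: eq_bigr => i ij.
  by rewrite !mxE (negbTE ij) andbF mulr0 add0r.
by rewrite /derive (funext E).
Qed.

Lemma smooth_tensor d (f : 'I_d -> R -> R) :
  (forall i, bumpy (f i)) -> smooth (tensor f).
Proof.
move=> bf s x.
suff [g bg ->] : exists2 g, (forall i, bumpy (g i)) & iter_partial s (tensor f) = tensor g.
  exact: (differentiable_tensor x bg).
elim: s => [|j s [g bg /= ->]]; first by exists f.
have [g' bg' dg] := bumpy_derive (bg j).
rewrite (partial_tensor dg); exists (fun i => if i == j then g' else g i) => // i.
by case: ifP.
Qed.

End smooth_test_functions.

(** * Boxes: compactness, volume, and generation of the Borel sets *)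

Section boxes.
Context {R : realType} {d : nat}.
Implicit Types (a b c x : 'rV[R]_d).
Local Notation lam := (@lebesgue_rV R d).

Definition obox a b : set 'rV[R]_d := [set x | forall i, a ord0 i < x ord0 i < b ord0 i].
Definition cbox a b : set 'rV[R]_d := [set x | forall i, a ord0 i <= x ord0 i <= b ord0 i].

Lemma obox_cbox a b : obox a b `<=` cbox a b.
Proof. by move=> x abx i; have /andP[/ltW -> /ltW ->] := abx i. Qed.

Lemma compact_cbox a b : compact (cbox a b).
Proof.
have : compact [set v : 'rV[R]_d | forall i, `[a ord0 i, b ord0 i]%classic (v ord0 i)].
  apply: (@rV_compact _ _ (fun i => `[a ord0 i, b ord0 i]%classic)) => i.
  exact: segment_compact.
by rewrite (_ : mkset _ = cbox a b)//; apply/seteqP; split => v abv i; have := abv i;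
  rewrite /= in_itv.
Qed.

Lemma compact_closed_rV (K : set 'rV[R]_d) : compact K -> closed K.
Proof. by apply: compact_closed; exact: norm_hausdorff. Qed.

Lemma closed_measurable_rV (K : set 'rV[R]_d) : closed K -> measurable K.
Proof.
move=> cK; rewrite -[K]setCK; apply: measurableC; apply: open_measurable_rV.
exact: closed_openC.
Qed.

Lemma measurable_cbox a b : measurable (cbox a b).
Proof. by apply: closed_measurable_rV; apply: compact_closed_rV; exact: compact_cbox. Qed.

Lemma measurable_rV_itv (J : 'I_d -> interval R) :
  measurable [set v : 'rV[R]_d | forall i, v ord0 i \in J i].
Proof.
rewrite (_ : mkset _ = \bigcap_(i in [set: 'I_d])
    ((fun v : 'rV[R]_d => v ord0 i) @^-1` [set` J i])).
  apply: fin_bigcap_measurable => // i _.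
  by rewrite -[X in measurable X]setTI; exact: measurable_rV_coord.
by apply/seteqP; split => [v H i _|v H i]; [exact: H|exact: (H i Logic.I)].
Qed.

Lemma measurable_obox a b : measurable (obox a b).
Proof.
have := measurable_rV_itv (fun i => `]a ord0 i, b ord0 i[).
by congr measurable; apply/seteqP; split => v H i; have := H i; rewrite in_itv.
Qed.

Lemma measurable_hbox a b :
  measurable [set v : 'rV[R]_d | forall i, a ord0 i < v ord0 i <= b ord0 i].
Proof.
have := measurable_rV_itv (fun i => `]a ord0 i, b ord0 i]).
by congr measurable; apply/seteqP; split => v H i; have := H i; rewrite in_itv.
Qed.

Lemma lebesgue_cbox_lty a b : (lam (cbox a b) < +oo)%E.
Proof.
(* The volume is known for half-open boxes with ordered corners; hence the shift by one, and the
   [min] and [max], which also cover an empty [cbox]. *)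
pose a' : 'rV[R]_d := \row_i (Num.min (a ord0 i) (b ord0 i) - 1).
pose b' : 'rV[R]_d := \row_i (Num.max (a ord0 i) (b ord0 i)).
have ab' i : a' ord0 i <= b' ord0 i.
  by rewrite !mxE lerBlDr (le_trans (_ : _ <= a ord0 i))// ?ge_min ?lexx// ler_wpDr// le_max lexx.
apply: (@le_lt_trans _ _ (lam [set v | forall i, a' ord0 i < v ord0 i <= b' ord0 i])).
  apply: le_measure; rewrite ?inE; [exact: measurable_cbox|exact: measurable_hbox|].
  move=> x abx i; have /andP[ax xb] := abx i; rewrite !mxE le_max xb orbT andbT.
  by rewrite ltrBlDr (@le_lt_trans _ _ (x ord0 i)) ?ltrDl// ge_min ax.
by rewrite lebesgue_rV_box// ltry.
Qed.

Lemma bounded_sub_cbox (K : set 'rV[R]_d) : bounded_set K -> exists M, K `<=` cbox (const_mx (- M)) (const_mx M).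
Proof.
move=> [M [_ /(_ (M + 1))]]; rewrite ltrDl ltr01 => /(_ isT) KM; exists (M + 1) => x Kx i.
rewrite !mxE -ler_norml; apply: le_trans (KM _ Kx).
rewrite /Num.norm/= mx_normrE.
exact: (le_bigmax _ (fun i : 'I_1 * 'I_d => `|x i.1 i.2|) (ord0, i)).
Qed.

Lemma lebesgue_bounded_lty (K : set 'rV[R]_d) : measurable K -> bounded_set K -> (lam K < +oo)%E.
Proof.
move=> mK /bounded_sub_cbox[M KM].
apply: (@le_lt_trans _ _ (lam (cbox (const_mx (- M)) (const_mx M)))); last exact: lebesgue_cbox_lty.
by apply: le_measure; rewrite ?inE//; exact: measurable_cbox.
Qed.

(** The two corners of the cube with centre [cr.1] and half-side [cr.2]; rational data keep the
    family countable. *)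
Definition rat_box (cr : 'rV[rat]_d * rat) : 'rV[R]_d * 'rV[R]_d :=
  (map_mx ratr cr.1 - const_mx (ratr cr.2), map_mx ratr cr.1 + const_mx (ratr cr.2)).

(** The index set asks for the closed boxes to lie in [U]: this is what a bump supported in a box
    needs in order to be a test function on [U]. *)
Lemma open_rat_box (U : set 'rV[R]_d) : open U ->
  U = \bigcup_(cr in [set cr | 0 < cr.2 /\ cbox (rat_box cr).1 (rat_box cr).2 `<=` U])
        obox (rat_box cr).1 (rat_box cr).2.
Proof.
move=> oU; apply/seteqP; split => [v Uv|v [cr [_ crU] /obox_cbox/crU//]].
have /nbhs_ballP[e /= e0 eU] := open_nbhs_nbhs (conj oU Uv).
have e2 : 0 < e / 2 by rewrite divr_gt0.
have [r] := rat_in_itvoo e2; rewrite in_itv/= => /andP[r0 re].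
have /choice[q qP] : forall i, exists q : rat, `|ratr q - v ord0 i| < ratr r.
  move=> i; have := @rat_in_itvoo R (v ord0 i - ratr r) (v ord0 i + ratr r).
  by case=> [|q]; [rewrite ltrD2l gtrN|rewrite in_itv/= -ltr_distl; exists q].
exists (\row_i q i, r); last first.
  by move=> i; rewrite !mxE -ltr_distl distrC; exact: qP.
split; first by rewrite -(ltr0q R).
move=> w qw; apply: eU; split => // i j; rewrite (ord1 i) [e]splitr.
apply: (@ball_triangle _ R (ratr (q j) : R)).
  by apply: ball_sym; apply: lt_trans re; exact: qP.
by apply: le_lt_trans re; have := qw j; rewrite !mxE -ler_distl distrC.
Qed.

(** Open sets are countable unions of rational boxes. With [obox_setI] this makes the open boxes a
    generating pi-system, ready for Dynkin induction. *)
Lemma rV_measurable_obox :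
  @measurable _ 'rV[R]_d = <<s [set A | exists a b, A = obox a b] >>.
Proof.
set G := mkset _; apply/seteqP; split; last first.
  apply: smallest_sub; first exact: (@sigma_algebra_measurable _ 'rV[R]_d).
  by move=> _ [a [b ->]]; exact: measurable_obox.
apply: smallest_sub; first exact: smallest_sigma_algebra.
move=> U oU; rewrite (open_rat_box oU) bigcup_mkcond.
apply: (@countable_bigcupT_measurable _ (g_sigma_algebraType G)); first exact: countableP.
move=> cr.
case: ifPn => _; last exact: (@measurable0 _ (g_sigma_algebraType G)).
by apply: sub_sigma_algebra; eexists; eexists.
Qed.

Lemma obox_setIE a b c e : obox a b `&` obox c e =
  obox (\row_i Num.max (a ord0 i) (c ord0 i)) (\row_i Num.min (b ord0 i) (e ord0 i)).
Proof.
apply/seteqP; split => x.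
  move=> [H1 H2] i; rewrite !mxE gt_max lt_min.
  by have /andP[-> ->] := H1 i; have /andP[-> ->] := H2 i.
move=> H; split => i; have := H i; rewrite !mxE gt_max lt_min;
  by move=> /andP[/andP[a1 a2] /andP[a3 a4]]; apply/andP.
Qed.

Lemma obox_setI : setI_closed [set A | exists a b, A = obox a b].
Proof. by move=> _ _ [a [b ->]] [c [e ->]]; rewrite obox_setIE; eexists; eexists. Qed.

(** Localization: the exceptional sets of the countably many rational boxes are enumerated through
    [unpickle], and their union is still negligible. *)
Lemma negligible_rat_boxes (P : set 'rV[R]_d) (U : set 'rV[R]_d) : open U ->
  (forall a b, cbox a b `<=` U -> \forall x \ae lam, obox a b x -> P x) ->
  \forall x \ae lam, U x -> P x.
Proof.
move=> oU UP.
pose N k : set 'rV[R]_d := if @unpickle ('rV[rat]_d * rat)%type k is Some cr then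
  if `[< cbox (rat_box cr).1 (rat_box cr).2 `<=` U >] then
    obox (rat_box cr).1 (rat_box cr).2 `\` P else set0 else set0.
change (lam.-negligible (~` [set x | U x -> P x])).
apply: (@negligibleS _ _ _ lam (\bigcup_k N k)); last first.
  apply: negligible_bigcup => k; rewrite /N; case: unpickle => [cr|]; last exact: negligible_set0.
  case: asboolP => [/UP|_]; last exact: negligible_set0.
  by apply: negligibleS => x [bx nP] /(_ bx).
move=> x /= /not_implyP[]; rewrite {1}(open_rat_box oU) => -[cr [_ crU] crx] nP.
by exists (pickle cr) => //; rewrite /N pickleK asboolT.
Qed.

(** Lebesgue measure has full support, because a nonempty open set contains a half-open box of
    positive volume. *)
Lemma open_ae_exists (U : set 'rV[R]_d) (P : set 'rV[R]_d) : open U -> U !=set0 ->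
  (\forall x \ae lam, U x -> P x) -> exists2 x, U x & P x.
Proof.
move=> oU [x Ux] UP; apply: contrapT => nUP.
have [A [mA A0 UA]] : lam.-negligible U.
  by apply: negligibleS UP => y Uy /(_ Uy) Py; apply: nUP; exists y.
have /nbhs_ballP[e /= e0 eU] := open_nbhs_nbhs (conj oU Ux).
have e2 : 0 < e / 2 by rewrite divr_gt0.
pose B := [set v : 'rV[R]_d | forall i,
  (x - const_mx (e/2)) ord0 i < v ord0 i <= (x + const_mx (e/2)) ord0 i].
have BA : B `<=` A.
  move=> y By; apply/UA/eU; split => // i j; rewrite (ord1 i) /ball/= distrC ltr_distl.
  have := By j; rewrite !mxE => /andP[xy yx]; apply/andP; split.
    by apply: le_lt_trans xy; lra.
  by apply: (le_lt_trans yx); lra.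
have := @lebesgue_rV_box R d (x - const_mx (e/2)) (x + const_mx (e/2)).
have lt_e i : (x - const_mx (e/2)) ord0 i < (x + const_mx (e/2)) ord0 i.
  by rewrite !mxE ltrD2l gtrN.
move=> /(_ (fun i => ltW (lt_e i))); rewrite -/B => LB.
have : (lam B <= lam A)%E.
  by apply: le_measure; rewrite ?inE//; exact: measurable_hbox.
rewrite A0 LB lee_fin leNgt prodr_gt0// => i _; by rewrite subr_gt0.
Qed.

End boxes.

(** * Integrability by domination and by support *)

Section integration_aux.
Context {dsp} {T : measurableType dsp} {R : realType} (m : {measure set T -> \bar R}).
Implicit Types (D K : set T) (f g : T -> R).

Lemma integrable_le D f g : measurable D -> measurable_fun D f ->
  m.-integrable D (EFin \o g) -> (forall x, D x -> `|f x| <= g x) ->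
  m.-integrable D (EFin \o f).
Proof.
move=> mD mf ig fg; apply: le_integrable ig => //; first exact/measurable_EFinP.
by move=> x Dx /=; rewrite lee_fin; apply: le_trans (ler_norm _); exact: fg.
Qed.

Lemma integrable_mul_bounded D f g C : measurable D -> m.-integrable D (EFin \o f) ->
  measurable_fun D g -> (forall x, D x -> `|g x| <= C) ->
  m.-integrable D (EFin \o (fun x => f x * g x)).
Proof.
move=> mD fi mg gC.
have mf : measurable_fun D f by move/measurable_int: fi => /measurable_EFinP.
have : m.-integrable D (EFin \o (fun x => C * `|f x|)).
  exact: (integrableZl mD C (integrable_norm fi)).
move=> /integrable_le; apply => //; first exact: measurable_funM.
by move=> x Dx; rewrite normrM mulrC ler_wpM2r// gC.
Qed.

Lemma integral_supp D K f : K `<=` D -> (forall x, D x -> ~ K x -> f x = 0) ->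
  (\int[m]_(x in D) (f x)%:E = \int[m]_(x in K) (f x)%:E)%E.
Proof.
move=> KD fK; rewrite integral_mkcond [RHS]integral_mkcond.
congr (integral _ _ _); apply/funext => x; rewrite !patchE.
have [xK|xK] := boolP (x \in K).
  by rewrite mem_set//; apply: KD; rewrite inE in xK.
by case: ifPn => // xD; rewrite fK//; [rewrite inE in xD|rewrite notin_setE in xK].
Qed.

Lemma integrable_supp D K f : measurable D -> measurable K -> K `<=` D ->
  (forall x, D x -> ~ K x -> f x = 0) -> measurable_fun D f ->
  m.-integrable K (EFin \o f) -> m.-integrable D (EFin \o f).
Proof.
move=> mD mK KD fK mf /integrableP[_ fi]; apply/integrableP; split; first exact/measurable_EFinP.
rewrite (@integral_supp _ K (fun x => `|f x|))// => x Dx Kx.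
by rewrite fK// normr0.
Qed.

End integration_aux.

Section test_functions.
Context {R : realType} {d : nat}.
Implicit Types (a b c x : 'rV[R]_d) (phi u : 'rV[R]_d -> R) (K Om : set 'rV[R]_d).
Local Notation lam := (@lebesgue_rV R d).

Lemma continuous_measurable_rV phi D : measurable D -> continuous phi -> measurable_fun D phi.
Proof.
move=> mD cphi; apply: measurable_funS (measurableT) _ _ => //.
apply: (measurability (@measurable_realfun.RGenOpens.G R)).
  exact: measurable_realfun.RGenOpens.measurableE.
move=> _ [_ [r [s ->]] <-]; rewrite setTI; apply: open_measurable_rV.
by apply: open_comp => //; exact: interval_open.
Qed.

Lemma continuous_compact_bounded phi K : continuous phi -> compact K ->
  exists2 C, 0 <= C & forall x, K x -> `|phi x| <= C.
Proof.
move=> cphi cK.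
have /compact_bounded[M [_ /(_ (Num.max 0 (M + 1)))]] : compact (phi @` K).
  by apply: continuous_compact => //; exact: continuous_subspaceT.
rewrite lt_max ltrDl ltr01 orbT => /(_ isT) KM.
exists (Num.max 0 (M + 1)); first by rewrite le_max lexx.
by move=> x Kx; apply: KM; exists x.
Qed.

Lemma loc_integrable_mul Om u phi K : measurable Om -> loc_integrable Om u ->
  continuous phi -> compact K -> K `<=` Om -> (forall x, ~ K x -> phi x = 0) ->
  lam.-integrable Om (EFin \o (fun x => u x * phi x)).
Proof.
move=> mO [mu ui] cphi cK KO phiK.
have mK : measurable K by apply: closed_measurable_rV; exact: compact_closed_rV.
have [C C0 phiC] := continuous_compact_bounded cphi cK.
apply: (@integrable_supp _ _ _ _ _ K) => //.
- by move=> x _ /phiK ->; rewrite mulr0.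
- by apply: measurable_funM => //; exact: continuous_measurable_rV.
- apply: (@integrable_mul_bounded _ _ _ _ _ _ _ C) => //; last exact: continuous_measurable_rV.
  apply/integrableP; split; first by apply/measurable_EFinP; exact: measurable_funS mu.
  exact: ui.
Qed.

Section one_test_function.
Variables (Om : set 'rV[R]_d) (phi : 'rV[R]_d -> R).
Hypothesis tphi : test_fun Om phi.
Local Notation K := (closure [set x | phi x != 0]).

Lemma test_fun_continuous : continuous phi.
Proof.
have [sphi _ _] := tphi; move=> x; apply: differentiable_continuous.
exact: (sphi [::]).
Qed.

Lemma test_fun_partial_continuous i : continuous (partial i phi).
Proof.
have [sphi _ _] := tphi; move=> x; apply: differentiable_continuous.
exact: (sphi [:: i]).
Qed.

Lemma test_fun_supp x : ~ K x -> phi x = 0.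
Proof. by move=> Kx; apply: contrapT => /eqP phix; apply: Kx; exact: subset_closure. Qed.

Lemma test_fun_partial_supp i x : ~ K x -> partial i phi x = 0.
Proof.
move=> Kx; rewrite /partial (near_eq_derive (g := cst 0)) ?derive_cst//.
have : nbhs x (~` K).
  by apply: open_nbhs_nbhs; split => //; exact/closed_openC/closed_closure.
by apply: filterS => y Ky; rewrite test_fun_supp.
Qed.

End one_test_function.
End test_functions.

(** * Smooth cutoffs converging to the indicator of a box *)

Section box_bump.
Context {R : realType} {d : nat}.
Implicit Types (a b c x : 'rV[R]_d).

(** In each coordinate the product of [flat 0] at [n.+1 * (t - a)] and at [n.+1 * (b - t)], expanded
    to the affine form that [bumpy_flat] expects. Inside the box both arguments tend to infinity,
    where [exp(-1/t)] tends to 1. *)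
Definition box_bump a b (n : nat) : 'rV[R]_d -> R :=
  tensor (fun i t => flat 0 (n.+1%:R * t + - (n.+1%:R * a ord0 i)) *
                     flat 0 (- n.+1%:R * t + n.+1%:R * b ord0 i)).

Lemma flat0_le1 (t : R) : flat 0 t <= 1.
Proof.
rewrite /flat; case: ifPn => // t0; rewrite expr0 mul1r -expR0 ler_expR.
by rewrite lerNl oppr0 invr_ge0 ltW.
Qed.

Lemma flat0_cvg (c : R) : 0 < c -> flat 0 (n.+1%:R * c) @[n --> \oo] --> (1 : R).
Proof.
move=> c0.
rewrite (_ : (fun n => _) = (fun n : nat => expR (- (c^-1 * harmonic n)))); last first.
  by apply/funext => n; rewrite /flat mulr_gt0// expr0 mul1r invfM mulrC.
rewrite -[X in _ --> X]expR0; apply: continuous_cvg; first exact: continuous_expR.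
rewrite -[X in _ --> X]oppr0; apply: cvgN; rewrite -[X in _ --> X](mulr0 c^-1).
by apply: cvgMr; exact: cvg_harmonic.
Qed.

Lemma box_bump_ge0 a b n x : 0 <= box_bump a b n x.
Proof. by apply: prodr_ge0 => i _; rewrite mulr_ge0 ?flat_ge0. Qed.

Lemma box_bump_le1 a b n x : box_bump a b n x <= 1.
Proof.
by apply: prodr_ile1 => i _; rewrite mulr_ge0 ?flat_ge0//= mulr_ile1 ?flat_ge0 ?flat0_le1.
Qed.

Lemma box_bump_out a b n x : ~ obox a b x -> box_bump a b n x = 0.
Proof.
move=> /existsNP[i abx]; rewrite /box_bump /tensor (bigD1 i)//=.
rewrite /flat; case: ifPn => // H1; last by rewrite !mul0r.
case: ifPn => // H2; last by rewrite mulr0 mul0r.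
exfalso; apply: abx; move: H1 H2.
by rewrite -mulrBr pmulr_rgt0// subr_gt0 mulNr addrC -mulrBr pmulr_rgt0// subr_gt0 => -> ->.
Qed.

Lemma box_bump_cvg a b x : obox a b x -> box_bump a b n x @[n --> \oo] --> (1 : R).
Proof.
move=> abx; rewrite /box_bump /tensor.
rewrite -[X in _ --> X](@big1_eq _ 1 *%R _ (index_enum 'I_d) xpredT).
apply: cvg_big => [|i _]; first exact: mul_continuous.
have /andP[ax xb] := abx i.
rewrite -[X in _ --> X](mulr1 1); apply: cvgM.
- under eq_fun do rewrite -mulrBr.
  by apply: flat0_cvg; rewrite subr_gt0.
- under eq_fun do rewrite mulNr addrC -mulrBr.
  by apply: flat0_cvg; rewrite subr_gt0.
Qed.

Lemma test_fun_box_bump (Om : set 'rV[R]_d) a b n : cbox a b `<=` Om ->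
  test_fun Om (box_bump a b n).
Proof.
move=> abO.
have suppK : closure [set x | box_bump a b n x != 0] `<=` cbox a b.
  rewrite [X in _ `<=` X](closure_id _).1; last first.
    by apply: compact_closed_rV; exact: compact_cbox.
  apply: closure_subset => x /= bx; apply: obox_cbox; apply: contrapT => /(box_bump_out n) b0.
  by rewrite b0 eqxx in bx.
split.
- apply: smooth_tensor => i; apply: bumpy_mul; exact: bumpy_flat.
- apply: subclosed_compact (@compact_cbox _ _ a b) suppK; exact: closed_closure.
- by move=> x /suppK/abO.
Qed.

End box_bump.

(** * The fundamental lemma of the calculus of variations *)

Section fundamental_lemma.
Context {R : realType} {d : nat}.
Implicit Types (a b c x : 'rV[R]_d) (f phi u : 'rV[R]_d -> R).
Local Notation lam := (@lebesgue_rV R d).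
Variable (Om : set 'rV[R]_d).
Hypothesis mO : measurable Om.

Lemma integral_obox_eq0 f a b : cbox a b `<=` Om -> loc_integrable Om f ->
  (forall phi, test_fun Om phi -> \int[lam]_(x in Om) (f x * phi x) = 0) ->
  (\int[lam]_(x in obox a b) (f x)%:E = 0)%E.
Proof.
move=> abO fl f0.
have mc : measurable (cbox a b) by exact: measurable_cbox.
have mo : measurable (obox a b) by exact: measurable_obox.
have mf : measurable_fun (cbox a b) f by case: fl => + _; exact: measurable_funS.
have fi : lam.-integrable (cbox a b) (EFin \o f).
  apply/integrableP; split; first exact/measurable_EFinP.
  by case: fl => _; apply => //; exact: compact_cbox.
have mB n : measurable_fun (cbox a b) (box_bump a b n).
  apply: continuous_measurable_rV => //.
  exact: test_fun_continuous (test_fun_box_bump n abO).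
pose F n x := (f x * box_bump a b n x)%:E.
have F0 n : (\int[lam]_(x in cbox a b) F n x = 0)%E.
  have t := test_fun_box_bump n abO.
  have := f0 _ t; rewrite /Rintegral (@integral_supp _ _ _ _ _ (cbox a b))//; last first.
    by move=> x _ abx; rewrite box_bump_out ?mulr0// => /obox_cbox.
  move=> H; rewrite /F -[LHS]fineK ?H//; apply: integrable_fin_num => //.
  apply: (@integrable_mul_bounded _ _ _ _ _ _ _ 1) => // x _.
  by rewrite ger0_norm ?box_bump_ge0 ?box_bump_le1.
pose g x := (f x * \1_(obox a b) x)%:E.
have : (\int[lam]_(x in cbox a b) F n x)%E @[n --> \oo] --> (\int[lam]_(x in cbox a b) g x)%E.
  apply: (@dominated_cvg _ _ _ lam _ mc F g (EFin \o (fun x => `|f x|))).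
  - by move=> n; apply/measurable_EFinP; exact: measurable_funM.
  - move=> x _; apply: cvg_EFin; first by apply: nearW.
    have -> : fine \o F^~ x = (fun n => f x * box_bump a b n x) by [].
    rewrite /g/= indicE; have [/set_mem abx|] := boolP (x \in obox a b).
      by apply: cvgMr; exact: box_bump_cvg.
    rewrite notin_setE mulr0 => abx; under eq_fun do rewrite box_bump_out// mulr0.
    exact: cvg_cst.
  - by [].
  - exact: integrable_norm.
  - move=> n x _ /=; rewrite lee_fin normrM (ger0_norm (box_bump_ge0 _ _ _ _)).
    by rewrite ler_piMr// box_bump_le1.
rewrite (_ : (fun n => _) = (fun=> 0%E)); last by apply/funext => n; rewrite F0.
move/(cvg_unique (@ereal_hausdorff R) (cvg_cst 0%E)).
rewrite (@integral_supp _ _ _ _ _ (obox a b)); first last.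
- by move=> x _ abx; rewrite indicE memNset// mulr0.
- exact: obox_cbox.
move=> ->; apply: eq_integral => x xab; by rewrite indicE xab mulr1.
Qed.

(** Dynkin induction on [A]. Intersecting with a fixed box keeps [f] integrable, so that complements
    can be subtracted and disjoint unions summed. *)
Lemma integral_sub_obox_eq0 f a b : cbox a b `<=` Om -> loc_integrable Om f ->
  (forall phi, test_fun Om phi -> \int[lam]_(x in Om) (f x * phi x) = 0) ->
  forall A, measurable A -> (\int[lam]_(x in obox a b `&` A) (f x)%:E = 0)%E.
Proof.
move=> abO fl f0.
have mc : measurable (cbox a b) by exact: measurable_cbox.
have mo : measurable (obox a b) by exact: measurable_obox.
have fi : lam.-integrable (obox a b) (EFin \o f).
  apply: (@integrableS _ _ _ _ (cbox a b)) => //; first exact: obox_cbox.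
  apply/integrableP; split.
    by apply/measurable_EFinP; case: fl => + _; exact: measurable_funS.
  by case: fl => _; apply => //; exact: compact_cbox.
have P0 : (\int[lam]_(x in obox a b) (f x)%:E = 0)%E by exact: integral_obox_eq0 fl f0.
move=> A; rewrite rV_measurable_obox; move: A.
apply: (@dynkin_induction _ _ [set A | exists a b, A = obox a b]
  (fun A => \int[lam]_(x in obox a b `&` A) (f x)%:E = 0)%E).
- exact: rV_measurable_obox.
- exact: obox_setI.
- by rewrite setIT.
- move=> _ [c [e ->]].
  rewrite obox_setIE; apply: integral_obox_eq0 => // x ce; apply: abO => i; have := ce i.
  by rewrite !mxE ge_max le_min => /andP[/andP[-> _] /andP[-> _]].
- move=> S mS PS.
  have : (\int[lam]_(x in obox a b) (f x)%:E =
      \int[lam]_(x in obox a b `&` S) (f x)%:E + \int[lam]_(x in obox a b `&` ~` S) (f x)%:E)%E.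
    have E : obox a b = (obox a b `&` S) `|` (obox a b `&` ~` S) by rewrite -setIUr setUv setIT.
    rewrite [in LHS]E integral_setU//.
    + exact: measurableI.
    + by apply: measurableI => //; exact: measurableC.
    + by rewrite -E; exact: measurable_int fi.
    + apply/disj_setPS => x [[_ Sx] [_ nSx]]; exact: nSx.
  by rewrite P0 PS add0e.
- move=> F mF tF PF; rewrite setI_bigcupr integral_bigcup.
  + by under eq_eseriesr do rewrite PF; rewrite eseries0.
  + exact: trivIset_setIl.
  + by move=> k; exact: measurableI.
  + rewrite -setI_bigcupr; apply: integrableS fi => //.
    by apply: measurableI => //; exact: bigcup_measurable.
Qed.

(* The functions [box_bump a b n] converge to the indicator of a box, so the
   integral of [f] vanishes on boxes, hence on Borel sets. *)
Lemma fundamental_lemma f : open Om -> loc_integrable Om f ->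
  (forall phi, test_fun Om phi -> \int[lam]_(x in Om) (f x * phi x) = 0) ->
  \forall x \ae lam, Om x -> f x = 0.
Proof.
move=> oO fl f0; apply: negligible_rat_boxes => // a b abO.
have mo : measurable (obox a b) by exact: measurable_obox.
have aeq : ae_eq lam (obox a b) (EFin \o f) (cst 0%E).
  apply: integral_ae_eq => //.
  - apply: (@integrableS _ _ _ _ (cbox a b)) => //; first exact: measurable_cbox.
      exact: obox_cbox.
    apply/integrableP; split.
      apply/measurable_EFinP; case: fl => + _; apply: measurable_funS => //.
    by case: fl => _; apply => //; exact: compact_cbox.
  - move=> E Eab mE; rewrite integral0 -(setIidr Eab).
    exact: integral_sub_obox_eq0 fl f0 _ mE.
by apply: filterS aeq => x /= H /H [].
Qed.

End fundamental_lemma.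

(** * Integration by parts and weak gradients *)

Section integral_of_derivative.
Context {R : realType}.

Lemma continuous_rV (T : topologicalType) n (phi : T -> 'rV[R]_n) :
  (forall i, continuous (fun t => phi t ord0 i)) -> continuous phi.
Proof.
move=> cphi t A [P Pt PA].
have : \forall s \near t, forall i : 'I_n, P ord0 i (phi s ord0 i).
  by apply: filter_forall => i; exact: (cphi i t _ (Pt ord0 i)).
apply: filterS => s Ps; apply: PA => i j; by rewrite (ord1 i).
Qed.

(** The difference quotients on both sides are equal for every [h]. This passes from a function of
    several variables to its slices. *)
Lemma is_derive_affine (V W : normedModType R) (f : V -> R) (phi : W -> V)
    (y w : W) (v : V) (l : R) :
  (forall h : R, phi (h *: w + y) = h *: v + phi y) ->
  is_derive (phi y) v f l -> is_derive y w (f \o phi) l.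
Proof.
move=> phiE [df fl].
have E (h : R) : h^-1 *: (((f \o phi) \o shift y) (h *: w) - (f \o phi) y) =
    h^-1 *: ((f \o shift (phi y)) (h *: v) - f (phi y)) by rewrite /= phiE.
by split; [rewrite /derivable (funext E)|rewrite /derive (funext E)].
Qed.

Lemma integral_derive1_eq0 (F G : R -> R) (M : R) :
  (forall t : R, is_derive t 1 F (G t)) -> continuous G ->
  (forall t, M < `|t| -> F t = 0 /\ G t = 0) ->
  (\int[@lebesgue_measure R]_t (G t)%:E = 0)%E.
Proof.
(* [N] is positive and exceeds [M] whatever the sign of [M], so [F] vanishes at both endpoints of
   [[- N, N]]. *)
move=> dF cG FGM; pose N : R := `|M| + 1.
have N0 : 0 < N by rewrite ltr_wpDl.
have MN (t : R) : N <= `|t| -> M < `|t|.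
  by apply: lt_le_trans; rewrite (le_lt_trans (ler_norm _))// ltrDl.
have cF : continuous F.
  move=> t; apply: differentiable_continuous; apply/derivable1_diffP; exact: ex_derive.
rewrite (@integral_supp _ _ R (@lebesgue_measure R) setT `[- N, N]%classic G)//; last first.
  move=> t _ /=; rewrite in_itv/= -ler_norml => /negP; rewrite -ltNge => /ltW/MN/FGM[]//.
rewrite (@continuous_FTC2 _ G F) ?gtrN//.
- have [-> _] := FGM N (MN N (ler_norm _)).
  have [|-> _] := FGM (- N); last by rewrite subee.
  by rewrite normrN; exact: (MN N (ler_norm _)).
- exact: continuous_subspaceT.
- split => [t _|//|//].
  + exact: ex_derive.
  + exact/cvg_at_right_filter/cF.
  + exact/cvg_at_left_filter/cF.
- by move=> t _; rewrite derive1E; exact: derive_val.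
Qed.

Lemma compact_support_integrable n (g : 'rV[R]_n -> R) (M C : R) :
  continuous g -> (forall x, `|g x| <= C) ->
  (forall x, ~ cbox (const_mx (- M)) (const_mx M) x -> g x = 0) ->
  (lebesgue_rV n).-integrable setT (EFin \o g).
Proof.
move=> cg gC gM; set K := cbox _ _ in gM.
have mK : measurable K by exact: measurable_cbox.
apply: (@integrable_supp _ _ _ (lebesgue_rV n) setT K g) => //.
- by move=> x _; exact: gM.
- exact: continuous_measurable_rV.
- apply: measurable_bounded_integrable => //; first exact: lebesgue_cbox_lty.
    exact: continuous_measurable_rV.
  exists C; split; first exact: num_real.
  by move=> C' CC' x _; exact: le_trans (gC x) (ltW CC').
Qed.

Lemma rV_cons_affine0 n (h t : R) (v : 'rV[R]_n) :
  rV_cons (h *: (1 : R) + t, v) = h *: delta_mx ord0 ord0 + rV_cons (t, v).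
Proof.
apply/rowP => i; rewrite [RHS]mxE [(h *: delta_mx _ _) _ _]mxE [delta_mx _ _ _ _]mxE eqxx andTb.
case: (unliftP ord0 i) => [j ->|->]; rewrite ?rV_consS ?rV_cons0/=.
  by rewrite mulr0 add0r.
by rewrite [h *: 1]mulr1 mulr1.
Qed.

Lemma rV_cons_affineS n (h t : R) (v : 'rV[R]_n) (j : 'I_n) :
  rV_cons (t, h *: delta_mx ord0 j + v) = h *: delta_mx ord0 (lift ord0 j) + rV_cons (t, v).
Proof.
apply/rowP => i; rewrite [RHS]mxE [(h *: delta_mx _ _) _ _]mxE [delta_mx _ _ _ _]mxE eqxx andTb.
case: (unliftP ord0 i) => [k ->|->]; rewrite ?rV_consS ?rV_cons0/=.
  by rewrite !mxE (inj_eq (@lift_inj _ _)).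
by rewrite mulr0 add0r.
Qed.

(* By induction on the dimension, since [lebesgue_rV n.+1] is the product of the
   Lebesgue measure on the first coordinate and [lebesgue_rV n]. *)
Lemma integral_derive_eq0 n (i : 'I_n) (f g : 'rV[R]_n -> R) (M C : R) :
  (forall x, is_derive x (delta_mx ord0 i) f (g x)) -> continuous g ->
  (forall x, `|g x| <= C) ->
  (forall x, ~ cbox (const_mx (- M)) (const_mx M) x -> f x = 0 /\ g x = 0) ->
  (\int[lebesgue_rV n]_x (g x)%:E = 0)%E.
Proof.
elim: n i f g => [[]//|n IH] i f g df cg gC fgM.
have ig : (lebesgue_rV n.+1).-integrable setT (EFin \o g).
  by apply: (@compact_support_integrable _ _ M C) => // x /fgM[].
have mg : measurable_fun setT (EFin \o g) by exact: measurable_int ig.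
have igc : (@lebesgue_measure R \x lebesgue_rV n)%E.-integrable setT ((EFin \o g) \o @rV_cons R n).
  apply/integrableP; split; first by apply: measurableT_comp => //; exact: measurable_rV_cons.
  have /integrableP[_] := ig.
  rewrite [X in (X < _)%E -> _](@ge0_integral_pushforward _ _ _ _ _ _ (@measurable_rV_cons R n)
    (@lebesgue_measure R \x lebesgue_rV n)%E setT (fun x => `|(EFin \o g) x|)%E)//.
  exact: measurableT_comp.
rewrite [LHS](@integral_pushforward _ _ _ _ _ _ (@measurable_rV_cons R n)
  (@lebesgue_measure R \x lebesgue_rV n)%E setT (EFin \o g))//.
case: (unliftP ord0 i) => [j|] iE; subst i.
(* For a direction other than the first, the first coordinate is frozen and the induction hypothesis
   kills the inner integral. *)
- rewrite preimage_setT -integral12_prod_meas1//= integral0_eq// => t _.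
  apply: (IH j (fun v => f (rV_cons (t, v))) (fun v => g (rV_cons (t, v)))).
  + move=> v; apply: (@is_derive_affine _ _ f (fun v => rV_cons (t, v)) v _ _ _ _ (df _)).
    by move=> h; exact: rV_cons_affineS.
  + move=> v; apply: continuous_comp; last exact: cg.
    apply: continuous_rV => k; case: (unliftP ord0 k) => [l ->|->].
      by under eq_fun do rewrite rV_consS; exact: coord_continuous.
    by under eq_fun do rewrite rV_cons0; exact: cst_continuous.
  + by move=> v; exact: gC.
  + move=> v vM; apply: fgM => tvM; apply: vM => k; have := tvM (lift ord0 k).
    by rewrite rV_consS !mxE.
(* For the first direction Fubini is used in the other order, so that the inner integral is the
   one-dimensional one. *)
- rewrite preimage_setT -integral21_prod_meas1//= integral0_eq// => v _.
  apply: (@integral_derive1_eq0 (fun t => f (rV_cons (t, v))) (fun t => g (rV_cons (t, v))) M).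
  + move=> t; apply: (@is_derive_affine _ _ f (fun t => rV_cons (t, v)) t _ _ _ _ (df _)).
    by move=> h; exact: rV_cons_affine0.
  + move=> t; apply: continuous_comp; last exact: cg.
    apply: continuous_rV => k; case: (unliftP ord0 k) => [l ->|->].
      by under eq_fun do rewrite rV_consS; exact: cst_continuous.
    by under eq_fun do rewrite rV_cons0.
  + move=> t Mt; apply: fgM => /(_ ord0); rewrite rV_cons0 !mxE -ler_norml.
    by rewrite leNgt Mt.
Qed.

End integral_of_derivative.

(** * Weak gradients: linearity, uniqueness, and the case of test functions *)

Section weak_gradients.
Context {R : realType} {d : nat}.
Implicit Types (phi psi u v : 'rV[R]_d -> R) (g : 'rV[R]_d -> 'rV[R]_d).
Local Notation lam := (@lebesgue_rV R d).
Variable (Om : set 'rV[R]_d).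
Hypothesis oO : open Om.

Let mO : measurable Om. Proof. exact: open_measurable_rV. Qed.

Lemma compact_measurable_rV (K : set 'rV[R]_d) : compact K -> measurable K.
Proof. by move=> cK; apply: closed_measurable_rV; exact: compact_closed_rV. Qed.

Lemma loc_integrableP u : loc_integrable Om u <-> measurable_fun Om u /\
  forall K, K `<=` Om -> compact K -> lam.-integrable K (EFin \o u).
Proof.
split=> -[mu ui]; split => // K KO cK.
  apply/integrableP; split; last exact: ui.
  apply/measurable_EFinP; apply: measurable_funS mu => //.
by have /integrableP[] := ui _ KO cK.
Qed.

Lemma loc_integrable_lin (a : R) u v : loc_integrable Om u -> loc_integrable Om v ->
  loc_integrable Om (a *: u + v).
Proof.
move=> /loc_integrableP[mu iu] /loc_integrableP[mv iv]; apply/loc_integrableP; split.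
  by apply: measurable_funD => //; exact: measurable_funM.
move=> K KO cK.
have mK := compact_measurable_rV cK.
exact: (integrableD mK (integrableZl mK a (iu _ KO cK)) (iv _ KO cK)).
Qed.

Lemma integrable_test u phi : loc_integrable Om u -> test_fun Om phi ->
  lam.-integrable Om (EFin \o (fun x => u x * phi x)).
Proof.
move=> lu tp; have [_ cK KO] := tp.
apply: (loc_integrable_mul mO lu _ cK KO) => [|x Kx].
  exact: test_fun_continuous tp.
exact: test_fun_supp Kx.
Qed.

Lemma integrable_partial_test u phi i : loc_integrable Om u -> test_fun Om phi ->
  lam.-integrable Om (EFin \o (fun x => u x * partial i phi x)).
Proof.
move=> lu tp; have [_ cK KO] := tp.
apply: (loc_integrable_mul mO lu _ cK KO) => [|x Kx].
  exact: test_fun_partial_continuous tp _.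
exact: test_fun_partial_supp Kx.
Qed.

Lemma weak_gradient_lin (a : R) u v g1 g2 : weak_gradient Om u g1 -> weak_gradient Om v g2 ->
  weak_gradient Om (a *: u + v) (a *: g1 + g2).
Proof.
move=> [lu lg1 ug1] [lv lg2 vg2].
have lg i : loc_integrable Om (fun x => (a *: g1 + g2) x ord0 i).
  have -> : (fun x => (a *: g1 + g2) x ord0 i) =
      a *: (fun x => g1 x ord0 i) + (fun x => g2 x ord0 i).
    by apply/funext => x; rewrite !fctE !mxE.
  exact: loc_integrable_lin.
split => //; first exact: loc_integrable_lin.
move=> phi i tp.
under eq_Rintegral do rewrite fctE mulrDl -mulrA.
under [in RHS]eq_Rintegral do rewrite fctE !mxE mulrDl -mulrA.
have i1 := integrable_partial_test i lu tp; have i2 := integrable_partial_test i lv tp.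
have i3 := integrable_test (lg1 i) tp; have i4 := integrable_test (lg2 i) tp.
rewrite !RintegralD//; first last.
- exact: (integrableZl mO a i1).
- exact: (integrableZl mO a i3).
by rewrite !RintegralZl// ug1// vg2// mulrN opprD.
Qed.

(** Each component of [g1 - g2] is orthogonal to all test functions. Allowing [u] and [v] to differ
    on a null set is what later makes the energy independent of the representative. *)
Lemma weak_gradient_unique u v g1 g2 :
  (\forall x \ae lam, Om x -> u x = v x) ->
  weak_gradient Om u g1 -> weak_gradient Om v g2 ->
  \forall x \ae lam, Om x -> g1 x = g2 x.
Proof.
move=> uv [lu lg1 ug1] [lv lg2 vg2].
have H i : \forall x \ae lam, Om x -> g1 x ord0 i - g2 x ord0 i = 0.
  apply: (fundamental_lemma mO oO).
    have -> : (fun x => g1 x ord0 i - g2 x ord0 i) =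
        -1 *: (fun x => g2 x ord0 i) + (fun x => g1 x ord0 i).
      by apply/funext => x; rewrite !fctE [-1 *: _]mulN1r addrC.
    exact: loc_integrable_lin.
  move=> phi tp; under eq_Rintegral do rewrite mulrBl.
  have i1 := integrable_test (lg1 i) tp; have i2 := integrable_test (lg2 i) tp.
  rewrite RintegralB//; apply/eqP; rewrite subr_eq0; apply/eqP; apply: oppr_inj.
  rewrite -ug1// -vg2// /Rintegral; congr fine; apply: ae_eq_integral => //.
  - exact: measurable_int (integrable_partial_test i lu tp).
  - exact: measurable_int (integrable_partial_test i lv tp).
  - by apply: filterS uv => x /= + Ox => ->.
have : \forall x \ae lam, forall i, Om x -> g1 x ord0 i - g2 x ord0 i = 0.
  exact: filter_forall.
by apply: filterS => x Hx Ox; apply/rowP => i; apply/eqP; rewrite -subr_eq0 Hx.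
Qed.

Lemma grad_weak_gradient u : weakly_differentiable Om u -> weak_gradient Om u (grad Om u).
Proof. by move=> [g ug]; exact: (xgetPex _ (ex_intro _ g ug)). Qed.

(** [grad] is a choice among representatives, so linearity survives only almost everywhere, through
    uniqueness. *)
Lemma grad_lin (a : R) u v : weakly_differentiable Om u -> weakly_differentiable Om v ->
  \forall x \ae lam, Om x -> grad Om (a *: u + v) x = a *: grad Om u x + grad Om v x.
Proof.
move=> /grad_weak_gradient du /grad_weak_gradient dv.
have duv := weak_gradient_lin a du dv.
apply: (weak_gradient_unique _ (grad_weak_gradient _) duv); first exact: aeW.
by eexists; exact: duv.
Qed.

Definition strong_gradient phi : 'rV[R]_d -> 'rV[R]_d := fun x => \row_i partial i phi x.

Lemma test_fun_loc_integrable phi psi : test_fun Om phi -> continuous psi ->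
  loc_integrable Om psi.
Proof.
move=> tp cpsi; apply/loc_integrableP; split; first exact: continuous_measurable_rV.
move=> K KO cK; have mK := compact_measurable_rV cK.
have [C C0 psiC] := continuous_compact_bounded cpsi cK.
apply: measurable_bounded_integrable => //.
- by apply: lebesgue_bounded_lty => //; exact: compact_bounded.
- exact: continuous_measurable_rV.
- exists C; split; first exact: num_real.
  by move=> C' CC' x Kx; exact: le_trans (psiC x Kx) (ltW CC').
Qed.

(** The [i]-th derivative [g] of the product [phi * psi] has zero integral over the whole space and
    is supported in [Om]; expanding [g] gives integration by parts. *)
Lemma weak_gradient_test_fun phi : test_fun Om phi ->
  weak_gradient Om phi (strong_gradient phi).
Proof.
move=> tp; have cp := test_fun_continuous tp.
have cdp i : continuous (partial i phi) by exact: test_fun_partial_continuous tp i.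
have lp : loc_integrable Om phi by exact: test_fun_loc_integrable tp cp.
have ldp i : loc_integrable Om (partial i phi).
  exact: test_fun_loc_integrable tp (cdp i).
split => // [i|psi i ts].
  by under eq_fun do rewrite mxE.
have cs := test_fun_continuous ts.
have cds : continuous (partial i psi) by exact: test_fun_partial_continuous ts i.
pose g x := phi x * partial i psi x + psi x * partial i phi x.
have cg : continuous g.
  by move=> x; exact: (cvgD (cvgM (cp x) (cds x)) (cvgM (cs x) (cdp i x))).
have dg x : is_derive x (delta_mx ord0 i) (fun x => phi x * psi x) (g x).
  have dp : is_derive x (delta_mx ord0 i) phi (partial i phi x).
    by apply: DeriveDef => //; apply: diff_derivable; have [s _ _] := tp; exact: (s [::] x).
  have ds : is_derive x (delta_mx ord0 i) psi (partial i psi x).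
    by apply: DeriveDef => //; apply: diff_derivable; have [s _ _] := ts; exact: (s [::] x).
  exact: is_deriveM.
set K := closure [set x | phi x != 0].
have [_ cK KO] := tp.
have gK x : ~ K x -> phi x * psi x = 0 /\ g x = 0.
  move=> Kx; rewrite /g test_fun_supp// (test_fun_partial_supp i Kx).
  by rewrite !mul0r mulr0 addr0.
have [M KM] := bounded_sub_cbox (compact_bounded cK).
have [C C0 gC] := continuous_compact_bounded cg cK.
have g0 : (\int[lam]_x (g x)%:E = 0)%E.
  apply: (@integral_derive_eq0 _ _ _ _ _ M C dg cg) => [x|x xM].
    have [Kx|Kx] := pselect (K x); first exact: gC.
    by have [_ ->] := gK x Kx; rewrite normr0.
  by apply: gK => /KM.
rewrite (@integral_supp _ _ _ _ _ Om) in g0 => //; last first.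
  by move=> x _ Ox; have [] := gK x (fun Kx => Ox (KO x Kx)).
apply/eqP; rewrite -addr_eq0; apply/eqP.
under [X in _ + X]eq_Rintegral do rewrite mxE mulrC.
rewrite -RintegralD//.
- by rewrite /Rintegral g0.
- exact: integrable_partial_test.
- exact: integrable_partial_test (test_fun_loc_integrable ts cs) tp.
Qed.

End weak_gradients.

(** * The double phase integrand *)

Section nfunctions.
Context {R : realType}.
Implicit Types (s t l : R) (h : R -> R).
Local Notation leb := (@lebesgue_measure R).

(** [nfun_ratio] is the monotonicity of [h t / t] with denominators cleared, so that it includes 0
    and forces [h 0 = 0]. Besides the convexity of the primitive it gives [l * h t <= h (l * t)] for
    [l >= 1]. *)
Record nfun h : Prop := NFun {
  nfun_cont : continuous h ;
  nfun_ge0 : forall t, 0 <= t -> 0 <= h t ;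
  nfun_ratio : forall s t, 0 <= s -> s <= t -> h s * t <= h t * s }.

Definition prim h t : R := \int[leb]_(s in `[0, t]) h s.

Variable h : R -> R.
Hypothesis hn : nfun h.

Lemma nfun_le s t : 0 <= s -> s <= t -> h s <= h t.
Proof.
move=> s0 st; have [<-//|t0] : s = t \/ 0 < t.
  by have [/eqP|] := boolP (0 == t);
    [move=> t0; left; lra|move=> t0; right; rewrite lt_neqAle t0 (le_trans s0)].
rewrite -(ler_pM2r t0); apply: le_trans (nfun_ratio hn s0 st) _.
by rewrite ler_wpM2l// nfun_ge0// ltW.
Qed.

Lemma nfun_integrable s t : leb.-integrable `[s, t] (EFin \o h).
Proof.
apply: continuous_compact_integrable; first exact: segment_compact.
by apply: continuous_subspaceT; exact: nfun_cont.
Qed.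

Lemma prim_incr s t : 0 <= s -> s <= t ->
  h s * (t - s) <= prim h t - prim h s <= h t * (t - s).
Proof.
move=> s0 st; rewrite /prim Rintegral_itvB ?bnd_simp//; last exact: nfun_integrable.
have mi : measurable `]s, t] by exact: measurable_itv.
have il : leb.-integrable `]s, t] (EFin \o h).
  apply: integrableS (nfun_integrable s t) => //.
  by move=> x /=; rewrite !in_itv/= => /andP[/ltW -> ->].
have ic (c : R) : leb.-integrable `]s, t] (EFin \o cst c).
  have /integrableS : leb.-integrable `[s, t] (EFin \o cst c).
    apply: continuous_compact_integrable; first exact: segment_compact.
    by apply: continuous_subspaceT => x; exact: cst_continuous.
  by apply => // x /=; rewrite !in_itv/= => /andP[/ltW -> ->].
have E (c : R) : \int[leb]_(x in `]s, t]) c = c * (t - s).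
  rewrite Rintegral_cst//= lebesgue_measure_itv/= lte_fin; case: ltP => // ts.
  by rewrite /= (_ : t = s) ?subrr//; apply/eqP; rewrite eq_le ts st.
apply/andP; split; rewrite -E; apply: le_Rintegral => //; try exact: ic.
- move=> x; rewrite /= in_itv/= => /andP[/ltW sx xt]; exact: nfun_le.
- by move=> x; rewrite /= in_itv/= => /andP[/ltW sx xt]; apply: nfun_le => //; exact: le_trans sx.
Qed.

Lemma prim0 : prim h 0 = 0.
Proof. by rewrite /prim set_itv1 Rintegral_set1. Qed.

(** Convexity in subgradient form; the two halves of [prim_incr] treat the two sides of [s]. *)
Lemma prim_convex s t : 0 <= s -> 0 <= t -> h s * (t - s) <= prim h t - prim h s.
Proof.
move=> s0 t0; have [st|/ltW ts] := leP s t; first by have /andP[] := prim_incr s0 st.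
by have /andP[_] := prim_incr t0 ts; rewrite -lerN2 opprB -mulrN opprB.
Qed.

Lemma prim_le s t : 0 <= s -> s <= t -> prim h s <= prim h t.
Proof.
move=> s0 st; rewrite -subr_ge0; have /andP[+ _] := prim_incr s0 st.
by apply: le_trans; rewrite mulr_ge0 ?subr_ge0 ?nfun_ge0.
Qed.

Lemma prim_ge0 t : 0 <= t -> 0 <= prim h t.
Proof. by move=> t0; rewrite -prim0 prim_le. Qed.

(** The conjugate of [prim h] at [h s] is [h s * s - prim h s]; it is replaced here by the larger
    [h s * s]. *)
Lemma nfun_young s t : 0 <= s -> 0 <= t -> h s * t <= h s * s + prim h t.
Proof.
move=> s0 t0; have := prim_convex s0 t0; have := prim_ge0 s0; rewrite mulrBr; lra.
Qed.

(** On [[t, 2 * t]] the integrand is at least [h t]. The product becomes an energy again, and the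
    loss is a factor inside the argument, not in front of [prim]. *)
Lemma nfun_mul_le_prim t : 0 <= t -> h t * t <= prim h (2 * t).
Proof.
move=> t0; have t20 : 0 <= 2 * t by rewrite mulr_ge0.
have := prim_convex t0 t20; have := prim_ge0 t0.
by rewrite (_ : 2 * t - t = t); [lra|lra].
Qed.

Lemma prim_scale l t : 0 <= l <= 1 -> 0 <= t -> prim h (l * t) <= l * prim h t.
Proof.
move=> /andP[l0 l1] t0; have lt0 : 0 <= l * t by rewrite mulr_ge0.
have H1 := prim_convex lt0 t0; have := prim_convex lt0 (lexx 0).
rewrite prim0 !sub0r => H2.
(* The tangent at [l * t] is tested at 0 and at [t] with weights [1 - l] and [l]; the linear terms
   cancel. *)
have : (1 - l) * (h (l * t) * (- (l * t))) + l * (h (l * t) * (t - l * t)) <=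
   (1 - l) * (- prim h (l * t)) + l * (prim h t - prim h (l * t)).
  by apply: lerD; rewrite ler_wpM2l// ?subr_ge0.
by rewrite (_ : (1 - l) * (h (l * t) * (- (l * t))) + l * (h (l * t) * (t - l * t)) = 0);
  [lra|ring].
Qed.

(** The sum [s + t] is at most twice the larger of the two. Again the constant stays inside the
    argument. *)
Lemma prim_add s t : 0 <= s -> 0 <= t -> prim h (s + t) <= prim h (2 * s) + prim h (2 * t).
Proof.
move=> s0 t0.
have [st|ts] := leP s t.
  apply: (@le_trans _ _ (prim h (2 * t))); first by apply: prim_le; lra.
  by rewrite lerDr prim_ge0// mulr_ge0.
apply: (@le_trans _ _ (prim h (2 * s))); first by apply: prim_le; lra.
by rewrite lerDl prim_ge0// mulr_ge0.
Qed.

(** The absolute value extends a function on the half-line to the whole line, the form that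
    [measurable_caratheodory] asks for. Near [t] the primitive is Lipschitz with the constant [C],
    kept positive by its last summand. *)
Lemma prim_continuous : continuous (fun t => prim h `|t|).
Proof.
move=> t; apply/cvgrPdist_le => e e0.
pose C := h (`|t| + 1) + 1.
have C0 : 0 < C by rewrite ltr_wpDl// nfun_ge0// addr_ge0.
have H (s u : R) : 0 <= s -> s <= u -> u <= `|t| + 1 -> `|prim h u - prim h s| <= C * (u - s).
  move=> s0 su ut; rewrite ger0_norm ?subr_ge0 ?prim_le//.
  have /andP[_ /le_trans] := prim_incr s0 su; apply.
  rewrite ler_wpM2r ?subr_ge0// /C ler_wpDr// nfun_le//; exact: le_trans su.
near=> s.
have ts : `|t - s| <= Num.min 1 (e / C).
  near: s; apply/nbhs_ballP; exists (Num.min 1 (e / C)); last by move=> s /ltW.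
  by rewrite /= lt_min ltr01 divr_gt0.
move: ts; rewrite le_min => /andP[ts1 tse].
have D : `| `|t| - `|s| | <= `|t - s| by exact: ler_dist_dist.
have se : C * `|t - s| <= e by rewrite mulrC -ler_pdivlMr.
have sC : `|s| <= `|t| + 1.
  have := le_trans D ts1; rewrite ler_norml => /andP[]; lra.
apply: le_trans se; apply: (@le_trans _ _ (C * `| `|t| - `|s| |)); last by rewrite ler_pM2l.
have [st|ts] := leP `|s| `|t|.
  by rewrite [X in C * X]ger0_norm ?subr_ge0// H// lerDl.
rewrite distrC [`| `|t| - _|]distrC [X in C * X]ger0_norm ?subr_ge0 ?(ltW ts)//.
by apply: H => //; exact: ltW.
Unshelve. all: by end_near. Qed.

End nfunctions.

Section double_phase_pointwise.
Context {R : realType}.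
Implicit Types (s t Q m : R) (e : R -> R).

Record exponent e Q : Prop := Exponent {
  exponent_cont : continuous (fun t => e `|t|) ;
  exponent_cst : forall s t, 0 <= s <= 1 -> 0 <= t <= 1 -> e s = e t ;
  exponent_mono : forall s t, 1 <= s -> s <= t -> e s <= e t ;
  exponent_ge2 : forall t, 0 <= t -> 2 <= e t ;
  exponent_le : forall t, 0 <= t -> e t <= Q }.

Definition wpow e t : R := `|t| `^ (e `|t| - 2).

Lemma wpow_ge0 e t : 0 <= wpow e t. Proof. exact: powR_ge0. Qed.

Section wpow.
Variables (e : R -> R) (Q : R).
Hypothesis eQ : exponent e Q.

(** On [[0, 1]] the exponent is constant; across 1 the two values are separated by 1; beyond 1 both
    the base and the exponent increase. *)
Lemma wpow_le s t : 0 <= s -> s <= t -> wpow e s <= wpow e t.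
Proof.
move=> s0 st; have t0 := le_trans s0 st; rewrite /wpow !ger0_norm//.
have es2 : 0 <= e s - 2 by rewrite subr_ge0 (exponent_ge2 eQ).
have et2 : 0 <= e t - 2 by rewrite subr_ge0 (exponent_ge2 eQ).
have E1 r : 1 `^ r = 1 :> R by rewrite powR1.
have [t1|/ltW t1] := leP t 1.
  rewrite (@exponent_cst _ _ eQ s t) ?s0 ?t0 ?(le_trans st t1)//.
  by apply: ge0_ler_powR; rewrite ?nnegrE.
have [s1|/ltW s1] := leP s 1.
  apply: (@le_trans _ _ 1); last by rewrite -[leLHS](E1 (e t - 2)) ge0_ler_powR ?nnegrE.
  by rewrite -[leRHS](E1 (e s - 2)) ge0_ler_powR ?nnegrE.
apply: (@le_trans _ _ (s `^ (e t - 2))).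
  by rewrite ler_powR// lerD2r (exponent_mono eQ).
by apply: ge0_ler_powR; rewrite ?nnegrE.
Qed.

Lemma wpow_continuous t : t != 0 -> {for t, continuous (wpow e)}.
Proof.
move=> t0; have nt0 : 0 < `|t| by rewrite normr_gt0.
have E s : s != 0 -> expR ((e `|s| - 2) * ln `|s|) = wpow e s.
  by move=> s0; rewrite /wpow /powR normr_eq0 (negbTE s0).
suff : wpow e @ t --> expR ((e `|t| - 2) * ln `|t|) by rewrite (E t t0).
apply: (@cvg_trans _ (expR ((e `|s| - 2) * ln `|s|) @[s --> t])).
  apply: near_eq_cvg; near=> s; apply: E; near: s.
  apply/nbhs_ballP; exists `|t| => //= s; rewrite /ball/=.
  by apply: contraTneq => ->; rewrite subr0 ltxx.
apply: (@continuous_cvg _ _ _ (nbhs t) _ (fun s : R => (e `|s| - 2) * ln `|s|) expR).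
  exact: continuous_expR.
have c1 : (fun s => e `|s| - 2) @ t --> e `|t| - 2.
  by apply: cvgB; [exact: (exponent_cont eQ)|exact: cvg_cst].
have c2 : (fun s : R => ln `|s|) @ t --> ln `|t|.
  apply: (@continuous_cvg _ _ _ (nbhs t) _ (fun s : R => `|s|) (@ln R)); first exact: continuous_ln.
  exact: norm_continuous.
exact: cvgM c1 c2.
Unshelve. all: by end_near. Qed.

Lemma wpow_ub t : 0 <= t -> wpow e t <= (1 + t) `^ Q.
Proof.
move=> t0; rewrite /wpow ger0_norm//.
have et2 : 0 <= e t - 2 by rewrite subr_ge0 (exponent_ge2 eQ).
apply: (@le_trans _ _ ((1 + t) `^ (e t - 2))).
  by apply: ge0_ler_powR => //; rewrite ?nnegrE; lra.
by apply: ler_powR; [rewrite lerDl|have := exponent_le eQ t0; lra].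
Qed.

Lemma wpow_lb t : 0 < t <= 1 -> t `^ Q <= wpow e t.
Proof.
move=> /andP[t0 t1]; rewrite /wpow gtr0_norm//.
by apply: ger_powR; [rewrite t0|have := exponent_le eQ (ltW t0); lra].
Qed.

End wpow.

(** The quotient [h(x, t) / t], given a value at 0 by the conventions of [powR]; the operator
    multiplies the gradient by it. *)
Definition dp_coef e1 e2 m t : R := wpow e1 t + m * wpow e2 t.

Section dp_coef.
Variables (e1 e2 : R -> R) (m Q : R).
Hypotheses (e1Q : exponent e1 Q) (e2Q : exponent e2 Q) (m0 : 0 <= m).
Local Notation k := (dp_coef e1 e2 m).

Lemma dp_coef_ge0 t : 0 <= k t.
Proof. by rewrite addr_ge0 ?mulr_ge0 ?wpow_ge0. Qed.

Lemma dp_coef_le s t : 0 <= s -> s <= t -> k s <= k t.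
Proof.
move=> s0 st; apply: lerD; first exact: wpow_le e1Q _ _ s0 st.
by rewrite ler_wpM2l//; exact: wpow_le e2Q _ _ s0 st.
Qed.

Lemma dp_coef_continuous t : t != 0 -> {for t, continuous k}.
Proof.
move=> t0; apply: cvgD; first exact: wpow_continuous e1Q _ t0.
by apply: cvgMr; exact: wpow_continuous e2Q _ t0.
Qed.

Lemma nfun_dp_coef : nfun (fun t => k t * t).
Proof.
split.
- move=> t; have [->|t0] := eqVneq t 0; last first.
    by apply: cvgM; [exact: dp_coef_continuous|exact: cvg_id].
  suff : (fun t => k t * t) @ (0 : R) --> (0 : R).
    by rewrite -[X in _ --> X -> _](mulr0 (k 0)).
  (* At zero the smallness comes from the factor [t] alone, the coefficient being at most [k 1] on
     [[-1, 1]]. *)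
  apply/cvgrPdist_le => e e0.
  have k1 : 0 < k 1 + 1 by rewrite ltr_wpDl// dp_coef_ge0.
  near=> s.
  have s1 : `|s| <= 1.
    by near: s; apply/nbhs_ballP; exists 1 => //= s; rewrite /ball/= sub0r normrN => /ltW.
  rewrite sub0r normrN normrM ger0_norm ?dp_coef_ge0//.
  have ks : k s <= k 1.
    apply: (@le_trans _ _ (k `|s|)); last exact: dp_coef_le.
    by rewrite /dp_coef /wpow !normr_id.
  apply: (@le_trans _ _ ((k 1 + 1) * `|s|)); first by rewrite ler_wpM2r// (le_trans ks)// lerDl.
  rewrite mulrC -ler_pdivlMr//.
  near: s; apply/nbhs_ballP; exists (e / (k 1 + 1)); first by rewrite /= divr_gt0.
  by move=> s; rewrite /ball/= sub0r normrN => /ltW.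
- by move=> t t0; rewrite mulr_ge0// dp_coef_ge0.
- move=> s t s0 st; have t0 := le_trans s0 st.
  rewrite (_ : k t * t * s = k t * (s * t)); last by ring.
  by rewrite -mulrA ler_wpM2r ?mulr_ge0 ?dp_coef_le.
Unshelve. all: by end_near. Qed.

Lemma dp_coef_ub t : 0 <= t -> k t <= (1 + m) * (1 + t) `^ Q.
Proof.
move=> t0; rewrite mulrDl mul1r lerD ?ler_wpM2l//.
  exact: wpow_ub e1Q _ t0.
exact: wpow_ub e2Q _ t0.
Qed.

Lemma dp_coef_lb t : 0 < t <= 1 -> t `^ Q <= k t.
Proof.
by move=> t01; rewrite /dp_coef ler_wpDr ?mulr_ge0 ?wpow_ge0//; exact: wpow_lb e1Q _ t01.
Qed.

End dp_coef.

Lemma dp_hE d (p q : 'rV[R]_d -> R -> R) mu x t :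
  dp_h p q mu x t = dp_coef (p x) (q x) (mu x) t * t.
Proof.
rewrite /dp_h; case: eqVneq => [->|t0]; first by rewrite mulr0.
by rewrite mulrDl.
Qed.

Lemma dp_HE d (p q : 'rV[R]_d -> R -> R) mu x t : 0 <= t ->
  dp_H p q mu x t = prim (dp_h p q mu x) t.
Proof. by rewrite /dp_H => ->. Qed.

End double_phase_pointwise.

(** * From almost everywhere to everywhere *)

Section euclidean_norm.
Context {R : realType} {n : nat}.
Implicit Types (v w : 'rV[R]_n) (c : R).

Lemma edotC v w : edot v w = edot w v.
Proof. by apply: eq_bigr => i _; rewrite mulrC. Qed.

Lemma edotDl u v w : edot (u + v) w = edot u w + edot v w.
Proof. by rewrite -big_split; apply: eq_bigr => i _; rewrite mxE mulrDl. Qed.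

Lemma edotZl c v w : edot (c *: v) w = c * edot v w.
Proof. by rewrite mulr_sumr; apply: eq_bigr => i _; rewrite mxE mulrA. Qed.

Lemma edotDr u v w : edot u (v + w) = edot u v + edot u w.
Proof. by rewrite edotC edotDl !(edotC u). Qed.

Lemma edotZr c v w : edot v (c *: w) = c * edot v w.
Proof. by rewrite edotC edotZl edotC. Qed.

Lemma edot_ge0 v : 0 <= edot v v.
Proof. by apply: sumr_ge0 => i _; rewrite -expr2 sqr_ge0. Qed.

Lemma edot_eq0 v : edot v v = 0 -> v = 0.
Proof.
move/eqP; rewrite psumr_eq0 => [/allP v0|i _]; last by rewrite -expr2 sqr_ge0.
apply/rowP => i; rewrite mxE; have := v0 i (mem_index_enum _).
by rewrite /= mulf_eq0 orbb => /eqP.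
Qed.

Lemma enorm_ge0 v : 0 <= enorm v. Proof. exact: sqrtr_ge0. Qed.

Lemma enorm_sqr v : enorm v ^+ 2 = edot v v.
Proof. by rewrite sqr_sqrtr ?edot_ge0. Qed.

Lemma enorm_eq0 v : enorm v = 0 -> v = 0.
Proof. by move=> v0; apply: edot_eq0; rewrite -enorm_sqr v0 expr0n. Qed.

Lemma enorm0 : enorm (0 : 'rV[R]_n) = 0.
Proof. by rewrite /enorm /edot big1 ?sqrtr0// => i _; rewrite mxE mul0r. Qed.

Lemma enormZ c v : enorm (c *: v) = `|c| * enorm v.
Proof.
by rewrite /enorm edotZl edotZr mulrA -expr2 sqrtrM ?sqr_ge0// sqrtr_sqr.
Qed.

Lemma enormN v : enorm (- v) = enorm v.
Proof. by rewrite -scaleN1r enormZ normrN1 mul1r. Qed.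

Lemma enormB v w : enorm (v - w) = enorm (w - v).
Proof. by rewrite -enormN opprB. Qed.

Lemma cauchy_schwarz v w : `|edot v w| <= enorm v * enorm w.
Proof.
have [w0|w0] := eqVneq (edot w w) 0.
  have -> : w = 0 by exact: edot_eq0.
  rewrite enorm0 mulr0 /edot big1 ?normr0// => i _; by rewrite mxE mulr0.
have w_gt0 : 0 < edot w w by rewrite lt_neqAle eq_sym w0 edot_ge0.
rewrite -(@ler_pXn2r _ 2) ?nnegrE ?mulr_ge0 ?enorm_ge0// real_normK ?num_real//.
rewrite exprMn !enorm_sqr -subr_ge0 -(pmulr_rge0 _ w_gt0).
(* The square of this vector is [edot w w] times the Gram determinant of [v] and [w]. *)
have := edot_ge0 (edot w w *: v + (- edot v w) *: w).
rewrite edotDl !edotDr !edotZl !edotZr (edotC w v).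
by move=> /le_trans; apply; rewrite le_eqVlt; apply/orP; left; apply/eqP; ring.
Qed.

Lemma edot_le v w : edot v w <= enorm v * enorm w.
Proof. exact: le_trans (ler_norm _) (cauchy_schwarz v w). Qed.

Lemma enormD v w : enorm (v + w) <= enorm v + enorm w.
Proof.
rewrite -(@ler_pXn2r _ 2) ?nnegrE ?addr_ge0 ?enorm_ge0//.
rewrite sqrrD !enorm_sqr edotDl !edotDr (edotC w v).
by have := edot_le v w; lra.
Qed.

Lemma ler_enormB v w : enorm v <= enorm w + enorm (v - w).
Proof. by rewrite (le_trans _ (enormD _ _))// addrC subrK. Qed.

Lemma ler_dist_enorm v w : `|enorm v - enorm w| <= enorm (v - w).
Proof.
by have := ler_enormB v w; have := ler_enormB w v; rewrite (enormB w) ler_norml; lra.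
Qed.

Lemma enorm_continuous : continuous (@enorm R n).
Proof.
move=> v; apply: (@continuous_comp _ _ _ (fun v => edot v v) Num.sqrt); last exact: sqrt_continuous.
apply: (@cvg_big _ _ _ _ _ _ _ (nbhs v)) => [|i _]; first exact: add_continuous.
by apply: cvgM; exact: coord_continuous.
Qed.

Lemma measurable_edot dsp (T : measurableType dsp) (D : set T) (f g : T -> 'rV[R]_n) :
  (forall i, measurable_fun D (fun x => f x ord0 i)) ->
  (forall i, measurable_fun D (fun x => g x ord0 i)) ->
  measurable_fun D (fun x => edot (f x) (g x)).
Proof.
move=> mf mg; apply: measurable_sum => i; exact: measurable_funM.
Qed.

Lemma measurable_enorm dsp (T : measurableType dsp) (D : set T) (f : T -> 'rV[R]_n) :
  (forall i, measurable_fun D (fun x => f x ord0 i)) ->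
  measurable_fun D (fun x => enorm (f x)).
Proof.
move=> mf; have ms : measurable_fun setT (@Num.sqrt R).
  by apply: continuous_measurable_fun; exact: sqrt_continuous.
exact: (measurableT_comp ms (measurable_edot mf mf)).
Qed.

End euclidean_norm.

(** * Exponents at every point of the domain *)

Section full_support.
Context {R : realType} {d : nat}.
Variable (Om : set 'rV[R]_d).
Hypothesis oO : open Om.
Local Notation lam := (@lebesgue_rV R d).

Lemma open_enorm_ball (x : 'rV[R]_d) (eps : R) : open [set y | enorm (x - y) < eps].
Proof.
have cf : continuous (fun y : 'rV[R]_d => enorm (x - y)).
  move=> y; apply: (@continuous_comp _ _ _ (fun y : 'rV[R]_d => x - y) (@enorm R d)).
    exact: (cvgB (@cvg_cst _ x _ (nbhs y) _) (@cvg_id _ (nbhs y))).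
  exact: enorm_continuous.
by move: cf => /continuousP /(_ [set t | t < eps]); apply; exact: open_lt.
Qed.

Lemma ae_dense (P : set 'rV[R]_d) x (eps : R) : (\forall y \ae lam, Om y -> P y) -> Om x ->
  0 < eps -> exists y, [/\ Om y, P y & enorm (x - y) < eps].
Proof.
move=> OP Ox e0.
have [|||y [Oy xy] Py] := @open_ae_exists R d (Om `&` [set y | enorm (x - y) < eps]) P.
- by apply: openI => //; exact: open_enorm_ball.
- by exists x; split => //=; rewrite subrr enorm0.
- by apply: filterS OP => y OPy [Oy _]; exact: OPy.
by exists y.
Qed.

Section exponent_everywhere.
Variables (p : 'rV[R]_d -> R -> R) (c : R).
Hypothesis c0 : 0 < c.
Hypothesis pc : forall (t : R) x y, 0 <= t -> Om x -> Om y -> `|p x t - p y t| <= c * enorm (x - y).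

(** The point [y] is chosen before [t]: the Lipschitz constant is uniform in [t], so the whole
    function [p x] is uniformly close to [p y] for some good [y]. *)
Lemma ae_approx (P : set 'rV[R]_d) x (eps : R) : (\forall y \ae lam, Om y -> P y) -> Om x ->
  0 < eps -> exists y, [/\ Om y, P y & forall t, 0 <= t -> `|p x t - p y t| <= eps].
Proof.
move=> OP Ox e0; have ec : 0 < eps / c by rewrite divr_gt0.
have [y [Oy Py xy]] := ae_dense OP Ox ec.
exists y; split => // t t0; apply: le_trans (pc t0 Ox Oy) _.
by rewrite mulrC -ler_pdivlMr// ltW.
Qed.

Lemma exponent_shape_continuous (r : R -> R) : exponent_shape r ->
  continuous (fun t : R => r `|t|).
Proof.
move=> [/continuous_within_itvcyP[rc _] r01 _] t.
have [->|t0] := eqVneq t 0.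
  (* At the endpoint 0 the constancy on [[0, 1]] gives the two-sided continuity of the even
     extension. *)
  apply: (@cvg_trans _ (r 0 @[s --> (0 : R)])); last first.
    by rewrite normr0; apply: (@cvg_cst _ (r 0) _ (nbhs (0 : R)) _).
  apply: near_eq_cvg; near=> s; apply: r01; rewrite ?lexx ?ler01// normr_ge0/=.
  by near: s; apply/nbhs_ballP; exists 1 => //= s; rewrite /ball/= sub0r normrN => /ltW.
apply: (@continuous_comp _ _ _ (fun t : R => `|t|) r); first exact: norm_continuous.
by apply: rc; rewrite in_itv/= normr_gt0 t0.
Unshelve. all: by end_near. Qed.

Hypothesis shape : \forall x \ae lam, Om x -> exponent_shape (p x).

Lemma exponent_continuous_everywhere x : Om x -> continuous (fun t : R => p x `|t|).
Proof.
move=> Ox t; apply/cvgrPdist_le => e e0; have e3 : 0 < e / 3 by rewrite divr_gt0.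
have [y [Oy /exponent_shape_continuous/(_ t) yc H]] := ae_approx shape Ox e3.
have := yc; move/cvgrPdist_le => /(_ _ e3); apply: filterS => s Hs.
have := H `|t| (normr_ge0 _); have := H `|s| (normr_ge0 _); move: Hs.
rewrite !ler_norml; lra.
Qed.

Lemma exponent_everywhere Q : (forall x t, Om x -> 0 <= t -> 2 <= p x t) ->
  (forall x t, Om x -> 0 <= t -> p x t <= Q) ->
  forall x, Om x -> exponent (p x) Q.
Proof.
move=> p2 pQ x Ox; split => [t|s t s01 t01|s t s1 st|t t0|t t0]; [| | |exact: p2|exact: pQ].
- exact: (exponent_continuous_everywhere Ox).
- apply/eqP; rewrite -subr_eq0 -normr_le0; apply/ler_addgt0Pl => e e0; rewrite addr0.
  have e3 : 0 < e / 3 by rewrite divr_gt0.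
  have [y [Oy [_ y01 _] H]] := ae_approx shape Ox e3.
  have /andP[s0 _] := s01; have /andP[t0 _] := t01.
  have := H s s0; have := H t t0; rewrite (y01 _ _ s01 t01) !ler_norml; lra.
- apply/ler_addgt0Pl => e e0; have e3 : 0 < e / 3 by rewrite divr_gt0.
  have [y [Oy [_ _ ym] H]] := ae_approx shape Ox e3.
  have s0 : 0 <= s by rewrite (le_trans _ s1).
  have := H s s0; have := H t (le_trans s0 st); have := ym _ _ s1 st.
  rewrite !ler_norml; lra.
Qed.

(** If [p x t] exceeded the essential bound [Q], then [p] would exceed [Q] on the product of a
    neighbourhood of [x] and an interval, a set of positive product measure. *)
Lemma exp_sup_everywhere : (exp_sup Om p < +oo)%E ->
  exists Q, forall x t, Om x -> 0 <= t -> p x t <= Q.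
Proof.
move=> poo.
have [Q pQ] : exists Q, (exp_sup Om p <= Q%:E)%E.
  by case: (exp_sup Om p) poo => [r _|//|_]; [exists r|exists 0; rewrite leNye].
exists Q => x t Ox t0; rewrite leNgt; apply/negP => Qpx.
pose eta := (p x t - Q) / 2.
have eta0 : 0 < eta by rewrite divr_gt0// subr_gt0.
have xc : continuous (fun t : R => p x `|t|) by exact: exponent_continuous_everywhere.
have /cvgrPdist_lt /(_ _ eta0) /nbhs_ballP[r /= r0 rt] := xc t.
(* The interval lies to the right of [t], hence inside the half-line even when [t = 0]. *)
pose V := ball (t + r / 2) (r / 2).
have Vt s : V s -> 0 <= s /\ Q + eta < p x s.
  rewrite /V /ball/= ltr_distlC => /andP[s1 s2].
  have s0 : 0 <= s by lra.
  split => //; have : ball t r s by rewrite /ball/= ltr_distlC; lra.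
  by move/rt; rewrite /= (ger0_norm t0) (ger0_norm s0) ltr_norml /eta; lra.
pose U := Om `&` [set y | enorm (x - y) < eta / c].
have oU : open U by apply: openI => //; exact: open_enorm_ball.
have UV y s : U y -> V s -> Q < p y s.
  move=> [Oy xy] /Vt[s0 Qs]; have := pc s0 Ox Oy.
  have : c * enorm (x - y) < eta by rewrite mulrC -ltr_pdivlMr.
  by rewrite ler_norml => H1 /andP[H2 H3]; lra.
have mU : measurable U by exact: open_measurable_rV.
have mV : measurable V by exact: measurable_ball.
have UV0 : (lam U * @lebesgue_measure R V = 0)%E.
  rewrite -product_measure1E//.
  have := @ess_sup_ge _ _ _ (lam \x @lebesgue_measure R)%E
    (patch (fun=> -oo%E) (Om `*` @halfline R) (EFin \o (fun z => p z.1 z.2))).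
  move=> [A [mA A0 HA]].
  apply/eqP; rewrite -measure_le0 -A0; apply: le_measure; rewrite ?inE//.
    exact: measurableX.
  move=> [y s] [/= Uy Vs]; apply: HA => /= H.
  have [s0 _] := Vt _ Vs.
  have : (y, s) \in Om `*` @halfline R.
    by rewrite inE; split; [case: Uy|rewrite /halfline/= in_itv/= s0].
  move=> yD; move: H; rewrite /patch yD /= => /le_trans/(_ pQ).
  by rewrite lee_fin leNgt UV.
have r20 : 0 < r / 2 by rewrite divr_gt0.
have U0 : (0 < lam U)%E.
  rewrite lt_neqAle measure_ge0 andbT; apply/negP => /eqP lU.
  have [||y _ []] := @open_ae_exists R d U set0 oU.
    by exists x; split => //=; rewrite subrr enorm0 divr_gt0.
  by exists U; split => // y /= /not_implyP[].
have : (0 < lam U * @lebesgue_measure R V)%E.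
  by apply: mule_gt0 => //; rewrite lebesgue_measure_ball ?ltW// lte_fin mulrn_wgt0.
by rewrite UV0 ltxx.
Qed.

End exponent_everywhere.
End full_support.

(** * Measurability *)

Section measurability.
Context {dsp} {T : measurableType dsp} {R : realType}.
Variable D : set T.
Hypothesis mD : measurable D.

Lemma measurable_powR2 (a b : T -> R) : measurable_fun D a -> measurable_fun D b ->
  measurable_fun D (fun x => a x `^ b x).
Proof.
move=> ma mb; rewrite /powR.
apply: measurable_fun_if => //.
- by apply: measurable_fun_eqr => //; exact: measurable_cst.
- apply: (measurable_funS mD (@subIsetl _ _ _)).
  rewrite (_ : (fun x => _) = (fun x => if b x == 0 then 1 else 0)); last first.
    by apply/funext => x; case: ifP.
  apply: measurable_fun_if; [by []| |exact: measurable_cst|exact: measurable_cst].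
  by apply: measurable_fun_eqr => //; exact: measurable_cst.
- apply: (measurable_funS mD (@subIsetl _ _ _)).
  have ml : measurable_fun D (fun x => b x * ln (a x)).
    by apply: measurable_funM => //; exact: (measurableT_comp (@measurable_ln R) ma).
  exact: (measurableT_comp (@measurable_expR R) ml).
Qed.

(* [f] is approximated by multiples of [1 / n.+1], so that only countably many of
   the functions [K ^~ t] are involved. *)
Lemma measurable_caratheodory (K : T -> R -> R) (f : T -> R) :
  (forall t, 0 <= t -> measurable_fun D (K ^~ t)) ->
  (forall x, D x -> continuous (fun t : R => K x `|t|)) ->
  measurable_fun D f -> measurable_fun D (fun x => K x `|f x|).
Proof.
move=> mK cK mf.
pose r n x : nat := Num.truncn (`|f x| * n.+1%:R).
apply: (@measurable_fun_cvg _ _ _ _ (fun n x => K x ((r n x)%:R / n.+1%:R))) => [n|x Dx].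
  move=> _ Y mY.
  rewrite (_ : _ `&` _ = \bigcup_k ((D `&` (fun x => `|f x| * n.+1%:R) @^-1` `[k%:R, k.+1%:R[%classic)
      `&` (D `&` (K ^~ (k%:R / n.+1%:R)) @^-1` Y))); last first.
    apply/seteqP; split => x.
      move=> [Dx Yx]; exists (r n x) => //; split => //; split => //.
      by rewrite /= in_itv/= truncn_itv.
    move=> [k _ [[Dx]]]; rewrite /= in_itv/= => /truncn_def kE [_ Yx].
    by split => //=; rewrite /r kE.
  apply: bigcup_measurable => k _; apply: measurableI; last first.
    by apply: mK => //; rewrite divr_ge0.
  have : measurable_fun D (fun x => `|f x| * n.+1%:R).
    by apply: measurable_funM => //; exact: measurableT_comp.
  by apply => //; exact: measurable_itv.
have rE : (fun n => K x ((r n x)%:R / n.+1%:R)) =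
    (fun t : R => K x `|t|) \o (fun n => (r n x)%:R / n.+1%:R).
  by apply/funext => n /=; rewrite ger0_norm// divr_ge0.
have fE : K x `|f x| = (fun t : R => K x `|t|) `|f x| by rewrite normr_id.
rewrite rE fE.
suff rf : (r n x)%:R / n.+1%:R @[n --> \oo] --> `|f x|.
  exact: (@continuous_cvg _ _ _ \oo _ _ (fun t : R => K x `|t|) `|f x| (cK x Dx _) rf).
have lo : `|f x| - harmonic n @[n --> \oo] --> `|f x|.
  by rewrite -[X in _ --> X]subr0; apply: cvgB; [exact: cvg_cst|exact: cvg_harmonic].
apply: squeeze_cvgr lo (cvg_cst `|f x|); apply: nearW => n.
have /andP[H1 H2] := @truncn_itv R (`|f x| * n.+1%:R) (mulr_ge0 (normr_ge0 _) (ler0n _ _)).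
apply/andP; split; last by rewrite ler_pdivrMr.
rewrite /harmonic lerBlDr -[X in _ + X]mul1r -mulrDl ler_pdivlMr//.
by rewrite (le_trans (ltW H2))// -natr1 addrC.
Qed.

End measurability.

Section riemann_sum.
Context {R : realType}.

(** Left sums of a nondecreasing function: the errors telescope to at most one step times [h t].
    Such sums make [x |-> H(x, t)] a limit of measurable functions. *)
Lemma prim_riemann (h : R -> R) (t : R) : nfun h -> 0 <= t ->
  \sum_(k < n.+1) (t / n.+1%:R * h (k%:R * (t / n.+1%:R))) @[n --> \oo] --> prim h t.
Proof.
move=> hn t0.
have step (del : R) m : 0 <= del ->
    0 <= prim h (m%:R * del) - \sum_(k < m) (del * h (k%:R * del)) <= del * h (m%:R * del).
  move=> del0; elim: m => [|m /andP[IH1 IH2]].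
    by rewrite mul0r big_ord0 (prim0 h) subrr lexx mulr_ge0// (nfun_ge0 hn).
  rewrite big_ord_recr/=.
  have m0 : 0 <= m%:R * del by rewrite mulr_ge0.
  have mm : m%:R * del <= m.+1%:R * del by rewrite ler_wpM2r// ler_nat.
  have /andP[] := prim_incr hn m0 mm.
  rewrite (_ : m.+1%:R * del - m%:R * del = del); last by rewrite -mulrBl -natr1; ring.
  rewrite ![_ * del]mulrC => H1 H2; move: IH1 IH2; rewrite ![_ * del]mulrC; lra.
have H n : 0 <= prim h t - \sum_(k < n.+1) (t / n.+1%:R * h (k%:R * (t / n.+1%:R)))
    <= t / n.+1%:R * h t.
  have del0 : 0 <= t / n.+1%:R by rewrite divr_ge0.
  by have := step _ n.+1 del0; rewrite [_ * (t / _)]mulrC divfK.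
have lo : prim h t - t * h t * harmonic n @[n --> \oo] --> prim h t.
  rewrite -[X in _ --> X]subr0; apply: cvgB; first exact: cvg_cst.
  by rewrite -(mulr0 (t * h t)); apply: cvgMr; exact: cvg_harmonic.
apply: squeeze_cvgr lo (cvg_cst (prim h t)); apply: nearW => n.
have /andP[H1 H2] := H n; apply/andP; split; last by rewrite -subr_ge0.
by rewrite lerBlDr -lerBlDl (le_trans H2)// /harmonic mulrAC.
Qed.

End riemann_sum.

Section double_phase_measurable.
Context {R : realType} {d : nat}.
Variables (Om : set 'rV[R]_d) (p q : 'rV[R]_d -> R -> R) (mu : 'rV[R]_d -> R).

(** The hypotheses promoted to every point of [Om], with one bound [Q] for both exponents. *)
Record dp_data (Q M : R) : Prop := DpData {
  dp_measurable : measurable Om ;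
  dp_p : forall x, Om x -> exponent (p x) Q ;
  dp_q : forall x, Om x -> exponent (q x) Q ;
  dp_mu : forall x, Om x -> 0 <= mu x <= M ;
  dp_mp : forall t, 0 <= t -> measurable_fun Om (p ^~ t) ;
  dp_mq : forall t, 0 <= t -> measurable_fun Om (q ^~ t) ;
  dp_mmu : measurable_fun Om mu }.

Variables (Q M : R).
Hypothesis D : dp_data Q M.
Local Notation h := (dp_h p q mu).
Local Notation mO := (dp_measurable D).

Lemma nfun_dp_h x : Om x -> nfun (h x).
Proof.
move=> Ox; have -> : h x = (fun t => dp_coef (p x) (q x) (mu x) t * t).
  by apply/funext => t; rewrite dp_hE.
have /andP[mu0 _] := dp_mu D Ox.
exact: nfun_dp_coef (dp_p D Ox) (dp_q D Ox) mu0.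
Qed.

Lemma measurable_dp_coef (f : 'rV[R]_d -> R) : measurable_fun Om f ->
  measurable_fun Om (fun x => dp_coef (p x) (q x) (mu x) (f x)).
Proof.
move=> mf.
have mnf : measurable_fun Om (fun x => `|f x|) by exact: measurableT_comp.
apply: measurable_funD.
  apply: (measurable_powR2 mO mnf); apply: measurable_funB; last exact: measurable_cst.
  apply: (measurable_caratheodory mO) => //; first exact: dp_mp D.
  by move=> x /(dp_p D)[].
apply: measurable_funM; first exact: dp_mmu D.
apply: (measurable_powR2 mO mnf); apply: measurable_funB; last exact: measurable_cst.
apply: (measurable_caratheodory mO) => //; first exact: dp_mq D.
by move=> x /(dp_q D)[].
Qed.

Lemma measurable_dp_h (f : 'rV[R]_d -> R) : measurable_fun Om f ->
  measurable_fun Om (fun x => h x (f x)).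
Proof.
move=> mf; under eq_fun do rewrite dp_hE.
by apply: measurable_funM => //; exact: measurable_dp_coef.
Qed.

Lemma measurable_prim_cst t : 0 <= t -> measurable_fun Om (fun x => prim (h x) t).
Proof.
move=> t0; apply: (@measurable_fun_cvg _ _ _ _
  (fun n x => \sum_(k < n.+1) (t / n.+1%:R * h x (k%:R * (t / n.+1%:R))))) => [n|x Ox].
  apply: measurable_sum => k; apply: measurable_funM => //; exact: measurable_dp_h.
by apply: prim_riemann => //; exact: nfun_dp_h.
Qed.

Lemma measurable_prim (f : 'rV[R]_d -> R) : measurable_fun Om f ->
  measurable_fun Om (fun x => prim (h x) `|f x|).
Proof.
move=> mf; apply: (@measurable_caratheodory _ _ _ _ mO (fun x => prim (h x)) f) => // [t t0|x Ox].
  exact: measurable_prim_cst.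
by apply: prim_continuous; exact: nfun_dp_h.
Qed.

End double_phase_measurable.

(** * Continuity of the operator *)

Section key_estimate.
Context {R : realType} {d : nat}.
Variables (Om : set 'rV[R]_d) (p q : 'rV[R]_d -> R -> R) (mu : 'rV[R]_d -> R).
Variables (Q M : R).
Hypothesis D : dp_data Om p q mu Q M.
Hypothesis Q0 : 0 <= Q.
Hypothesis M0 : 0 <= M.
Hypothesis lamO : (lebesgue_rV d Om < +oo)%E.
Local Notation lam := (@lebesgue_rV R d).
Local Notation h := (dp_h p q mu).
Local Notation H x := (prim (dp_h p q mu x)).
Let mO : measurable Om := dp_measurable D.
Implicit Types (x xi zeta : 'rV[R]_d) (t : R) (f w : 'rV[R]_d -> R) (G V : 'rV[R]_d -> 'rV[R]_d).

(** The field [h(x, |xi|) xi / |xi|] of the operator, written without the division. *)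
Definition dp_vec x xi : 'rV[R]_d := dp_coef (p x) (q x) (mu x) (enorm xi) *: xi.

Lemma enorm_dp_vec x xi : Om x -> enorm (dp_vec x xi) = h x (enorm xi).
Proof.
move=> Ox; have /andP[mu0 _] := dp_mu D Ox.
by rewrite enormZ ger0_norm ?dp_hE// dp_coef_ge0.
Qed.

Lemma dp_h_ge0 x t : Om x -> 0 <= t -> 0 <= h x t.
Proof. by move=> Ox; exact: (nfun_ge0 (nfun_dp_h D Ox)). Qed.

Lemma H_ge0 x t : Om x -> 0 <= t -> 0 <= H x t.
Proof. by move=> Ox; exact: (prim_ge0 (nfun_dp_h D Ox)). Qed.

(** The bound does not depend on [x]; its value at [eta] is the threshold between small and large
    increments. *)
Lemma dp_h_lb x t : Om x -> 0 < t <= 1 -> t `^ Q * t <= h x t.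
Proof.
move=> Ox /andP[t0 t1]; have /andP[mu0 _] := dp_mu D Ox.
rewrite dp_hE ler_pM2r//; apply: dp_coef_lb (dp_p D Ox) mu0 _ _.
by rewrite t0.
Qed.

Lemma dp_h_ub x t : Om x -> 0 <= t -> h x t <= (1 + M) * (1 + t) `^ Q * t.
Proof.
move=> Ox t0; have /andP[mu0 muM] := dp_mu D Ox.
rewrite dp_hE ler_wpM2r//; apply: le_trans (dp_coef_ub (dp_p D Ox) (dp_q D Ox) mu0 t0) _.
by rewrite ler_wpM2r ?powR_ge0// lerD2l.
Qed.

(** This turns the pointwise convergence of energies to zero into that of the gradients. The point
    [s] is at most 1, where the power bound holds, and strictly below [t]. *)
Lemma H_gt0 x t : Om x -> 0 < t -> 0 < H x t.
Proof.
move=> Ox t0; have hn := nfun_dp_h D Ox.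
pose s := Num.min 1 (t / 2).
have s01 : 0 < s <= 1 by rewrite lt_min ltr01 divr_gt0//= ge_min lexx.
have /andP[s0 _] := s01.
have st : s < t.
  by rewrite gt_min; apply/orP; right; rewrite ltr_pdivrMr// ltr_pMr// ltr1n.
have := prim_convex hn (ltW s0) (ltW t0).
have hs : 0 < h x s by apply: lt_le_trans (dp_h_lb Ox s01); rewrite mulr_gt0// powR_gt0.
have := H_ge0 Ox (ltW s0); have : 0 < h x s * (t - s) by rewrite mulr_gt0// subr_gt0.
lra.
Qed.

(** At [xi = 0] the continuity of [h x] bounds the norm of the field; elsewhere the coefficient is
    itself continuous. *)
Lemma dp_vec_cvg x xi (xin : nat -> 'rV[R]_d) : Om x ->
  enorm (xin n - xi) @[n --> \oo] --> (0 : R) ->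
  enorm (dp_vec x (xin n) - dp_vec x xi) @[n --> \oo] --> (0 : R).
Proof.
have scaler_diff (a b : R) (y z : 'rV[R]_d) :
    a *: y - b *: z = (a - b) *: z + a *: (y - z).
  by rewrite scalerBl scalerBr [RHS]addrC addrA subrK.
move=> Ox xin0; have /andP[mu0 _] := dp_mu D Ox.
have cn : enorm (xin n) @[n --> \oo] --> enorm xi.
  apply/cvgrPdist_lt => e e0; move/cvgrPdist_lt : xin0 => /(_ _ e0).
  apply: filterS => n; rewrite sub0r normrN ger0_norm ?enorm_ge0// => ne.
  by apply: le_lt_trans ne; rewrite distrC ler_dist_enorm.
have [xi0|xi0] := eqVneq xi 0.
  have ch : h x (enorm (xin n)) @[n --> \oo] --> h x (enorm xi).
    by apply: continuous_cvg cn; apply: nfun_cont; exact: (nfun_dp_h D Ox).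
  have dx0 : dp_vec x xi = 0 by rewrite xi0 /dp_vec scaler0.
  rewrite dx0; under eq_fun do rewrite subr0 enorm_dp_vec//.
  by rewrite xi0 enorm0 dp_hE mulr0 in ch.
have nxi : enorm xi != 0 by apply: contra_neq xi0; exact: enorm_eq0.
set k := dp_coef (p x) (q x) (mu x).
have ck : k (enorm (xin n)) @[n --> \oo] --> k (enorm xi).
  apply: continuous_cvg cn; exact: dp_coef_continuous (dp_p D Ox) (dp_q D Ox) _ _.
have up : `|k (enorm (xin n)) - k (enorm xi)| * enorm xi +
    k (enorm (xin n)) * enorm (xin n - xi) @[n --> \oo] --> (0 : R).
  rewrite -[X in _ --> X](addr0 0); apply: cvgD.
    rewrite -[X in _ --> X](mul0r (enorm xi)); apply: cvgMl.
    rewrite -(@normr0 _ R) -(subrr (k (enorm xi))); apply: cvg_norm.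
    exact: (cvgB ck (cvg_cst _)).
  by rewrite -[X in _ --> X](mulr0 (k (enorm xi))); exact: cvgM.
apply: squeeze_cvgr (cvg_cst 0) up; apply: nearW => n; rewrite enorm_ge0/=.
rewrite /dp_vec -/k scaler_diff.
apply: le_trans (enormD _ _) _; rewrite !enormZ (ger0_norm (dp_coef_ge0 _ _ _ _))//.
Qed.

(* Where the increment of [dp_vec] is small, Young's inequality is applied at
   [eta]; elsewhere it is applied at a multiple of [enorm xi + enorm (zeta - xi)],
   which avoids the conjugate of [H]. *)
Lemma dp_vec_young x xi zeta t lambda eta : Om x -> 0 <= t -> 1 <= lambda -> 0 < eta <= 1 ->
  lambda * (enorm (dp_vec x zeta - dp_vec x xi) * t) <=
  (1 + M) * 2 `^ Q * eta +
  (if eta `^ Q * eta < lambda * enorm (dp_vec x zeta - dp_vec x xi) then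
     H x (8 * lambda * enorm xi) + H x (8 * lambda * enorm (zeta - xi)) else 0) + H x t.
Proof.
move=> Ox t0 l1 eta01; have hn := nfun_dp_h D Ox.
have /andP[eta0 eta1] := eta01.
have l0 : 0 < lambda by apply: lt_le_trans l1.
set b := enorm _; have b0 : 0 <= b by exact: enorm_ge0.
have Ceta : h x eta * eta <= (1 + M) * 2 `^ Q * eta.
  apply: (@le_trans _ _ (h x eta)).
    by rewrite ler_piMr// dp_h_ge0// ltW.
  apply: le_trans (dp_h_ub Ox (ltW eta0)) _; rewrite ler_wpM2r ?(ltW eta0)//.
  rewrite ler_wpM2l ?addr_ge0//; apply: ge0_ler_powR; rewrite ?nnegrE//; lra.
rewrite mulrA; case: ifPn => [_|].
- pose m := enorm xi + enorm (zeta - xi).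
  have xm : enorm xi <= m by rewrite lerDl enorm_ge0.
  have zm : enorm zeta <= m by exact: ler_enormB.
  have m0 : 0 <= m by rewrite (le_trans _ xm) ?enorm_ge0.
  pose s := 2 * lambda * m.
  have ms : m <= s by rewrite /s ler_peMl//; lra.
  have s0 : 0 <= s by rewrite (le_trans m0).
  have bm : b <= 2 * h x m.
    apply: (@le_trans _ _ (h x (enorm zeta) + h x (enorm xi))).
      by rewrite /b (le_trans (enormD _ _))// enormN !enorm_dp_vec.
    have := nfun_le hn (enorm_ge0 _) xm; have := nfun_le hn (enorm_ge0 _) zm; lra.
  (* Here [lambda * b <= 2 * lambda * h x m <= h x (2 * lambda * m)], the last step by
     [nfun_ratio]. *)
  have bs : lambda * b <= h x s.
    have [m00|m_gt0] := eqVneq m 0.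
      apply: (@le_trans _ _ 0); last exact: dp_h_ge0.
      have hm0 : h x m = 0 by rewrite m00 dp_hE mulr0.
      by rewrite hm0 mulr0 in bm; rewrite pmulr_rle0.
    have mp : 0 < m by rewrite lt_neqAle eq_sym m_gt0.
    have := nfun_ratio hn m0 ms; rewrite /s -/s => hms.
    rewrite -(ler_pM2r mp); apply: le_trans hms; rewrite /s.
    rewrite (_ : h x m * (2 * lambda * m) = lambda * (2 * h x m) * m); last by ring.
    by rewrite ler_pM2r// ler_pM2l.
  have := nfun_young hn s0 t0.
  have := nfun_mul_le_prim hn s0.
  have : lambda * b * t <= h x s * t by rewrite ler_wpM2r.
  (* Origin of the 8: one factor 2 in [s], one from [nfun_mul_le_prim], one from [prim_add]. *)
  have : H x (2 * s) <= H x (8 * lambda * enorm xi) + H x (8 * lambda * enorm (zeta - xi)).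
    have -> : 2 * s = 4 * lambda * enorm xi + 4 * lambda * enorm (zeta - xi).
      by rewrite /s /m; ring.
    rewrite (_ : 8 * lambda * enorm xi = 2 * (4 * lambda * enorm xi)); last by ring.
    rewrite (_ : 8 * lambda * enorm (zeta - xi) = 2 * (4 * lambda * enorm (zeta - xi))); last by ring.
    by apply: prim_add => //; rewrite mulr_ge0 ?enorm_ge0// mulr_ge0// ltW.
  have := Ceta; have : 0 <= h x eta * eta by rewrite mulr_ge0 ?dp_h_ge0// ltW.
  lra.
- rewrite -leNgt => bc; rewrite addr0.
  have := nfun_young hn (ltW eta0) t0; have := dp_h_lb Ox eta01.
  have : lambda * b * t <= h x eta * t.
    by rewrite ler_wpM2r// (le_trans bc)// dp_h_lb.
  lra.
Qed.

Definition measurable_field G := forall i, measurable_fun Om (fun x => G x ord0 i).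

Lemma measurable_fieldB G V : measurable_field G -> measurable_field V ->
  measurable_field (fun x => G x - V x).
Proof.
by move=> mG mV i; under eq_fun do rewrite !mxE; exact: measurable_funB.
Qed.

Lemma measurable_field_enorm G : measurable_field G -> measurable_fun Om (fun x => enorm (G x)).
Proof. exact: measurable_enorm. Qed.

Lemma measurable_field_dp_vec G : measurable_field G -> measurable_field (fun x => dp_vec x (G x)).
Proof.
move=> mG i; under eq_fun do rewrite mxE; apply: measurable_funM => //.
by apply: (measurable_dp_coef D); exact: measurable_field_enorm.
Qed.

Lemma measurable_H f : measurable_fun Om f -> (forall x, 0 <= f x) ->
  measurable_fun Om (fun x => H x (f x)).
Proof.
move=> mf f0; under eq_fun do rewrite -(ger0_norm (f0 _)).
exact: measurable_prim D _ mf.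
Qed.

(** Membership in the heart of the Musielak-Orlicz space, in general a stronger property than a
    finite modular. *)
Definition finite_energy f := forall k, 0 <= k -> (\int[lam]_(x in Om) (H x (k * f x))%:E < +oo)%E.

Lemma finite_energy_integrable f k : measurable_fun Om f -> (forall x, 0 <= f x) ->
  finite_energy f -> 0 <= k -> lam.-integrable Om (fun x => (H x (k * f x))%:E).
Proof.
move=> mf f0 fe k0; apply/integrableP; split.
  apply/measurable_EFinP; apply: measurable_H => [|x]; last by rewrite mulr_ge0.
  exact: measurable_funM.
apply: le_lt_trans (fe k k0); apply: ge0_le_integral => //.
- by apply/measurable_EFinP; apply: measurableT_comp => //; apply: measurable_H => [|x];
    [exact: measurable_funM|rewrite mulr_ge0].
- apply/measurable_EFinP; apply: measurable_H => [|x]; last by rewrite mulr_ge0.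
  exact: measurable_funM.
- by move=> x Ox; rewrite abse_EFin ger0_norm// H_ge0// mulr_ge0.
Qed.

End key_estimate.

Lemma cvg_ereal_lt_exists {R : realType} (u : nat -> \bar R) (l c : \bar R) : (l < c)%E ->
  u n @[n --> \oo] --> l -> exists n, (u n < c)%E.
Proof.
move=> lc ul.
have : \forall n \near \oo, (u n < c)%E.
  by apply: (ul [set y | (y < c)%E]); apply: open_nbhs_nbhs; split => //; exact: open_ereal_lt_ereal.
by move/filter_ex.
Qed.

Lemma summable_cvg0 {R : realType} (u : nat -> R) : (forall n, 0 <= u n) ->
  (\sum_(0 <= n <oo) (u n)%:E < +oo)%E -> u n @[n --> \oo] --> (0 : R).
Proof.
move=> u0 uoo; apply/cvgrPdist_lt => e e0.
have := @nneseries_tail_cvg R (EFin \o u) xpredT uoo (fun n _ => u0 n).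
move=> /(_ [set y | (y < e%:E)%E]) tl.
have : \forall n \near \oo, (\sum_(n <= k <oo) (u k)%:E < e%:E)%E.
  by apply: tl; apply: open_nbhs_nbhs; split; [exact: open_ereal_lt_ereal|rewrite /= lte_fin].
apply: filterS => n un; rewrite sub0r normrN ger0_norm// -lte_fin; apply: le_lt_trans un.
apply: le_trans (@nneseries_lim_ge R (EFin \o u) xpredT n n.+1 (fun k _ _ => u0 k)).
by rewrite big_nat1.
Qed.

(** * Dominated convergence along a summable sequence *)

Section dominated_threshold.
Context {dsp} {T : measurableType dsp} {R : realType} (m : {measure set T -> \bar R}).
Variable (D : set T).
Hypothesis mD : measurable D.
Variables (g : T -> R) (e : nat -> T -> R) (big : nat -> T -> bool).
Hypothesis ig : m.-integrable D (EFin \o g).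
Hypothesis g0 : forall x, D x -> 0 <= g x.
Hypothesis me : forall n, measurable_fun D (e n).
Hypothesis e0 : forall n x, D x -> 0 <= e n x.
Hypothesis ie : forall n, (\int[m]_(x in D) (e n x)%:E <= (1 / (2 ^ n.+1)%:R)%:E)%E.
Hypothesis mbig : forall n, measurable_fun D (big n).
Hypothesis big0 : forall x, D x -> e n x @[n --> \oo] --> (0 : R) ->
  \forall n \near \oo, ~~ big n x.

Let S x := (\sum_(0 <= n <oo) (e n x)%:E)%E.

Let S_ge n x : D x -> ((e n x)%:E <= S x)%E.
Proof.
move=> Dx; rewrite /S (@nneseriesD1 _ _ n)//; last by move=> k _; rewrite lee_fin e0.
by rewrite leeDl// nneseries_ge0// => k _ _; rewrite lee_fin e0.
Qed.

Let S0 x : D x -> (0 <= S x)%E.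
Proof. by move=> Dx; apply: le_trans (S_ge 0%N Dx); rewrite lee_fin e0. Qed.

Let iS : m.-integrable D S.
Proof.
apply/integrableP; split.
  apply: ge0_emeasurable_sum => [k x Dx _|k _]; first by rewrite lee_fin e0.
  exact/measurable_EFinP.
under eq_integral => x /[!inE] Dx do rewrite gee0_abs ?S0//.
rewrite integral_nneseries//; last by move=> n; exact/measurable_EFinP.
apply: (@le_lt_trans _ _ 1%:E); last exact: ltry.
apply: le_trans (@epsilon_trick0 R 1 xpredT ler01); apply: lee_nneseries => // n _ _.
by apply: integral_ge0 => x Dx; rewrite lee_fin e0.
Qed.

(** The sum [S] is integrable, hence finite almost everywhere; there [e n] tends to 0 and [big n]
    eventually fails, so the integrands tend to 0 under the majorant [g + S]. *)
Lemma dominated_threshold :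
  exists n, (\int[m]_(x in D) (if big n x then g x + e n x else 0)%:E < 1)%E.
Proof.
pose F n x := if big n x then g x + e n x else 0.
have mg : measurable_fun D g by move/measurable_int: ig => /measurable_EFinP.
have mF n : measurable_fun D (EFin \o F n).
  apply/measurable_EFinP; apply: measurable_fun_if => //.
  by apply: (measurable_funS mD); [exact: subIsetl|exact: measurable_funD].
have FS : \forall x \ae m, forall n, D x -> (`|(EFin \o F n) x| <= (g x)%:E + S x)%E.
  apply: aeW => x n Dx; rewrite /F/=; case: ifP => _; last first.
    by rewrite normr0 adde_ge0 ?S0// lee_fin g0.
  by rewrite ger0_norm ?addr_ge0 ?g0 ?e0// EFinD leeD2l// S_ge.
have cvF : \forall x \ae m, D x -> (EFin \o F n) x @[n --> \oo] --> cst 0%E x.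
  have := integrable_ae mD iS; apply: filterS => x Sfin Dx.
  have /fin_numP := Sfin Dx => -[_ Soo].
  have ecvg : e n x @[n --> \oo] --> (0 : R).
    by apply: summable_cvg0 => [n|]; [exact: e0|rewrite ltey; apply/eqP; move/eqP: Soo].
  apply: (@cvg_trans _ ((fun=> 0%E) @ \oo)); last exact: cvg_cst.
  by apply: near_eq_cvg; have := big0 Dx ecvg; apply: filterS => n /negbTE nb; rewrite /F/= nb.
have [_ _ cvI] := dominated_convergence mD mF (measurable_cst 0%E) cvF (integrableD mD ig iS) FS.
rewrite integral0 in cvI.
exact: cvg_ereal_lt_exists lte01 cvI.
Qed.

End dominated_threshold.

Section continuity_of_operator.
Context {R : realType} {d : nat}.
Variables (Om : set 'rV[R]_d) (p q : 'rV[R]_d -> R -> R) (mu : 'rV[R]_d -> R).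
Variables (Q M : R).
Hypothesis D : dp_data Om p q mu Q M.
Hypothesis Q0 : 0 <= Q.
Hypothesis M0 : 0 <= M.
Hypothesis lamO : (lebesgue_rV d Om < +oo)%E.
Local Notation lam := (@lebesgue_rV R d).
Local Notation H x := (prim (dp_h p q mu x)).
Local Notation vec := (dp_vec p q mu).
Let mO : measurable Om := dp_measurable D.
Implicit Types (f w : 'rV[R]_d -> R) (G V : 'rV[R]_d -> 'rV[R]_d).

(** Convexity makes an energy small as soon as a large multiple has energy at most 1; used with
    [eps = 1 / 2 ^ n.+1] to obtain a summable sequence. *)
Lemma integral_H_le1 f k eps : measurable_fun Om f -> (forall x, 0 <= f x) ->
  0 <= eps <= 1 -> 0 <= k -> (\int[lam]_(x in Om) (H x (k * f x))%:E <= 1)%E ->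
  (\int[lam]_(x in Om) (H x (eps * (k * f x)))%:E <= eps%:E)%E.
Proof.
move=> mf f0 eps01 k0 kf; have /andP[eps0 eps1] := eps01.
have mk c : 0 <= c -> measurable_fun Om (EFin \o (fun x => H x (c * f x))).
  move=> c0; apply/measurable_EFinP; apply: (measurable_H D); first exact: measurable_funM.
  by move=> x; rewrite mulr_ge0.
apply: (@le_trans _ _ (\int[lam]_(x in Om) (eps%:E * (H x (k * f x))%:E))%E).
  apply: ge0_le_integral => //.
  - by move=> x Ox; rewrite lee_fin (H_ge0 D Ox)// !mulr_ge0.
  - have := mk (eps * k); rewrite mulr_ge0// => /(_ isT); apply: eq_measurable_fun.
    by move=> x _; rewrite /= mulrA.
  - by apply: measurable_funeM; exact: mk.
  - move=> x Ox; rewrite -EFinM lee_fin; apply: (prim_scale (nfun_dp_h D Ox)) => //.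
    by rewrite mulr_ge0.
rewrite ge0_integralZl_EFin//; last exact: mk.
- by rewrite -[leRHS]mule1; apply: lee_wpmul2l; rewrite ?lee_fin.
- by move=> x Ox; rewrite lee_fin (H_ge0 D Ox)// !mulr_ge0.
Qed.

(* Otherwise there are fields [V n] for [delta = del n], and the energies [E n] of
   [kap * (V n - G)] have a summable sequence of integrals. Their sum is finite
   almost everywhere, which makes [V n] converge to [G] almost everywhere, and it
   dominates the sequence, as needed for the dominated convergence theorem. *)
Lemma integral_operator_increment G : measurable_field Om G ->
  finite_energy Om p q mu (fun x => enorm (G x)) ->
  forall eps, 0 < eps -> exists2 delta, 0 < delta & forall V w,
    measurable_field Om V ->
    (\int[lam]_(x in Om) (H x (delta^-1 * enorm (V x - G x)))%:E <= 1)%E ->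
    measurable_fun Om w -> (forall x, 0 <= w x) ->
    (\int[lam]_(x in Om) (H x (w x))%:E <= 1)%E ->
    (\int[lam]_(x in Om) (enorm (vec x (V x) - vec x (G x)) * w x)%:E <= eps%:E)%E.
Proof.
move=> mG feG eps eps0.
(* Three terms will each integrate to at most 1, and [3 / lambda <= eps]. *)
pose lambda := 1 + 3 / eps.
have l1 : 1 <= lambda by rewrite lerDl divr_ge0// ltW.
have l0 : 0 < lambda by rewrite (lt_le_trans _ l1).
pose kap := 8 * lambda.
have kap0 : 0 < kap by rewrite mulr_gt0.
have kap_ge0 := ltW kap0.
pose C := (1 + M) * 2 `^ Q.
have C0 : 0 <= C by rewrite mulr_ge0 ?powR_ge0// addr_ge0.
pose vol := fine (lam Om).
have volE : lam Om = vol%:E by rewrite fineK// ge0_fin_numE.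
have vol0 : 0 <= vol by rewrite fine_ge0.
(* Chosen so that [eta <= 1] and the constant [C * eta] integrates to at most 1 over [Om]. *)
pose eta := (1 + C * vol)^-1.
have Cv0 : 0 <= C * vol by rewrite mulr_ge0.
have eta0 : 0 < eta by rewrite invr_gt0 ltr_wpDr.
have eta1 : eta <= 1 by rewrite invf_le1 ?ltr_wpDr// lerDl.
have eta01 : 0 < eta <= 1 by apply/andP.
have Ceta : C * eta * vol <= 1.
  by rewrite mulrAC -ler_pdivlMr// invrK mul1r lerDr.
(* Its inverse is [2 ^ n.+1] times [kap], so scaling down to [kap] leaves an energy of at most
   [1 / 2 ^ n.+1]. *)
pose del n := (kap * (2 ^ n.+1)%:R)^-1.
have del0 n : 0 < del n by rewrite invr_gt0 mulr_gt0// ltr0n expn_gt0.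
apply: contrapT => /forall2NP neg.
have /choice[F HF] : forall n, exists Vw : ('rV[R]_d -> 'rV[R]_d) * ('rV[R]_d -> R),
    [/\ measurable_field Om Vw.1,
        (\int[lam]_(x in Om) (H x ((del n)^-1 * enorm (Vw.1 x - G x)))%:E <= 1)%E,
        measurable_fun Om Vw.2 /\ (forall x, 0 <= Vw.2 x),
        (\int[lam]_(x in Om) (H x (Vw.2 x))%:E <= 1)%E &
        ~ (\int[lam]_(x in Om) (enorm (vec x (Vw.1 x) - vec x (G x)) * Vw.2 x)%:E <= eps%:E)%E].
  move=> n; have [//|nH] := neg (del n).
  apply: contrapT => nF; apply: nH => V w mV V1 mw w0 w1.
  apply: contrapT => nE; apply: nF; exists (V, w).
  by split; [exact: mV|exact: V1|split; [exact: mw|exact: w0]|exact: w1|exact: nE].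
pose V n := (F n).1; pose w n := (F n).2.
have mV n : measurable_field Om (V n) by have [] := HF n.
have mw n : measurable_fun Om (w n) by have [_ _ []] := HF n.
have w0 n x : 0 <= w n x by have [_ _ [_ wn0] _ _] := HF n; exact: wn0.
have w1 n : (\int[lam]_(x in Om) (H x (w n x))%:E <= 1)%E by have [_ _ _ wn1 _] := HF n.
pose dV n x := enorm (V n x - G x).
have mdV n : measurable_fun Om (dV n) by apply: measurable_enorm; exact: measurable_fieldB.
have dV0 n x : 0 <= dV n x by exact: enorm_ge0.
pose E n x := H x (kap * dV n x).
have E0 n x : Om x -> 0 <= E n x by move=> Ox; apply: (H_ge0 D Ox); rewrite mulr_ge0.
have mE n : measurable_fun Om (E n).
  apply: (measurable_H D) => [|x]; first exact: measurable_funM.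
  by rewrite mulr_ge0.
have intE n : (\int[lam]_(x in Om) (E n x)%:E <= (1 / (2 ^ n.+1)%:R)%:E)%E.
  have [_ V1 _ _ _] := HF n.
  have p2 : 0 < (2 ^ n.+1)%:R :> R by rewrite ltr0n expn_gt0.
  have i01 : 0 <= (1 / (2 ^ n.+1)%:R : R) <= 1.
    by apply/andP; split; [exact: divr_ge0|rewrite ler_pdivrMr// mul1r ler1n expn_gt0].
  have id0 : 0 <= (del n)^-1 by rewrite invr_ge0 ltW.
  have EE x : 1 / (2 ^ n.+1)%:R * ((del n)^-1 * dV n x) = kap * dV n x.
    by rewrite /del invrK mulrA [kap * _]mulrC mulrA mul1r mulVf ?mul1r// gt_eqF.
  have := integral_H_le1 (mdV n) (dV0 n) i01 id0 V1.
  by under eq_integral do rewrite EE.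
pose EG x := H x (kap * enorm (G x)).
have EG0 x : Om x -> 0 <= EG x by move=> Ox; apply: (H_ge0 D Ox); rewrite mulr_ge0 ?enorm_ge0.
have iEG : lam.-integrable Om (EFin \o EG).
  apply: (finite_energy_integrable D) (ltW kap0) => //; first exact: measurable_enorm.
  by move=> x; exact: enorm_ge0.
have mEG : measurable_fun Om EG by move/measurable_int: iEG => /measurable_EFinP.
pose b n x := enorm (vec x (V n x) - vec x (G x)).
have mb n : measurable_fun Om (b n).
  apply: measurable_enorm; apply: measurable_fieldB; exact: (measurable_field_dp_vec D).
pose c := eta `^ Q * eta.
have c0 : 0 < c by rewrite mulr_gt0// powR_gt0.
have mbig n : measurable_fun Om (fun x => c < lambda * b n x).
  apply: measurable_fun_ltr; first exact: measurable_cst.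
  by apply: measurable_funM; [exact: measurable_cst|exact: mb].
have big0 x : Om x -> E n x @[n --> \oo] --> (0 : R) ->
    \forall n \near \oo, ~~ (c < lambda * b n x).
  move=> Ox Ecvg.
  have dcvg : dV n x @[n --> \oo] --> (0 : R).
    apply/cvgrPdist_lt => r r0; have v0 := H_gt0 D Ox (mulr_gt0 kap0 r0).
    move/cvgrPdist_lt : Ecvg => /(_ _ v0); apply: filterS => n.
    rewrite !sub0r !normrN (ger0_norm (E0 n x Ox)) (ger0_norm (dV0 n x)).
    rewrite !ltNge; apply: contra => rd.
    apply: (prim_le (nfun_dp_h D Ox)); first by rewrite mulr_ge0// ltW.
    by rewrite ler_pM2l.
  have bcvg := dp_vec_cvg D Ox dcvg.
  have cl : 0 < c / lambda by rewrite divr_gt0.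
  move/cvgrPdist_lt : bcvg => /(_ _ cl); apply: filterS => n.
  rewrite sub0r normrN ger0_norm ?enorm_ge0// => bn.
  by rewrite -leNgt mulrC -ler_pdivlMr// ltW.
have [n Fn] := dominated_threshold mO iEG EG0 mE E0 intE mbig big0.
pose F' x := if c < lambda * b n x then EG x + E n x else 0.
have mF : measurable_fun Om F'.
  apply: (measurable_fun_if mO (mbig n)); last exact: measurable_cst.
  by apply: (measurable_funS mO); [exact: subIsetl|apply: measurable_funD; [exact: mEG|exact: mE]].
have F0 x : Om x -> 0 <= F' x.
  move=> Ox; rewrite /F'; case: ifP => _; last exact: lexx.
  by apply: addr_ge0; [exact: EG0|exact: E0].
have [_ _ _ _] := HF n; apply; rewrite -/(V n) -/(w n).
have : (\int[lam]_(x in Om) (lambda * (b n x * w n x))%:E <= 3%:E)%E.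
  have Ho : measurable_fun Om (fun x => H x (w n x)) by exact: (measurable_H D).
  apply: (@le_trans _ _ (\int[lam]_(x in Om) (((C * eta)%:E + (F' x)%:E) + (H x (w n x))%:E))%E).
    apply: ge0_le_integral => //.
    - move=> x Ox; rewrite lee_fin mulr_ge0 ?mulr_ge0 ?enorm_ge0//; exact: ltW.
    - apply/measurable_EFinP; apply: measurable_funM => //; exact: measurable_funM.
    - apply/measurable_EFinP; apply: measurable_funD => //; exact: measurable_funD.
    - move=> x Ox; rewrite -!EFinD lee_fin.
      exact: (@dp_vec_young _ _ _ _ _ _ _ _ D Q0 M0 x (G x) (V n x) (w n x) lambda eta Ox (w0 n x) l1 eta01).
  have C1 x : Om x -> (0 <= (C * eta)%:E)%E by move=> _; rewrite lee_fin mulr_ge0// ltW.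
  have F1 x : Om x -> (0 <= (F' x)%:E)%E by move=> Ox; rewrite lee_fin F0.
  have CF1 x : Om x -> (0 <= (C * eta)%:E + (F' x)%:E)%E.
    by move=> Ox; apply: adde_ge0; [exact: (C1 x)|exact: F1].
  have H1 x : Om x -> (0 <= (H x (w n x))%:E)%E by move=> Ox; rewrite lee_fin (H_ge0 D Ox).
  have mC : measurable_fun Om (fun=> (C * eta)%:E : \bar R) by exact: measurable_cst.
  have mF1 : measurable_fun Om (EFin \o F') by exact/measurable_EFinP.
  have mH1 : measurable_fun Om (EFin \o (fun x => H x (w n x))) by exact/measurable_EFinP.
  rewrite (ge0_integralD _ mO CF1 (emeasurable_funD mC mF1) H1 mH1).
  rewrite (ge0_integralD _ mO C1 mC F1 mF1).
  (* One unit each for the threshold term, the term made small by the choice of [n], and the modular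
     of [w n]. *)
  rewrite (_ : 3%:E = (1%:E + 1%:E) + 1%:E :> \bar R)%E; last by rewrite -!EFinD; congr EFin; lra.
  apply: leeD => //; apply: leeD; last exact: ltW.
  have -> : (\int[lam]_(x in Om) (C * eta)%:E = (C * eta)%:E * lam Om)%E.
    exact: (@integral_cst _ _ _ lam Om mO (C * eta)%:E).
  by rewrite volE -EFinM lee_fin.
under eq_integral do rewrite EFinM.
have bw1 x : Om x -> (0 <= (b n x * w n x)%:E)%E.
  by move=> Ox; rewrite lee_fin mulr_ge0 ?enorm_ge0.
have mbw : measurable_fun Om (EFin \o (fun x => b n x * w n x)).
  by apply/measurable_EFinP; apply: measurable_funM; [exact: mb|exact: mw].
rewrite (ge0_integralZl_EFin _ mO bw1 mbw (ltW l0)).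
rewrite muleC -lee_pdivlMr// => /le_trans; apply; rewrite lee_fin.
by rewrite ler_pdivrMr// /lambda mulrDr mulr1 mulrC divfK ?gt_eqF// lerDr ltW.
Qed.

End continuity_of_operator.

(** * The Luxemburg norm and the regularity of gradients *)

Section sobolev_level.
Context {R : realType} {d : nat}.
Variables (Om : set 'rV[R]_d) (p q : 'rV[R]_d -> R -> R) (mu : 'rV[R]_d -> R).
Variables (Q M : R).
Hypothesis oO : open Om.
Hypothesis D : dp_data Om p q mu Q M.
Hypothesis Q0 : 0 <= Q.
Hypothesis M0 : 0 <= M.
Hypothesis lamO : (lebesgue_rV d Om < +oo)%E.
Local Notation lam := (@lebesgue_rV R d).
Local Notation h := (dp_h p q mu).
Local Notation H x := (prim (dp_h p q mu x)).
Local Notation vec := (dp_vec p q mu).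
Local Notation grad := (grad Om).
Local Notation W := (W01H Om (dp_H p q mu)).
Local Notation N := (W1H_norm Om (dp_H p q mu)).
Let mO : measurable Om := dp_measurable D.
Implicit Types (f g : 'rV[R]_d -> R) (u v phi : 'rV[R]_d -> R) (G V : 'rV[R]_d -> 'rV[R]_d).

Definition rho f : \bar R := (\int[lam]_(x in Om) (H x (f x))%:E)%E.

Definition nonneg_measurable f := measurable_fun Om f /\ forall x, 0 <= f x.

Lemma nonneg_measurableZ k f : 0 <= k -> nonneg_measurable f ->
  nonneg_measurable (fun x => k * f x).
Proof.
by move=> k0 [mf f0]; split => [|x]; [exact: measurable_funM|rewrite mulr_ge0].
Qed.

Lemma measurable_H_comp f : nonneg_measurable f ->
  measurable_fun Om (EFin \o (fun x => H x (f x))).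
Proof. by move=> [mf f0]; apply/measurable_EFinP; exact: (measurable_H D). Qed.

Lemma H_comp_ge0 f x : nonneg_measurable f -> Om x -> (0 <= (H x (f x))%:E)%E.
Proof. by move=> [_ f0] Ox; rewrite lee_fin; exact: (H_ge0 D Ox). Qed.

Lemma rho_ge0 f : nonneg_measurable f -> (0 <= rho f)%E.
Proof. by move=> nf; apply: integral_ge0 => x; exact: H_comp_ge0. Qed.

Lemma modular_rho f : nonneg_measurable f -> modular Om (dp_H p q mu) f = rho f.
Proof. by move=> [_ f0]; apply: eq_integral => x _; rewrite dp_HE. Qed.

Lemma rho_le f g : nonneg_measurable f -> nonneg_measurable g ->
  (\forall x \ae lam, Om x -> f x <= g x) -> (rho f <= rho g)%E.
Proof.
move=> nf ng fg; apply: ae_ge0_le_integral => //.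
- by move=> x; exact: H_comp_ge0.
- exact: measurable_H_comp.
- by move=> x; exact: H_comp_ge0.
- exact: measurable_H_comp.
- apply: filterS fg => x fg Ox; rewrite lee_fin; apply: (prim_le (nfun_dp_h D Ox)); last exact: fg.
  by case: nf.
Qed.

Lemma rho_add f g : nonneg_measurable f -> nonneg_measurable g ->
  (rho (fun x => (f x + g x)%R) <= rho (fun x => (2 * f x)%R) + rho (fun x => (2 * g x)%R))%E.
Proof.
move=> nf ng; have [mf f0] := nf; have [mg g0] := ng.
have nf2 : nonneg_measurable (fun x => 2 * f x) by exact: nonneg_measurableZ.
have ng2 : nonneg_measurable (fun x => 2 * g x) by exact: nonneg_measurableZ.
have nfg : nonneg_measurable (fun x => f x + g x).
  by split => [|x]; [exact: measurable_funD|rewrite addr_ge0].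
rewrite /rho -(ge0_integralD _ mO (fun x => H_comp_ge0 nf2) (measurable_H_comp nf2)
  (fun x => H_comp_ge0 ng2) (measurable_H_comp ng2)).
apply: ge0_le_integral => //.
- by move=> x; exact: (H_comp_ge0 nfg).
- exact: (measurable_H_comp nfg).
- by apply: emeasurable_funD; [exact: (measurable_H_comp nf2)|exact: (measurable_H_comp ng2)].
- by move=> x Ox; rewrite -EFinD lee_fin; exact: (prim_add (nfun_dp_h D Ox)).
Qed.

Lemma rho_scale k f : 0 <= k <= 1 -> nonneg_measurable f ->
  (rho (fun x => (k * f x)%R) <= k%:E * rho f)%E.
Proof.
move=> k01 nf; have /andP[k0 _] := k01; have [mf f0] := nf.
rewrite /rho -(ge0_integralZl_EFin _ mO (fun x => H_comp_ge0 nf) (measurable_H_comp nf) k0).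
have nk := nonneg_measurableZ k0 nf.
apply: ge0_le_integral => //.
- by move=> x; exact: (H_comp_ge0 nk).
- exact: (measurable_H_comp nk).
- by apply: measurable_funeM; exact: measurable_H_comp.
- by move=> x Ox; rewrite -EFinM lee_fin; exact: (prim_scale (nfun_dp_h D Ox)).
Qed.

Lemma rho_cst_lty c : 0 <= c -> (rho (fun=> c) < +oo)%E.
Proof.
move=> c0.
apply: (@le_lt_trans _ _ (\int[lam]_(x in Om) ((1 + M) * (1 + c) `^ Q * c * c)%:E)%E).
  apply: ge0_le_integral => //.
  - by move=> x Ox; rewrite lee_fin; exact: (H_ge0 D Ox).
  - by apply: (@measurable_H_comp (fun=> c)); split.
  - move=> x Ox; rewrite lee_fin.
    have /andP[_] := prim_incr (nfun_dp_h D Ox) (lexx 0) c0; rewrite prim0 !subr0.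
    move=> /le_trans; apply; rewrite ler_wpM2r//; exact: (dp_h_ub D Ox).
set C := _ * c.
have -> : (\int[lam]_(x in Om) C%:E = C%:E * lam Om)%E by exact: (@integral_cst _ _ _ lam Om mO C%:E).
have -> : lam Om = (fine (lam Om))%:E by rewrite fineK// ge0_fin_numE.
by rewrite -EFinM ltry.
Qed.

Lemma lux_norm_ge0 f : 0 <= lux_norm Om (dp_H p q mu) f.
Proof.
rewrite /lux_norm; have [->|/set0P S0] := eqVneq [set l | 0 < l /\
    (modular Om (dp_H p q mu) (fun x => (f x / l)%R) <= 1)%E] set0; first by rewrite inf0.
by apply: lb_le_inf => // l [/ltW].
Qed.

(* The [inf] defining the Luxemburg norm is [0] on the empty set, hence the
   hypothesis on [rho (k * f)]. *)
Lemma lux_norm_lt f k l : nonneg_measurable f -> 0 < k -> (rho (fun x => (k * f x)%R) < +oo)%E ->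
  lux_norm Om (dp_H p q mu) f < l -> (rho (fun x => (l^-1 * f x)%R) <= 1)%E.
Proof.
move=> nf k0 fk fl; have l0 : 0 < l by apply: le_lt_trans fl; exact: lux_norm_ge0.
have modE c : 0 < c -> modular Om (dp_H p q mu) (fun x => (f x / c)%R) = rho (fun x => (c^-1 * f x)%R).
  move=> c0; rewrite -modular_rho; last by apply: nonneg_measurableZ => //; rewrite invr_ge0 ltW.
  by congr modular; apply/funext => x; rewrite mulrC.
have nkf := nonneg_measurableZ (ltW k0) nf.
have S0 : [set c | 0 < c /\ (modular Om (dp_H p q mu) (fun x => (f x / c)%R) <= 1)%E] !=set0.
  pose r := fine (rho (fun x => (k * f x)%R)).
  have r0 : 0 <= r by rewrite fine_ge0// rho_ge0.
  have rE : rho (fun x => (k * f x)%R) = r%:E by rewrite fineK// ge0_fin_numE// rho_ge0.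
  have r1 : 0 < 1 + r by rewrite ltr_wpDr.
  (* Dividing [k * f], of modular [r], by [1 + r] brings the modular down to [r / (1 + r)] at most,
     by convexity. *)
  exists ((1 + r) / k); rewrite /= divr_gt0//; split => //; rewrite modE ?divr_gt0//.
  have r01 : 0 <= (1 + r)^-1 <= 1 by rewrite invr_ge0 (ltW r1)/= invf_le1// lerDl.
  have := rho_scale r01 nkf; rewrite rE -EFinM.
  have -> : (fun x => (1 + r)^-1 * (k * f x)) = (fun x => ((1 + r) / k)^-1 * f x).
    by apply/funext => x; rewrite invf_div mulrA; congr (_ * _); rewrite mulrC.
  move=> /le_trans; apply; rewrite lee_fin mulrC ler_pdivrMr// mul1r lerDr//.
have [c [c0 fc] cl] := inf_lt S0 fl.
have {}fc : (rho (fun x => (c^-1 * f x)%R) <= 1)%E by rewrite -(modE c c0).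
apply: le_trans fc; apply: rho_le.
- by apply: nonneg_measurableZ => //; rewrite invr_ge0 ltW.
- by apply: nonneg_measurableZ => //; rewrite invr_ge0 ltW.
- apply: aeW => x _; have [_ f0] := nf; rewrite ler_wpM2r// lef_pV2 ?posrE// ltW//.
Qed.

Lemma weak_gradient_measurable u G : weak_gradient Om u G -> measurable_field Om G.
Proof. by move=> [_ lG _] i; have [] := lG i. Qed.

Lemma grad_nonneg_measurable u : weakly_differentiable Om u ->
  nonneg_measurable (fun x => enorm (grad u x)).
Proof.
move=> /grad_weak_gradient/weak_gradient_measurable mG; split => [|x].
  exact: measurable_field_enorm.
exact: enorm_ge0.
Qed.

Lemma rho_grad_lin k (a : R) u v : 0 <= k -> weakly_differentiable Om u -> weakly_differentiable Om v ->
  (rho (fun x => (k * enorm (grad (a *: u + v) x))%R) <=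
   rho (fun x => (2 * k * `|a| * enorm (grad u x))%R) + rho (fun x => (2 * k * enorm (grad v x))%R))%E.
Proof.
move=> k0 du dv; have nu := grad_nonneg_measurable du; have nv := grad_nonneg_measurable dv.
have duv : weakly_differentiable Om (a *: u + v).
  exists (a *: grad u + grad v); apply: weak_gradient_lin => //; exact: grad_weak_gradient.
have nuv := grad_nonneg_measurable duv.
have nku : nonneg_measurable (fun x => k * `|a| * enorm (grad u x)).
  by apply: nonneg_measurableZ => //; rewrite mulr_ge0.
have nkv : nonneg_measurable (fun x => k * enorm (grad v x)) by exact: nonneg_measurableZ.
have -> : rho (fun x => 2 * k * `|a| * enorm (grad u x)) = rho (fun x => 2 * (k * `|a| * enorm (grad u x))).
  by apply: eq_integral => x _; rewrite !mulrA.
have -> : rho (fun x => 2 * k * enorm (grad v x)) = rho (fun x => 2 * (k * enorm (grad v x))).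
  by apply: eq_integral => x _; rewrite !mulrA.
apply: le_trans (rho_add nku nkv); apply: rho_le.
- exact: (nonneg_measurableZ k0 nuv).
- case: nku => mku ku0; case: nkv => mkv kv0; split => [|x]; first exact: (measurable_funD mku mkv).
  exact: (addr_ge0 (ku0 x) (kv0 x)).
- have := grad_lin oO a du dv; apply: filterS => x guv Ox; rewrite guv//.
  rewrite -mulrA -mulrDr ler_wpM2l//; apply: le_trans (enormD _ _) _.
  by rewrite enormZ.
Qed.

(** The class on which all estimates are carried out: a linear space containing the test functions
    and [W], described without reference to density. *)
Definition regular u := weakly_differentiable Om u /\
  finite_energy Om p q mu (fun x => enorm (grad u x)).

Lemma regular_lin (a : R) u v : regular u -> regular v -> regular (a *: u + v).
Proof.
move=> [du eu] [dv ev]; split.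
  exists (a *: grad u + grad v); apply: weak_gradient_lin => //; exact: grad_weak_gradient.
move=> k k0; apply: le_lt_trans (rho_grad_lin a k0 du dv) _.
by apply: lte_add_pinfty; [apply: eu|apply: ev]; rewrite ?mulr_ge0.
Qed.

Lemma regularB u v : regular u -> regular v -> regular (u - v).
Proof.
move=> ru rv; rewrite (_ : u - v = -1 *: v + u); first exact: regular_lin.
by rewrite scaleN1r addrC.
Qed.

Lemma regularD u v : regular u -> regular v -> regular (u + v).
Proof. by move=> ru rv; rewrite -[u]scale1r; exact: regular_lin. Qed.

Lemma regular_test_fun phi : test_fun Om phi -> regular phi.
Proof.
move=> tp; have wp := weak_gradient_test_fun oO tp.
have dp : weakly_differentiable Om phi by eexists; exact: wp.
split => // k k0.
pose s x := enorm (strong_gradient phi x).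
have cs : continuous s.
  move=> x; apply: (@continuous_comp _ _ _ (strong_gradient phi) (@enorm R d)); last exact: enorm_continuous.
  apply: continuous_rV => i; rewrite (_ : (fun t => _) = partial i phi).
    exact: test_fun_partial_continuous tp i.
  by apply/funext => y; rewrite mxE.
have [_ cK _] := tp.
have [B B0 sB] := continuous_compact_bounded cs cK.
apply: le_lt_trans (rho_cst_lty (mulr_ge0 k0 B0)).
apply: rho_le.
- by apply: nonneg_measurableZ => //; exact: grad_nonneg_measurable.
- by split => // x; rewrite mulr_ge0.
- have := weak_gradient_unique oO (aeW _ (fun x _ => erefl)) (grad_weak_gradient dp) wp.
  apply: filterS => x gE Ox; rewrite ler_wpM2l// gE//.
  have [Kx|Kx] := pselect (closure [set x | phi x != 0] x).
    by have := sB x Kx; rewrite ger0_norm// enorm_ge0.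
  rewrite (_ : strong_gradient phi x = 0) ?enorm0//.
  by apply/rowP => i; rewrite !mxE (test_fun_partial_supp i Kx).
Qed.

Lemma lux_grad_le_norm u : lux_norm Om (dp_H p q mu) (fun x => enorm (grad u x)) <= N u.
Proof. by rewrite /W1H_norm lerDr lux_norm_ge0. Qed.

Lemma W1H_norm_ge0 u : 0 <= N u.
Proof. by rewrite addr_ge0// lux_norm_ge0. Qed.

Lemma regular_norm_lt u l : regular u -> N u < l ->
  (rho (fun x => (l^-1 * enorm (grad u x))%R) <= 1)%E.
Proof.
move=> [du eu] ul; apply: (@lux_norm_lt _ 1) => //.
- exact: grad_nonneg_measurable.
- exact: eu.
- exact: le_lt_trans (lux_grad_le_norm u) ul.
Qed.

(* [H] need not satisfy the Delta_2 condition, since [p x] and [q x] may increase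
   abruptly; the density of the test functions is what makes every multiple of
   the gradient of an element of [W] have finite energy. *)
Lemma W_regular u : W u -> regular u.
Proof.
move=> [[_ du [_ eu]] dense]; split => // k k0.
have nu := grad_nonneg_measurable du.
have {}eu : (rho (fun x => enorm (grad u x)) < +oo)%E by rewrite -(modular_rho nu).
(* Splitting [u] into [phi] and [u - phi] doubles the factor [k], and [2 * k <= eps^-1]; the added 1
   covers [k = 0]. *)
pose eps := (2 * (k + 1))^-1.
have k1 : 0 < k + 1 by rewrite ltr_wpDl.
have eps0 : 0 < eps by rewrite invr_gt0 mulr_gt0.
have [phi tp uphi] := dense eps eps0.
have [dp ep] := regular_test_fun tp.
have E : u - phi = -1 *: phi + u by rewrite scaleN1r addrC.
rewrite E in uphi.
have duphi : weakly_differentiable Om (-1 *: phi + u).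
  exists (-1 *: grad phi + grad u); apply: weak_gradient_lin => //; exact: grad_weak_gradient.
have nuphi := grad_nonneg_measurable duphi.
have half : 0 < 2^-1 :> R by rewrite invr_gt0.
(* Some multiple must have finite energy before the Luxemburg norm says anything. The factor one
   half offsets the doubling in [rho_grad_lin], the energy of [u] being known so far only for the
   factor 1. *)
have fin : (rho (fun x => (2^-1 * enorm (grad (-1 *: phi + u) x))%R) < +oo)%E.
  apply: le_lt_trans (rho_grad_lin (-1) (ltW half) dp du) _.
  rewrite mulfV// !mul1r; apply: lte_add_pinfty; first by apply: ep.
  by under [X in rho X]eq_fun do rewrite mul1r.
have le1 := lux_norm_lt nuphi half fin (le_lt_trans (lux_grad_le_norm _) uphi).
change (rho (fun x => (k * enorm (grad u x))%R) < +oo)%E.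
have -> : (fun x => k * enorm (grad u x)) = (fun x => k * enorm (grad (1 *: phi + (-1 *: phi + u)) x)).
  have -> : 1 *: phi + (-1 *: phi + u) = u by rewrite scale1r addrA scaleN1r subrr add0r.
  by [].
apply: le_lt_trans (rho_grad_lin 1 k0 dp duphi) _.
apply: lte_add_pinfty; first by apply: ep; rewrite !mulr_ge0.
apply: (@le_lt_trans _ _ 1%E); last exact: ltry.
apply: le_trans le1; apply: rho_le.
- by apply: nonneg_measurableZ => //; rewrite mulr_ge0.
- by apply: nonneg_measurableZ => //; rewrite invr_ge0 ltW.
- apply: aeW => x _; rewrite ler_wpM2r ?enorm_ge0// /eps invrK ler_wpM2l//.
  by rewrite lerDl.
Qed.

End sobolev_level.

(** * Differentiability of the energy *)

Section functional.
Context {R : realType} {d : nat}.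
Variables (Om : set 'rV[R]_d) (p q : 'rV[R]_d -> R -> R) (mu : 'rV[R]_d -> R).
Variables (Q M : R).
Hypothesis oO : open Om.
Hypothesis D : dp_data Om p q mu Q M.
Hypothesis Q0 : 0 <= Q.
Hypothesis M0 : 0 <= M.
Hypothesis lamO : (lebesgue_rV d Om < +oo)%E.
Local Notation lam := (@lebesgue_rV R d).
Local Notation H x := (prim (dp_h p q mu x)).
Local Notation vec := (dp_vec p q mu).
Local Notation grad := (grad Om).
Local Notation N := (W1H_norm Om (dp_H p q mu)).
Local Notation rho := (rho Om p q mu).
Local Notation regular := (regular Om p q mu).
Local Notation I := (gradient_energy Om (dp_H p q mu)).
Local Notation A := (dp_A p q mu Om).
Let mO : measurable Om := dp_measurable D.
Implicit Types (x xi zeta : 'rV[R]_d) (f g : 'rV[R]_d -> R) (u v w : 'rV[R]_d -> R) (G : 'rV[R]_d -> 'rV[R]_d).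

Lemma Rintegral_norm_le f g (c : R) : lam.-integrable Om (EFin \o f) ->
  measurable_fun Om g -> (forall x, Om x -> `|f x| <= g x) ->
  (\int[lam]_(x in Om) (g x)%:E <= c%:E)%E -> `|\int[lam]_(x in Om) f x| <= c.
Proof.
move=> fi mg fg gc; rewrite -lee_fin EFin_normr_Rintegral//.
apply: le_trans gc; apply: le_trans (le_abse_integral lam mO (measurable_int _ fi)) _.
apply: ge0_le_integral => //.
- by apply/measurable_EFinP; apply: measurableT_comp => //; move/measurable_int : fi => /measurable_EFinP.
- exact/measurable_EFinP.
Qed.

Lemma Rintegral_ae_eq f g : measurable_fun Om f -> measurable_fun Om g ->
  (\forall x \ae lam, Om x -> f x = g x) ->
  \int[lam]_(x in Om) f x = \int[lam]_(x in Om) g x.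
Proof.
move=> mf mg fg; rewrite /Rintegral; congr fine; apply: ae_eq_integral => //.
- exact/measurable_EFinP.
- exact/measurable_EFinP.
- by apply: filterS fg => x fg Ox; rewrite fg.
Qed.

Lemma dp_A_integrandE u v x : dp_A_integrand p q mu Om u v x = edot (vec x (grad u x)) (grad v x).
Proof.
by rewrite /dp_A_integrand /dp_vec edotZl /dp_coef /wpow ger0_norm ?enorm_ge0// mulrDl.
Qed.

Lemma edot_dp_vec_le x xi zeta : Om x -> `|edot (vec x xi) zeta| <= H x (2 * enorm xi) + H x (enorm zeta).
Proof.
move=> Ox; have hn := nfun_dp_h D Ox.
apply: le_trans (cauchy_schwarz _ _) _; rewrite (enorm_dp_vec D)//.
have := nfun_young hn (enorm_ge0 xi) (enorm_ge0 zeta).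
by have := nfun_mul_le_prim hn (enorm_ge0 xi); lra.
Qed.

(** The field is a subgradient of [H x (enorm xi)] in [xi]: Cauchy-Schwarz reduces this to the
    radial inequality [prim_convex]. *)
Lemma edot_dp_vec_convex x xi zeta : Om x ->
  edot (vec x xi) (zeta - xi) <= H x (enorm zeta) - H x (enorm xi).
Proof.
move=> Ox; apply: le_trans (prim_convex (nfun_dp_h D Ox) (enorm_ge0 xi) (enorm_ge0 zeta)).
have /andP[mu0 _] := dp_mu D Ox.
rewrite dp_hE /dp_vec edotZl -mulrA ler_wpM2l ?dp_coef_ge0//.
rewrite edotDr -scaleN1r edotZr -enorm_sqr expr2 mulrBr.
by have := edot_le xi zeta; lra.
Qed.

Lemma regular_field u : regular u -> measurable_field Om (grad u).
Proof. by move=> [/grad_weak_gradient/weak_gradient_measurable]. Qed.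

Lemma regular_nonneg_measurable u : regular u -> nonneg_measurable Om (fun x => enorm (grad u x)).
Proof. by move=> [/grad_nonneg_measurable]. Qed.

Lemma integrable_H_grad k u : 0 <= k -> regular u ->
  lam.-integrable Om (EFin \o (fun x => H x (k * enorm (grad u x)))).
Proof.
move=> k0 ru; have [mu_ u0] := regular_nonneg_measurable ru; have [_ eu] := ru.
exact: (finite_energy_integrable D mu_ u0 eu k0).
Qed.

Lemma integrable_H_grad1 u : regular u ->
  lam.-integrable Om (EFin \o (fun x => H x (enorm (grad u x)))).
Proof.
move=> ru; have := integrable_H_grad ler01 ru.
by under [X in EFin \o X]eq_fun do rewrite mul1r.
Qed.

Lemma integrable_dp_A u v : regular u -> regular v ->
  lam.-integrable Om (EFin \o (fun x => edot (vec x (grad u x)) (grad v x))).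
Proof.
move=> ru rv.
have mvec : measurable_field Om (fun x => vec x (grad u x)).
  by apply: (measurable_field_dp_vec D); exact: regular_field.
have me : measurable_fun Om (fun x => edot (vec x (grad u x)) (grad v x)).
  by apply: measurable_edot => //; exact: regular_field.
have ig := integrableD mO (integrable_H_grad (ler0n _ 2) ru) (integrable_H_grad1 rv).
apply: (integrable_le mO me ig) => x Ox; exact: edot_dp_vec_le.
Qed.

Lemma dp_AE u v : A u v = \int[lam]_(x in Om) edot (vec x (grad u x)) (grad v x).
Proof. by apply: eq_Rintegral => x _; rewrite dp_A_integrandE. Qed.

Lemma gradient_energyE u : I u = \int[lam]_(x in Om) H x (enorm (grad u x)).
Proof. by apply: eq_Rintegral => x _; rewrite dp_HE ?enorm_ge0. Qed.

Lemma dp_A_lin u (a : R) v w : regular u -> regular v -> regular w ->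
  A u (a *: v + w) = a * A u v + A u w.
Proof.
move=> ru rv rw; have rvw := regular_lin oO D a rv rw.
have iv := integrable_dp_A ru rv; have iw := integrable_dp_A ru rw.
rewrite !dp_AE -RintegralZl// -RintegralD//; last exact: (integrableZl mO a iv).
have mE z : regular z -> measurable_fun Om (fun x => edot (vec x (grad u x)) (grad z x)).
  by move=> /(integrable_dp_A ru)/measurable_int/measurable_EFinP.
apply: Rintegral_ae_eq.
- exact: mE.
- by apply: measurable_funD; [apply: measurable_funM => //|]; exact: mE.
- have [dv _] := rv; have [dw _] := rw.
  have := grad_lin oO a dv dw; apply: filterS => x E Ox.
  by rewrite E// edotDr edotZr.
Qed.

Lemma grad_sub u w : regular u -> regular w ->
  \forall x \ae lam, Om x -> grad (w - u) x = grad w x - grad u x.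
Proof.
move=> [du _] [dw _]; have -> : w - u = -1 *: u + w by rewrite scaleN1r addrC.
by have := grad_lin oO (-1) du dw; apply: filterS => x E Ox; rewrite E// scaleN1r addrC.
Qed.

Lemma operator_increment u : regular u -> forall eps : R, 0 < eps ->
  exists2 delta : R, 0 < delta & forall w, regular w -> N (w - u) < delta -> forall v, regular v ->
    (\int[lam]_(x in Om)
       (enorm (vec x (grad w x) - vec x (grad u x)) * enorm (grad v x))%:E <= (eps * N v)%:E)%E.
Proof.
move=> ru eps eps0; have mgu := regular_field ru; have [_ eu] := ru.
have [delta delta0 Hd] := integral_operator_increment D Q0 M0 lamO mgu eu eps0.
exists delta => // w rw wu v rv.
have mgw := regular_field rw.
have rwu := regularB oO D rw ru.
have wu1 : (rho (fun x => (delta^-1 * enorm (grad w x - grad u x))%R) <= 1)%E.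
  apply: le_trans (regular_norm_lt D rwu wu); apply: (rho_le D).
  - apply: nonneg_measurableZ; first by rewrite invr_ge0 ltW.
    split; last by move=> x; exact: enorm_ge0.
    by apply: measurable_enorm; exact: measurable_fieldB.
  - by apply: nonneg_measurableZ; [rewrite invr_ge0 ltW|exact: regular_nonneg_measurable].
  - by have := grad_sub ru rw; apply: filterS => x E Ox; rewrite E.
have [mv v0] := regular_nonneg_measurable rv.
pose b x := enorm (vec x (grad w x) - vec x (grad u x)).
have mb : measurable_fun Om b.
  by apply: measurable_enorm; apply: measurable_fieldB; exact: (measurable_field_dp_vec D).
have b0 x : 0 <= b x by exact: enorm_ge0.
(* The level [l] stays strictly above [N v], which may be 0 and need not be attained as an infimum;
   it is then taken to be [N v + e / eps] with [e] arbitrary. *)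
have scaled l : 0 < l -> N v < l ->
    (\int[lam]_(x in Om) (b x * enorm (grad v x))%:E <= (l * eps)%:E)%E.
  move=> l0 vl; have rl := regular_norm_lt D rv vl.
  have il0 : 0 <= l^-1 by rewrite invr_ge0 ltW.
  have [mlv lv0] := nonneg_measurableZ il0 (regular_nonneg_measurable rv).
  have := Hd _ _ mgw wu1 mlv lv0 rl.
  have nbv x : Om x -> (0 <= (b x * (l^-1 * enorm (grad v x)))%:E)%E.
    by move=> _; rewrite lee_fin mulr_ge0.
  have mbv : measurable_fun Om (EFin \o (fun x => b x * (l^-1 * enorm (grad v x)))).
    by apply/measurable_EFinP; exact: measurable_funM.
  move=> le_eps; rewrite EFinM.
  apply: le_trans (lee_wpmul2l _ le_eps); last by rewrite lee_fin ltW.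
  rewrite -(ge0_integralZl_EFin lam mO nbv mbv (ltW l0)).
  rewrite le_eqVlt; apply/orP; left; apply/eqP; apply: eq_integral => x _.
  by rewrite -EFinM mulrCA mulVKf// gt_eqF.
apply/lee_addgt0Pr => e e0.
have l0 : 0 < N v + e / eps by rewrite ltr_wpDl ?divr_gt0//; exact: W1H_norm_ge0.
have Nl : N v < N v + e / eps by rewrite ltrDl divr_gt0.
apply: le_trans (scaled _ l0 Nl) _.
by rewrite -EFinD lee_fin mulrDl divfK ?gt_eqF// mulrC.
Qed.

Lemma dp_A_dist u (eps : R) : regular u -> 0 < eps ->
  exists2 delta : R, 0 < delta & forall w, regular w -> N (w - u) < delta -> forall v, regular v ->
    `|A w v - A u v| <= eps * N v.
Proof.
move=> ru eps0; have [delta delta0 Hd] := operator_increment ru eps0.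
exists delta; first exact: delta0.
move=> w rw wu v rv; have Hw := Hd w rw wu v rv.
have iw := integrable_dp_A rw rv; have iu := integrable_dp_A ru rv.
rewrite (dp_AE w) (dp_AE u).
rewrite -(RintegralB mO iw iu).
apply: (Rintegral_norm_le _ _ _ Hw).
- exact: (integrableB mO iw iu).
- apply: measurable_funM; last by have [] := regular_nonneg_measurable rv.
  by apply: measurable_enorm; apply: measurable_fieldB; apply: (measurable_field_dp_vec D);
    exact: regular_field.
- move=> x Ox; rewrite -mulN1r -edotZl scaleN1r -edotDl; exact: cauchy_schwarz.
Qed.

(* By convexity the remainder lies between [0] and the integral of
   [edot (vec x (grad w x) - vec x (grad u x)) (grad v x)], where [w = u + v]. *)
Lemma energy_remainder u (eps : R) : regular u -> 0 < eps ->
  exists2 delta : R, 0 < delta & forall v, regular v -> N v < delta ->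
    `|I (u + v) - I u - A u v| <= eps * N v.
Proof.
have arith (e1 e2 h1 h2 n : R) : e1 <= h1 - h2 -> -1 * e2 <= h2 - h1 ->
    e2 + -1 * e1 <= n -> `|h1 - h2 - e1| <= n.
  by move=> low up cs; rewrite ger0_norm ?subr_ge0//; lra.
move=> ru eps0; have [delta delta0 Hd] := operator_increment ru eps0.
exists delta; first exact: delta0.
move=> v rv vd; have [w wE] : exists w, w = u + v by exists (u + v).
have rw : regular w by rewrite wE; exact: (regularD oO D ru rv).
have wuE : w - u = v by rewrite wE addrAC subrr add0r.
have wu : N (w - u) < delta by rewrite wuE.
have gv : \forall x \ae lam, Om x -> grad v x = grad w x - grad u x.
  by rewrite -wuE; exact: (grad_sub ru rw).
have mgu := regular_field ru; have mgw := regular_field rw; have mgv := regular_field rv.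
have mZ : measurable_field Om (fun x => grad w x - grad u x) by exact: measurable_fieldB.
have mvu : measurable_field Om (fun x => vec x (grad u x)) by exact: (measurable_field_dp_vec D).
have mvw : measurable_field Om (fun x => vec x (grad w x)) by exact: (measurable_field_dp_vec D).
have iZ : lam.-integrable Om (EFin \o (fun x => edot (vec x (grad u x)) (grad w x - grad u x))).
  have i2u := integrable_H_grad (ler0n R 2) ru; have i2w := integrable_H_grad (ler0n R 2) rw.
  apply: (integrable_le mO (measurable_edot mvu mZ) (integrableD mO i2u (integrableD mO i2w i2u))).
  move=> x Ox; apply: le_trans (edot_dp_vec_le _ _ Ox) _; rewrite lerD2l.
  have hn := nfun_dp_h D Ox.
  apply: le_trans (prim_add hn (enorm_ge0 _) (enorm_ge0 _)).
  apply: (prim_le hn (enorm_ge0 _)); apply: le_trans (enormD _ _) _.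
  by rewrite enormN.
have iw := integrable_H_grad1 rw; have iu := integrable_H_grad1 ru.
have Auv : A u v = \int[lam]_(x in Om) edot (vec x (grad u x)) (grad w x - grad u x).
  rewrite (dp_AE u v); apply: Rintegral_ae_eq.
  - exact: (measurable_edot mvu mgv).
  - exact: (measurable_edot mvu mZ).
  - by apply: filterS gv => x E Ox; rewrite E.
have iwu : lam.-integrable Om (EFin \o (fun x => H x (enorm (grad w x)) - H x (enorm (grad u x)))).
  exact: (integrableB mO iw iu).
rewrite -wE Auv (gradient_energyE w) (gradient_energyE u).
rewrite -(RintegralB mO iw iu) -(RintegralB mO iwu iZ).
have mb : measurable_fun Om (fun x => enorm (vec x (grad w x) - vec x (grad u x))).
  exact: (measurable_enorm (measurable_fieldB mvw mvu)).
apply: (@Rintegral_norm_le _ (fun x => enorm (vec x (grad w x) - vec x (grad u x)) *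
   enorm (grad w x - grad u x))).
- exact: (integrableB mO iwu iZ).
- exact: (measurable_funM mb (measurable_enorm mZ)).
- move=> x Ox.
  have low := edot_dp_vec_convex (grad u x) (grad w x) Ox.
  have := edot_dp_vec_convex (grad w x) (grad u x) Ox.
  rewrite -(opprB (grad w x)) -scaleN1r edotZr => up.
  have := edot_le (vec x (grad w x) - vec x (grad u x)) (grad w x - grad u x).
  rewrite edotDl -(scaleN1r (vec x (grad u x))) (edotZl (-1) (vec x (grad u x))) => cs.
  exact: (arith _ _ _ _ _ low up cs).
- apply: le_trans (Hd w rw wu v rv); rewrite le_eqVlt; apply/orP; left; apply/eqP.
  apply: ae_eq_integral.
  + exact: mO.
  + by apply/measurable_EFinP; exact: (measurable_funM mb (measurable_enorm mZ)).
  + by apply/measurable_EFinP; exact: (measurable_funM mb (measurable_enorm mgv)).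
  + by apply: filterS gv => x E Ox; rewrite E.
Qed.

Lemma dp_A_bounded u : regular u ->
  exists C, forall v, regular v -> N v <= 1 -> `|A u v| <= C.
Proof.
move=> ru; have iu := integrable_H_grad (ler0n R 2) ru.
have [J JE] : exists J, (\int[lam]_(x in Om) (H x (2 * enorm (grad u x)))%:E = J%:E)%E.
  by eexists; rewrite -[LHS]fineK//; exact: integrable_fin_num iu.
(* The strict bound [N v < 2] gives [v / 2] a gradient energy of at most 1; the pairing is estimated
   on [v / 2] and doubled. *)
exists (2 * (J + 1)) => v rv v1.
have v2 : N v < 2 by rewrite (le_lt_trans v1)// ltr1n.
have rv2 := regular_norm_lt D rv v2.
have i20 : 0 <= 2^-1 :> R by rewrite invr_ge0.
have nv2 := nonneg_measurableZ i20 (regular_nonneg_measurable rv).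
have nu2 := nonneg_measurableZ (ler0n R 2) (regular_nonneg_measurable ru).
have mHu := measurable_H_comp D nu2; have mHv := measurable_H_comp D nv2.
have mHu' : measurable_fun Om (fun x => H x (2 * enorm (grad u x))) by move/measurable_EFinP : mHu.
have mHv' : measurable_fun Om (fun x => H x (2^-1 * enorm (grad v x))) by move/measurable_EFinP : mHv.
rewrite dp_AE; apply: (@Rintegral_norm_le _ (fun x => 2 * (H x (2 * enorm (grad u x)) +
    H x (2^-1 * enorm (grad v x))))).
- exact: integrable_dp_A.
- exact: (measurable_funM (measurable_cst _) (measurable_funD mHu' mHv')).
- move=> x Ox.
  have := edot_dp_vec_le (grad u x) (2^-1 *: grad v x) Ox.
  by rewrite edotZr normrM enormZ (ger0_norm i20) ler_pdivrMl.
- under eq_integral do rewrite EFinM EFinD.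
  have H1 x : Om x -> (0 <= (H x (2 * enorm (grad u x)))%:E)%E by exact: (H_comp_ge0 D nu2).
  have H2 x : Om x -> (0 <= (H x (2^-1 * enorm (grad v x)))%:E)%E by exact: (H_comp_ge0 D nv2).
  have H12 x : Om x -> (0 <= (H x (2 * enorm (grad u x)))%:E + (H x (2^-1 * enorm (grad v x)))%:E)%E.
    by move=> Ox; apply: adde_ge0; [exact: H1|exact: H2].
  rewrite (ge0_integralZl_EFin lam mO H12 (emeasurable_funD mHu mHv) (ler0n R 2)).
  rewrite (ge0_integralD lam mO H1 mHu H2 mHv) EFinM.
  apply: lee_wpmul2l; first by rewrite lee_fin.
  by rewrite [leRHS]EFinD; apply: leeD; [rewrite JE|exact: rv2].
Qed.

(** Well-definedness of [I]: meant for a weak gradient [G] of any function equal to [u] almost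
    everywhere. *)
Lemma gradient_energy_ae u G : regular u -> measurable_field Om G ->
  (\forall x \ae lam, Om x -> G x = grad u x) ->
  lam.-integrable Om (EFin \o (fun x => dp_H p q mu x (enorm (G x)))) /\
  \int[lam]_(x in Om) dp_H p q mu x (enorm (G x)) = I u.
Proof.
move=> ru mG Gu.
have nG : nonneg_measurable Om (fun x => enorm (G x)).
  by split; [exact: measurable_enorm|move=> x; exact: enorm_ge0].
have mHG : measurable_fun Om (fun x => H x (enorm (G x))).
  by have /measurable_EFinP := measurable_H_comp D nG.
have mHu : measurable_fun Om (fun x => H x (enorm (grad u x))).
  by have /measurable_EFinP := measurable_H_comp D (regular_nonneg_measurable ru).
have E : (fun x => dp_H p q mu x (enorm (G x))) = (fun x => H x (enorm (G x))).
  by apply/funext => x; rewrite dp_HE ?enorm_ge0.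
rewrite E gradient_energyE; split.
  apply/integrableP; split; first by apply/measurable_EFinP; exact: mHG.
  have -> : (\int[lam]_(x in Om) `|(EFin \o (fun x => H x (enorm (G x)))) x| =
      rho (fun x => enorm (G x)))%E.
    by apply: eq_integral => x /set_mem Ox; rewrite gee0_abs//; exact: (H_comp_ge0 D nG).
  have nu := regular_nonneg_measurable ru.
  apply: (@le_lt_trans _ _ (rho (fun x => enorm (grad u x)))).
    by apply: (rho_le D nG nu); apply: filterS Gu => x Gu Ox; rewrite Gu.
  have [_ eu] := ru.
  have eu1 : (rho (fun x => (1 * enorm (grad u x))%R) < +oo)%E by exact: eu.
  by move: eu1; under [X in rho X]eq_fun do rewrite mul1r.
apply: (Rintegral_ae_eq mHG mHu).
by apply: filterS Gu => x Gu Ox; rewrite Gu.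
Qed.

End functional.

(** * From the stated hypotheses to bounds at every point, and the conclusion *)

Unset Implicit Arguments.

Theorem proposition3p16 (R : realType) (d : nat) (Om : set 'rV[R]_d)
    (mu : 'rV[R]_d -> R) (p q : 'rV[R]_d -> R -> R)
    (d_ge2 : (2 <= d)%N)
    (Om_domain : bounded_domain Om)
    (Om_lipschitz : lipschitz_boundary Om)
    (mu_measurable : measurable_fun Om mu)
    (mu_bounded :
      (ess_sup_on (lebesgue_rV d) Om (fun x => `|mu x|%R) < +oo)%E)
    (mu_ge0 : \forall x \ae lebesgue_rV d, Om x -> 0 <= mu x)
    (p_ge2 : forall x t, Om x -> 0 <= t -> 2 <= p x t)
    (q_ge2 : forall x t, Om x -> 0 <= t -> 2 <= q x t)
    (p_caratheodory : caratheodory Om p)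
    (q_caratheodory : caratheodory Om q)
    (p_range : [/\ (2%:E <= exp_inf Om p)%E, (exp_inf Om p <= exp_sup Om p)%E &
                   (exp_sup Om p <= d%:R%:E)%E])
    (q_range : [/\ (2%:E <= exp_inf Om q)%E, (exp_inf Om q <= exp_sup Om q)%E &
                   (exp_sup Om q < +oo)%E])
    (p_le_q : \forall x \ae lebesgue_rV d, Om x ->
      forall t, 0 <= t -> p x t <= q x t)
    (p_shape : \forall x \ae lebesgue_rV d, Om x -> exponent_shape (p x))
    (q_shape : \forall x \ae lebesgue_rV d, Om x -> exponent_shape (q x))
    (mu_lipschitz : exists L : R, forall x y, closure Om x -> closure Om y ->
      `|mu x - mu y| <= L * enorm (x - y))
    (p_lipschitz : exists2 c : R, 0 < c & forall t x y, 0 <= t -> Om x -> Om y ->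
      `|p x t - p y t| <= c * enorm (x - y))
    (q_lipschitz : exists2 c : R, 0 < c & forall t x y, 0 <= t -> Om x -> Om y ->
      `|q x t - q y t| <= c * enorm (x - y))
    (gap : fine (exp_sup Om q) / fine (exp_inf Om p) < 1 + d%:R^-1) :
  let H := dp_H p q mu in
  let W := W01H Om H in
  let I := gradient_energy Om H in
  let A := dp_A p q mu Om in
  [/\ (* [I] is finite and depends neither on the representative of [u] nor on
         that of its weak gradient *)
      forall u v g, W u -> (\forall x \ae lebesgue_rV d, Om x -> v x = u x) ->
        weak_gradient Om v g ->
        (lebesgue_rV d).-integrable Om (fun x => (H x (enorm (g x)))%:E) /\
        \int[lebesgue_rV d]_(x in Om) H x (enorm (g x)) = I u,
      forall u v, W u -> W v ->
        (lebesgue_rV d).-integrable Om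
          (fun x => (dp_A_integrand p q mu Om u v x)%:E) &
      C1_with_derivative W (W1H_norm Om H) I A].
Proof.
move=> H W I A.
have [Om0 oO _ bO] := Om_domain.
have mO : measurable Om by exact: open_measurable_rV.
have lamO := lebesgue_bounded_lty mO bO.
have [M0 [M [M_ge0 muM]]] : (forall x, Om x -> 0 <= mu x) /\
    exists M, 0 <= M /\ forall x, Om x -> mu x <= M.
  have [L HL] := mu_lipschitz.
  (* The given [L] may be nonpositive; a positive constant is wanted, since the radius [e0] below
     divides by it. *)
  have muL x y : Om x -> Om y -> `|mu x - mu y| <= (`|L| + 1) * enorm (x - y).
    move=> Ox Oy; apply: le_trans (HL _ _ (subset_closure Ox) (subset_closure Oy)) _.
    by rewrite ler_wpM2r ?enorm_ge0// (le_trans (ler_norm _))// lerDl.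
  have L1 : 0 < `|L| + 1 by rewrite ltr_wpDl.
  split.
    move=> x Ox; rewrite leNgt; apply/negP => mux.
    have e0 : 0 < - mu x / (`|L| + 1) by rewrite divr_gt0// oppr_gt0.
    have [y [Oy muy xy]] := ae_dense oO mu_ge0 Ox e0.
    have := muL x y Ox Oy; rewrite ltr_pdivlMr// mulrC in xy.
    by move=> /le_lt_trans/(_ xy); rewrite ltr_norml; lra.
  have [x0 Ox0] := Om0; have [K OK] := bounded_sub_cbox bO.
  have [B B0 HB] := continuous_compact_bounded (@enorm_continuous R d)
    (@compact_cbox _ _ (const_mx (- K)) (const_mx K)).
  have EB x : Om x -> enorm x <= B.
    by move=> Ox; have := HB x (OK x Ox); rewrite ger0_norm// enorm_ge0.
  exists (`|mu x0| + (`|L| + 1) * (B + B)); split.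
    by rewrite addr_ge0// mulr_ge0 ?addr_ge0.
  move=> x Ox.
  have -> : mu x = mu x0 + (mu x - mu x0) by rewrite addrC subrK.
  apply: lerD; first exact: ler_norm.
  apply: le_trans (ler_norm _) _; apply: le_trans (muL x x0 Ox Ox0) _.
  rewrite ler_wpM2l ?(ltW L1)//; apply: le_trans (enormD _ _) _.
  by rewrite enormN lerD ?EB.
have [cp cp0 pc] := p_lipschitz; have [cq cq0 qc] := q_lipschitz.
have [_ _ pd] := p_range; have [_ _ qoo] := q_range.
have [Qp pQ] := exp_sup_everywhere oO cp0 pc p_shape (le_lt_trans pd (ltry _)).
have [Qq qQ] := exp_sup_everywhere oO cq0 qc q_shape qoo.
pose Q := Num.max 0 (Num.max Qp Qq).
have Q_ge0 : 0 <= Q by rewrite le_max lexx.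
have D : dp_data Om p q mu Q M.
  split => //.
  - apply: (exponent_everywhere oO cp0 pc p_shape p_ge2) => x t Ox t0.
    by rewrite !le_max (pQ x t Ox t0) !orbT.
  - apply: (exponent_everywhere oO cq0 qc q_shape q_ge2) => x t Ox t0.
    by rewrite !le_max (qQ x t Ox t0) !orbT.
  - by move=> x Ox; rewrite M0//= muM.
  - by move=> t t0; have [mp _] := p_caratheodory; exact: mp.
  - by move=> t t0; have [mq _] := q_caratheodory; exact: mq.
have Wreg u : W u -> regular Om p q mu u by exact: (W_regular oO D lamO).
have wd u : W u -> weakly_differentiable Om u by move=> /Wreg[].
split.
- move=> u v g Wu vu vg; apply: (gradient_energy_ae D (Wreg u Wu)).
    exact: weak_gradient_measurable vg.
  exact: (weak_gradient_unique oO vu vg (grad_weak_gradient (wd u Wu))).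
- move=> u v Wu Wv; have := integrable_dp_A D (Wreg u Wu) (Wreg v Wv).
  by apply: eq_integrable => // x _; rewrite /= dp_A_integrandE.
- split.
  + move=> u Wu; have ru := Wreg u Wu; split.
      split.
        by move=> a v w Wv Ww; exact: (dp_A_lin oO D _ ru (Wreg v Wv) (Wreg w Ww)).
      have [C HC] := dp_A_bounded D ru.
      apply: (@le_lt_trans _ _ C%:E); last exact: ltry.
      apply: ge_ereal_sup => _ [v [Wv v1] <-]; rewrite lee_fin; exact: HC (Wreg v Wv) v1.
    move=> eps eps0; have [delta delta0 Hd] := energy_remainder oO D Q_ge0 M_ge0 lamO ru eps0.
    by exists delta => // v Wv; exact: Hd (Wreg v Wv).
  + move=> u Wu eps eps0; have ru := Wreg u Wu.
    have [delta delta0 Hd] := dp_A_dist oO D Q_ge0 M_ge0 lamO ru eps0.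
    exists delta => // w Ww wu; apply: ge_ereal_sup => _ [v [Wv v1] <-]; rewrite lee_fin.
    apply: le_trans (Hd w (Wreg w Ww) wu v (Wreg v Wv)) _.
    by rewrite ler_piMr// ltW.
Qed.
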